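(* Let $(\Gamma,\pi)$ be a weighted graph, $\Gamma=(G,E)$, with at least two vertices, and let $\rho$ be a metric on $G$ adapted to the VSRW $(X_t)$ on $(\Gamma,\pi)$. Let $\mathcal X_{\text{loop}}(\Gamma,\ell,p,\omega)$ be the weighted metric graph with $\ell(e)=1$, $p(e)=\pi(e)$, $\omega(e)=\rho^2(\overline e,\underline e)$ for each $e\in E$ (where $\overline e,\underline e$ are the endpoints of $e$), and $\ell(x_{\text{loop}})=1$, $p(x_{\text{loop}})=\frac12$, $\omega(x_{\text{loop}})=1$ for each $x\in G$, and let $(Y_t)$ be Brownian motion on it. For a vertex $x$, let $\widetilde T$ be the first jump time of $X$ started at $x$, and let $T$ be the first time $Y$, started at $x$, hits a vertex different from $x$. Then there exists a constant $C_\rho>0$ such that for every $x\in G$ and every neighbour $x_j$ of $x$, $$\mathbb P^x(Y_T=x_j)=\widetilde{\mathbb P}^x(X_{\widetilde T}=x_j),\qquad \widetilde{\mathbb E}^x\widetilde T\le\mathbb E^xT\le(C_\rho+1)\,\widetilde{\mathbb E}^x\widetilde T,$$ where $\mathbb P^x,\mathbb E^x$ refer to $Y$ and $\widetilde{\mathbb P}^x,\widetilde{\mathbb E}^x$ to $X$, both started at $x$. Additionally, if $d_\rho$ is the metric induced by the edge weights $\rho(e):=\rho(\overline e,\underline e)$, then $\rho(x,y)\le d_\rho(x,y)$ for all $x,y\in G$.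
   Context: $\Gamma=(G,E)$ is an unoriented, connected, countable, locally finite graph without loops or multiple edges. A weighted graph $(\Gamma,\pi)$ has symmetric nonnegative edge weights $\pi_{xy}=\pi_{yx}$ with $\pi_{xy}>0$ iff $\{x,y\}\in E$; $\pi(e)=\pi_{xy}$ for $e=\{x,y\}$; $\pi_x=\sum_y\pi_{xy}$. $E(x)$ is the set of (non-loop) edges incident to $x$. The VSRW $(X_t)$ is the continuous-time Markov chain on $G$ with generator $(\mathcal L_Xf)(x)=\sum_{y\sim x}\pi_{xy}(f(y)-f(x))$; from $x$ it waits an exponential time with mean $1/\pi_x$ and jumps to $y$ with probability $\pi_{xy}/\pi_x$. A metric $\rho$ on $G$ is adapted to the VSRW if there is a constant $C\ge0$ with $\sum_{y\sim x}\pi_{xy}\rho^2(x,y)\le C$ for all $x\in G$. The metric induced by positive edge weights $(\alpha(e))_{e\in E}$ is $d_\alpha(x,y)=\inf\{\sum_{e\in\gamma}\alpha(e):\gamma\text{ a path joining }x\text{ and }y\}$. $\Gamma_{\text{loop}}=(G,E_{\text{loop}})$ is $\Gamma$ with a loop edge $x_{\text{loop}}$ added at every vertex $x$. Given $\ell(e),p(e),\omega(e)>0$ for $e\in E_{\text{loop}}$ (length, jump conductance, edge density), $\mathcal X_{\text{loop}}(\Gamma,\ell,p,\omega)$ is the metric graph obtained by identifying each edge $e$ with a copy $I(e)$ of $[0,\ell(e)]$, glued at common vertices. Let $m$ be Lebesgue measure on edges and $\mu(dx)=\sum_e\mathbf 1_{I(e)}(x)p(e)\omega(e)m(dx)$.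 Brownian motion $(Y_t)$ on it is the strong Markov diffusion associated with the Dirichlet form $\mathcal E(f,g)=\frac12\sum_{e}\int_{I(e)}f'g'\,p(e)\,dm$ on $L^2(\mu)$, whose domain consists of the continuous functions that are uniform limits of compactly supported continuous functions, lie in $W^{1,2}$ on every edge, and have $\sum_e\|f\|^2_{W^{1,2}(I(e),\mu)}<\infty$. Its generator acts as $\frac1{2\omega(e)}u''$ on $I(e)$, with the condition at each vertex $x$ that $\sum_{e\in E(x)}p(e)u'_e(x)+p(x_{\text{loop}})(u_1'(x_{\text{loop}})+u_2'(x_{\text{loop}}))=0$, where $u'_e(x)$ is the derivative at $x$ in the direction of $e$ and $u'_1,u_2'$ are the derivatives at $x$ into the two ends of the loop. *)

(* Defs.v *)
From HB Require Import structures.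
From mathcomp Require Import all_boot all_order all_algebra.
From mathcomp Require Import all_classical all_reals all_analysis.
From mathcomp Require Import measurable_realfun.

Set Implicit Arguments.
Unset Strict Implicit.
Unset Printing Implicit Defensive.
Import Order.TTheory GRing.Theory Num.Theory.
Import numFieldNormedType.Exports.
Local Open Scope classical_set_scope.
Local Open Scope ring_scope.

Section WeightedGraph.
Context {R : realType} {V : countType}.
Implicit Types (adj : rel V) (wt rho alpha : V -> V -> R).

Record weighted_graph adj wt : Prop := WeightedGraph {
  adj_sym : symmetric adj;
  adj_irr : irreflexive adj;
  adj_connected : forall x y, exists2 p, path adj x p & last x p = y;
  adj_locally_finite : forall x, finite_set [set y | adj x y];
  wt_sym : forall x y, wt x y = wt y x;
  wt_ge0 : forall x y, 0 <= wt x y;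
  wt_gt0 : forall x y, 0 < wt x y <-> adj x y }.

Definition vertex_weight adj wt (x : V) : R :=
  \sum_(y \in [set y | adj x y]) wt x y.

Record is_distance rho : Prop := IsDistance {
  distance_ge0 : forall x y, 0 <= rho x y;
  distance_eq0 : forall x y, rho x y = 0 <-> x = y;
  distance_sym : forall x y, rho x y = rho y x;
  distance_triangle : forall x y z, rho x z <= rho x y + rho y z }.

Definition adapted adj wt rho : Prop :=
  exists2 C : R, 0 <= C &
    forall x, \sum_(y \in [set y | adj x y]) (wt x y * rho x y ^+ 2) <= C.

(** The successive edges of the path [x :: p] are the pairs in [zip (x :: p) p]. *)
Definition path_metric adj alpha (x y : V) : R :=
  inf [set \sum_(e <- zip (x :: p) p) alpha e.1 e.2
      | p in [set p | path adj x p /\ last x p = y]].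

End WeightedGraph.

Definition first_time {R : realType} (A : set R) : \bar R :=
  ereal_inf (EFin @` [set t | 0 <= t /\ A t]).

Definition at_time {R : realType} {W S : Type} (X : R -> W -> S)
    (tau : W -> \bar R) (s : S) : set W :=
  [set w | exists2 t : R, tau w = t%:E & X t w = s].

Section Vsrw.
Context {R : realType} {V : countType} (adj : rel V) (wt : V -> V -> R).
Context {d : measure_display} {W : measurableType d}.
Local Notation deg := (vertex_weight adj wt).

(** The minimal chain with rates [wt x y], in its jump chain/holding time form.
    [Z] is the jump chain and [S] the sequence of holding times: under [P x],
    given [Z], the [S i] are independent exponential times of mean
    [1 / deg (Z i)]. The state [None] is reached at the explosion time. *)
Record jump_chain_realization (P : V -> probability W R)
    (X : R -> W -> option V) (Z : nat -> W -> V) (S : nat -> W -> R) : Prop := {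
  jump_chain_measurable : forall n y, measurable (Z n @^-1` [set y]);
  holding_time_measurable : forall n, measurable_fun setT (S n);
  holding_time_gt0 : forall n w, 0 < S n w;
  jump_law : forall (x : V) (n : nat) (z : nat -> V) (t : nat -> R),
    (forall i, 0 <= t i) ->
    P x [set w | (forall i, (i <= n)%N -> Z i w = z i) /\
                 (forall i, (i < n)%N -> t i < S i w)] =
    (if z 0%N == x then
       \prod_(i < n) (wt (z i) (z i.+1) / deg (z i) * expR (- deg (z i) * t i))
     else 0)%:E;
  jump_path : forall n w (t : R),
    \sum_(i < n) S i w <= t < \sum_(i < n.+1) S i w -> X t w = Some (Z n w);
  jump_path_explosion : forall w (t : R),
    (forall n, \sum_(i < n) S i w <= t) -> X t w = None }.

Definition is_vsrw (P : V -> probability W R) (X : R -> W -> option V) : Prop :=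
  exists Z S, jump_chain_realization P X Z S.

Definition first_jump_time (X : R -> W -> option V) (w : W) : \bar R :=
  first_time [set t | X t w <> X 0 w].

End Vsrw.

(** An edge [e] is the segment [[0, mg_len e]], its end [0] being [mg_src e] and
    its end [mg_len e] being [mg_tgt e]; the two may coincide (loops). *)
Record metric_graph (R : realType) := MetricGraph {
  mg_vertex : choiceType;
  mg_edge : choiceType;
  mg_src : mg_edge -> mg_vertex;
  mg_tgt : mg_edge -> mg_vertex;
  mg_len : mg_edge -> R;
  mg_cond : mg_edge -> R;
  mg_dens : mg_edge -> R }.
Arguments mg_src {R m}.
Arguments mg_tgt {R m}.
Arguments mg_len {R m}.
Arguments mg_cond {R m}.
Arguments mg_dens {R m}.

Inductive mg_point {R : realType} (M : metric_graph R) :=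
| Vtx of mg_vertex M
| Inner (e : mg_edge M) (t : R) of (0 < t < mg_len e).
Arguments Vtx {R M}.

(** The parametrization of the edge [e] by [[0, mg_len e]], extended to the
    real line by constants. *)
Definition mg_pt {R : realType} {M : metric_graph R} (e : mg_edge M) (t : R) :
    mg_point M :=
  match @idP (0 < t < mg_len e) with
  | ReflectT h => Inner h
  | ReflectF _ => if t <= 0 then Vtx (mg_src e) else Vtx (mg_tgt e)
  end.

Section Topology.
Context {R : realType} (M : metric_graph R).

HB.instance Definition _ := gen_eqMixin (mg_point M).
HB.instance Definition _ := gen_choiceMixin (mg_point M).

(** The final topology of the parametrizations, i.e. that of the gluing. *)
Definition mg_open : set (set (mg_point M)) :=
  [set U | forall e, open (mg_pt e @^-1` U : set R)].

Let mg_openT : mg_open setT.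
Proof. by move=> e; rewrite preimage_setT; exact: openT. Qed.

Let mg_openI : setI_closed mg_open.
Proof. by move=> A B hA hB e; rewrite preimage_setI; exact: openI. Qed.

Let mg_open_bigU (I : Type) (f : I -> set (mg_point M)) :
  (forall i, mg_open (f i)) -> mg_open (\bigcup_i f i).
Proof.
by move=> hf e; rewrite preimage_bigcup; apply: bigcup_open => i _; exact: hf.
Qed.

HB.instance Definition _ :=
  isOpenTopological.Build (mg_point M) mg_openT mg_openI mg_open_bigU.

End Topology.

Section DirichletForm.
Context {R : realType} (M : metric_graph R).
Local Notation E := (mg_edge M).
Local Notation m := (@lebesgue_measure R).

(** The integral of [Phi] against the measure with density [a e] with respect to
    Lebesgue measure on each edge [e]; [\esum] is for nonnegative families, so
    the sum over the edges is split into its positive and negative parts. *)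
Definition edge_integral (a : E -> R) (Phi : E -> R -> R) : \bar R :=
  let I e := ((a e)%:E *
    \int[m]_(t in `[0%R, mg_len e]) (Phi e t)%:E)%E in
  (\esum_(e in [set: E]) (I^\+ e) - \esum_(e in [set: E]) (I^\- e))%E.

Definition mu_integral (Phi : E -> R -> R) : \bar R :=
  edge_integral (fun e => mg_cond e * mg_dens e) Phi.

Definition inner_mu (f g : mg_point M -> R) : \bar R :=
  mu_integral (fun e t => f (mg_pt e t) * g (mg_pt e t)).

(** The form is a function of the weak derivatives, given edge by edge. *)
Definition energy (f' g' : E -> R -> R) : \bar R :=
  (2^-1%:E * edge_integral mg_cond (fun e t => (f' e t * g' e t)%R))%E.

(** [f] is continuous and in [W^{1,2}] on every edge, with weak derivative [f']:
    on a bounded interval, a function is in [W^{1,2}] iff it is the primitive of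
    a square integrable function. *)
Record sobolev (f : mg_point M -> R) (f' : E -> R -> R) : Prop := Sobolev {
  sobolev_continuous : continuous f;
  sobolev_measurable : forall e, measurable_fun `[0, mg_len e] (f' e);
  sobolev_L2 : forall e,
    (\int[m]_(t in `[0%R, mg_len e]) (f' e t ^+ 2)%:E < +oo)%E;
  sobolev_primitive : forall e t, 0 <= t <= mg_len e ->
    f (mg_pt e t) = f (mg_pt e 0) + \int[m]_(s in `[0, t]) f' e s }.

Definition compact_support (f : mg_point M -> R) : Prop := compact (closure [set z | f z != 0]).

Definition vanishes_at_infinity (f : mg_point M -> R) : Prop :=
  forall eps : R, 0 < eps -> exists g : mg_point M -> R,
    [/\ continuous g, compact_support g & forall z, `|f z - g z| <= eps].

Record form_domain (f : mg_point M -> R) (f' : E -> R -> R) : Prop := FormDomain {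
  form_sobolev : sobolev f f';
  form_C0 : vanishes_at_infinity f;
  form_W12 :
    (mu_integral (fun e t => (f (mg_pt e t) ^+ 2 + f' e t ^+ 2)%R) < +oo)%E;
  form_energy : (energy f' f' < +oo)%E }.

(** The form need not be closed on [form_domain], whereas the form of a
    semigroup is closed: this is the closure for the norm
    [(energy + inner_mu)^(1/2)]. Its elements have continuous versions since
    the norm controls the [W^{1,2}] norm on each edge. *)
Definition closed_form_domain (u : mg_point M -> R) (u' : E -> R -> R) :
    Prop :=
  sobolev u u' /\
  forall eps : R, 0 < eps -> exists (f : mg_point M -> R) (f' : E -> R -> R),
    let v' := fun e t => u' e t - f' e t in
    let v := fun z => u z - f z in
    form_domain f f' /\ (energy v' v' + inner_mu v v < eps%:E)%E.

End DirichletForm.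

Section BrownianMotion.
Context {R : realType} (M : metric_graph R).
Context {d : measure_display} {W : measurableType d}.

(** The state space is the metric graph with the cemetery [None] added as its
    point at infinity. *)
Local Notation opc := (one_point_compactification (mg_point M)).
Local Notation borel := (g_sigma_algebraType (@open opc)).

Variables (P : mg_point M -> probability W R) (Y : R -> W -> opc).

Definition natural_filtration (t : R) : set (set W) :=
  <<s [set A | exists (s : R) B, [/\ 0 <= s <= t, open B & A = Y s @^-1` B]] >>.

(** Stopping times of the right-continuous filtration
    [F_{t+} = \bigcap_(u > t) F_u], and the events prior to them. *)
Definition optional_time (tau : W -> \bar R) : Prop :=
  (forall w, 0 <= tau w)%E /\
  forall t : R, 0 < t -> natural_filtration t [set w | (tau w < t%:E)%E].

Definition prior_event (tau : W -> \bar R) (A : set W) : Prop :=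
  forall t : R, 0 < t ->
    natural_filtration t (A `&` [set w | (tau w < t%:E)%E]).

Definition transition (s : R) (B : set opc) (z : opc) : \bar R :=
  match z with
  | Some y => P y (Y s @^-1` B)
  | None => (\1_B z)%:E
  end.

Record strong_markov_diffusion : Prop := StrongMarkovDiffusion {
  bm_measurable : forall t : R, 0 <= t -> measurable_fun setT (Y t : W -> borel);
  bm_start : forall x, P x (Y 0 @^-1` [set Some x]) = 1%E;
  bm_continuous : forall w, {within `[0, +oo[, continuous (fun t => Y t w)};
  bm_cemetery : forall (s t : R) w, 0 <= s <= t -> Y s w = None -> Y t w = None;
  bm_transition : forall (s : R) (B : set borel), 0 <= s -> measurable B ->
    measurable_fun setT (transition s B : borel -> \bar R);
  bm_strong_markov : forall x tau A (s : R) (B : set borel),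
    optional_time tau -> prior_event tau A -> 0 <= s -> measurable B ->
    P x [set w | [/\ A w, (tau w < +oo)%E & B (Y (fine (tau w) + s) w)]] =
    (\int[P x]_(w in A `&` [set w | (tau w < +oo)%E])
       transition s B (Y (fine (tau w)) w))%E }.

Definition resolvent (a : R) (f : opc -> R) (x : mg_point M) : R :=
  \int[@lebesgue_measure R]_(t in `[0, +oo[)
    (expR (- a * t) * \int[P x]_w f (Y t w)).

(** The resolvent of the process is that of the form. A Borel function on the
    graph is extended by [0] at the cemetery. *)
Definition associated_with_form : Prop :=
  forall (a : R) (f : opc -> R), 0 < a ->
    measurable_fun setT (f : borel -> R) -> f None = 0 ->
    (inner_mu (f \o Some) (f \o Some) < +oo)%E ->
    exists2 u', closed_form_domain (resolvent a f) u' &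
      forall g g', form_domain g g' ->
        (energy u' g' + a%:E * inner_mu (resolvent a f) g =
         inner_mu (f \o Some) g)%E.

Definition is_brownian_motion : Prop :=
  strong_markov_diffusion /\ associated_with_form.

Definition vertex_hitting_time (x : mg_vertex M) (w : W) : \bar R :=
  first_time [set t | exists2 y, y <> x & Y t w = Some (Vtx y)].

End BrownianMotion.

Section LoopGraph.
Context {R : realType} {V : countType} (adj : rel V).

(** An unoriented edge [{x, y}] is represented by its orientation with
    [pickle x < pickle y]. *)
Definition graph_edge : Type :=
  {xy : V * V | adj xy.1 xy.2 && (pickle xy.1 < pickle xy.2)%N}.
HB.instance Definition _ := Countable.on graph_edge.

(** [inl e] is an edge of the graph and [inr x] the loop at [x]. *)
Definition loop_edge : Type := (graph_edge + V)%type.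
HB.instance Definition _ := Countable.on loop_edge.

Definition loop_src (e : loop_edge) : V :=
  match e with inl e => (val e).1 | inr x => x end.
Definition loop_tgt (e : loop_edge) : V :=
  match e with inl e => (val e).2 | inr x => x end.

Definition X_loop (len cond dens : loop_edge -> R) : metric_graph R :=
  @MetricGraph R V loop_edge loop_src loop_tgt len cond dens.

Definition adapted_X_loop (wt rho : V -> V -> R) : metric_graph R :=
  X_loop (fun=> 1)
    (fun e => match e with
              | inl e => wt (val e).1 (val e).2
              | inr _ => 2^-1
              end)
    (fun e => match e with
              | inl e => rho (val e).1 (val e).2 ^+ 2
              | inr _ => 1
              end).

End LoopGraph.

(* Main.v *)
(** The generator of [Y] acts explicitly on continuous functions which are quadratic on every
    edge with finitely many nonzero coefficients. A loop of conductance [1/2] can be curved to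
    absorb the defect of the Kirchhoff condition at its vertex, so that the values at the
    vertices and the curvatures of the other edges are arbitrary. Uniqueness of weak solutions
    then identifies such a function [u] with the resolvent of [alpha u - L u], and the strong
    Markov property at the first visit [T] to another vertex gives
      [u x = E (int_0^T exp (- alpha t) (alpha u - L u) (Y_t) dt) + E (exp (- alpha T) u (Y_T))].
    Before [T] the path stays in the open star of [x]. Letting [alpha] tend to [0]:
    - if [L u = -1] on the star and [u] vanishes at the other vertices, then
      [E T = u x = (1 + sum_y pi_xy rho(x, y)^2) / pi_x];
    - if [L u = 0] on the star and, among the other vertices, [u] is [1] at [x_j] and [0]
      elsewhere, then [P (Y_T = x_j) = u x = pi_(x x_j) / pi_x].
    The first jump time of [X] has mean [1 / pi_x], and adaptedness bounds the sum above. *)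

Require Import Defs.
From HB Require Import structures.
From mathcomp Require Import all_boot all_order all_algebra.
From mathcomp Require Import all_classical all_reals all_analysis.
From mathcomp Require Import measurable_realfun.
From mathcomp Require Import ring lra.

Set Implicit Arguments.
Unset Strict Implicit.
Unset Printing Implicit Defensive.
Import Order.TTheory GRing.Theory Num.Theory.
Import numFieldNormedType.Exports.
Local Open Scope classical_set_scope.
Local Open Scope ring_scope.

(** * Uniqueness of weak solutions *)

(** The strong Markov property is given for events at one fixed time after an optional time, whereas
    the argument needs expectations of integrals over time: laws are turned into expectations by
    pushforward, and time is integrated against the exponential density by Fubini. It is not known
    beforehand that [T] is finite, nor that a vertex is occupied at time [T]. Put
    [theta = E (1 - exp (- alpha T))]. If [L u = - b] on the star and [K] bounds [|u|], confinement
    to the star yields one estimate, with [K] independent of [alpha]: [|alpha u x - alpha (u x_j) E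
    (exp (- alpha T); Y_T = x_j) - b theta| <= alpha K theta]. For [b = 1] and [u x_j = 0], division
    by [alpha] and monotone convergence give the finiteness of [E T] together with its value. For
    [b = 0] and [u x_j = 1], that finiteness makes [theta] of order [alpha], so the error vanishes
    in the limit. The number [u x] is forced by the vertex condition at [x], whose loop must have
    curvature [b]: [sum_y pi_xy (u y - u x + b rho(x, y)^2) = - b]. *)

Section Tsum.
Context {R : realType} {T : choiceType}.
Implicit Types f g : T -> R.

Definition rsummable f := summable [set: T] (EFin \o f).

(** The same splitting as in [edge_integral], which is thus an instance of it. The real number
    [tsum] is meaningful on summable families, where real algebra replaces extended arithmetic. *)
Definition esum_posneg f : \bar R :=
  (\esum_(e in [set: T]) (EFin \o f)^\+ e - \esum_(e in [set: T]) (EFin \o f)^\- e)%E.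

Definition tsum f : R := fine (esum_posneg f).

Lemma rsummableD f g : rsummable f -> rsummable g -> rsummable (f \+ g).
Proof. exact: summableD. Qed.

Lemma rsummableN f : rsummable f -> rsummable (\- f).
Proof. by rewrite /rsummable summableN. Qed.

Lemma rsummableB f g : rsummable f -> rsummable g -> rsummable (f \- g).
Proof. exact: summableB. Qed.

Lemma rsummable_le f g : (forall e, `|f e| <= `|g e|) -> rsummable g -> rsummable f.
Proof.
by move=> fg; apply: le_lt_trans; apply: le_esum => e _ /=; rewrite lee_fin.
Qed.

Lemma esum_posnegE f : rsummable f -> esum_posneg f = (tsum f)%:E.
Proof.
move=> sf; rewrite fineK// fin_numB; apply/andP; split.
  rewrite (_ : esum _ _ = \esum_(e in [set: T]) `|(EFin \o f)^\+ e|)%E.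
    by rewrite -summableE; exact: summable_funepos.
  by apply: eq_esum => e _; rewrite gee0_abs.
rewrite (_ : esum _ _ = \esum_(e in [set: T]) `|(EFin \o f)^\- e|)%E.
  by rewrite -summableE; exact: summable_funeneg.
by apply: eq_esum => e _; rewrite gee0_abs.
Qed.

Lemma ge0_esum_posneg f : (forall e, 0 <= f e) ->
  esum_posneg f = \esum_(e in [set: T]) (f e)%:E.
Proof.
move=> f0; rewrite /esum_posneg [X in (_ - X)%E]esum1 => [|e _].
  rewrite sube0; apply: eq_esum => e _.
  by rewrite funeposE; apply/max_idPl; rewrite lee_fin.
by rewrite funenegE; apply/max_idPr; rewrite leeNl oppe0 lee_fin.
Qed.

Lemma tsum_ge0 f : (forall e, 0 <= f e) -> 0 <= tsum f.
Proof.
move=> f0; rewrite fine_ge0// ge0_esum_posneg//.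
by apply: esum_ge0 => e _; rewrite lee_fin.
Qed.

Lemma le_tsum f e : rsummable f -> (forall e, 0 <= f e) -> f e <= tsum f.
Proof.
move=> sf f0; rewrite -lee_fin -esum_posnegE// ge0_esum_posneg//.
apply: esum_ge; exists [set e]; first by split => //; exact: finite_set1.
by rewrite fsbig_set1.
Qed.

Lemma tsum_posneg f g : rsummable f -> rsummable g ->
  (forall e, 0 <= f e) -> (forall e, 0 <= g e) -> tsum (f \- g) = tsum f - tsum g.
Proof.
move=> sf sg f0 g0; apply: EFin_inj; rewrite -esum_posnegE ?EFinB; last exact: rsummableB.
rewrite -!esum_posnegE// ![in RHS]ge0_esum_posneg//.
by rewrite -(esumB sf sg)// => e _; rewrite lee_fin.
Qed.

Lemma ge0_tsumD f g : rsummable f -> rsummable g ->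
  (forall e, 0 <= f e) -> (forall e, 0 <= g e) -> tsum (f \+ g) = tsum f + tsum g.
Proof.
move=> sf sg f0 g0; apply: EFin_inj.
rewrite EFinD -!esum_posnegE//; last exact: rsummableD.
rewrite !ge0_esum_posneg//; last by move=> e; exact: addr_ge0.
by rewrite -esumD// => e _; rewrite lee_fin.
Qed.

Lemma rsummable_funrpos f : rsummable f -> rsummable f^\+%R.
Proof.
apply: rsummable_le => e; rewrite ger0_norm ?funrpos_ge0//.
by rewrite -[leRHS](congr1 (@^~ e) (funrposDneg f)) lerDl funrneg_ge0.
Qed.

Lemma rsummable_funrneg f : rsummable f -> rsummable f^\-%R.
Proof. by move=> /rsummableN/rsummable_funrpos; rewrite funrposN. Qed.

(** Positive parts do not commute with subtraction. Writing [f - g] as the difference of the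
    nonnegative families [f^+ + g^-] and [f^- + g^+] reduces the claim to the nonnegative case. *)
Lemma tsumB f g : rsummable f -> rsummable g -> tsum (f \- g) = tsum f - tsum g.
Proof.
move=> sf sg.
have := (rsummable_funrpos sf, rsummable_funrneg sf).
have := (rsummable_funrpos sg, rsummable_funrneg sg).
move=> -[gp gn] [fp fn].
have -> : f \- g = (f^\+%R \+ g^\-%R) \- (f^\-%R \+ g^\+%R).
  apply/funext => e.
  have hf : f e = f^\+%R e - f^\-%R e by rewrite -[LHS](congr1 (@^~ e) (funrposBneg f)).
  have hg : g e = g^\+%R e - g^\-%R e by rewrite -[LHS](congr1 (@^~ e) (funrposBneg g)).
  by rewrite /= {1}hf {1}hg; ring.
have -> : tsum f = tsum f^\+%R - tsum f^\-%R.
  by rewrite -tsum_posneg//; congr tsum; rewrite -[LHS](funrposBneg f).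
have -> : tsum g = tsum g^\+%R - tsum g^\-%R.
  by rewrite -tsum_posneg//; congr tsum; rewrite -[LHS](funrposBneg g).
rewrite tsum_posneg ?ge0_tsumD//; [ring|exact: rsummableD|exact: rsummableD|..].
- by move=> e; exact: addr_ge0.
- by move=> e; exact: addr_ge0.
Qed.

End Tsum.

(** Stands in for Cauchy-Schwarz: it suffices for products of square integrable functions to be
    integrable. *)
Lemma normM_le_sqrD {R : realDomainType} (x y : R) : `|x * y| <= x ^+ 2 + y ^+ 2.
Proof.
rewrite normrM -(real_normK (num_real x)) -(real_normK (num_real y)).
have := sqr_ge0 (`|x| - `|y|); have := normr_ge0 x; have := normr_ge0 y; nra.
Qed.

(** * Topology of the metric graph *)

Section GraphTopology.
Context {R : realType} {M : metric_graph R}.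

Lemma mg_openE (U : set (mg_point M)) :
  open U = forall e, open (mg_pt e @^-1` U : set R).
Proof. by []. Qed.

Lemma mg_pt_continuous (e : mg_edge M) : continuous (mg_pt e : R -> mg_point M).
Proof. by apply/continuousP => A; exact. Qed.

Lemma mg_pt0 (e : mg_edge M) (t : R) : t <= 0 -> mg_pt e t = Vtx (mg_src e).
Proof.
move=> t0; rewrite /mg_pt; destruct idP as [h|h]; last by rewrite t0.
by have := h; rewrite ltNge t0.
Qed.

Lemma mg_ptl (e : mg_edge M) (t : R) : 0 < mg_len e -> mg_len e <= t ->
  mg_pt e t = Vtx (mg_tgt e).
Proof.
move=> l0 lt; rewrite /mg_pt; destruct idP as [h|h].
  by have := h; rewrite [X in _ && X]ltNge lt andbF.
by rewrite leNgt (lt_le_trans l0 lt).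
Qed.

Lemma mg_pt_in (e : mg_edge M) (t : R) (h : 0 < t < mg_len e) : mg_pt e t = Inner h.
Proof.
rewrite /mg_pt; destruct idP as [h'|h'] => //.
by congr Inner; exact: bool_irrelevance.
Qed.

Lemma mg_continuous (T : topologicalType) (f : mg_point M -> T) :
  (forall e, continuous (fun t : R => f (mg_pt e t))) -> continuous f.
Proof.
move=> cf; apply/continuousP => A oA; rewrite mg_openE => e.
by have /continuousP := cf e; apply.
Qed.

End GraphTopology.

Lemma sqrB_le {R : realDomainType} (x y : R) :
  (x - y) ^+ 2 <= (x ^+ 2 + y ^+ 2) + (x ^+ 2 + y ^+ 2).
Proof. by have := sqr_ge0 (x + y); nra. Qed.

(** * Weighted square integrable functions on the edges *)

Section EdgeL2.
Context {R : realType} (M : metric_graph R).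
Local Notation E := (mg_edge M).
Local Notation m := (@lebesgue_measure R).
Local Notation I e := (`[0%R, mg_len e]%classic : set R).
Implicit Types (a : E -> R) (F G : E -> R -> R).

Record edgeL2 a F : Prop := EdgeL2 {
  edgeL2_measurable : forall e, measurable_fun (I e) (F e);
  edgeL2_integrable : forall e, m.-integrable (I e) (fun t => (F e t ^+ 2)%:E);
  edgeL2_summable : rsummable (fun e => a e * \int[m]_(t in I e) (F e t ^+ 2)) }.

Lemma edgeL2_integrableM a F G e : edgeL2 a F -> edgeL2 a G ->
  m.-integrable (I e) (fun t => (F e t * G e t)%:E).
Proof.
move=> [mF iF _] [mG iG _].
have iFG : m.-integrable (I e) (fun t => (F e t ^+ 2 + G e t ^+ 2)%:E).
  exact: integrableD (iF e) (iG e).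
apply: le_integrable iFG => //.
  by apply/measurable_EFinP; exact: measurable_funM (mF e) (mG e).
move=> t _; rewrite !abse_EFin lee_fin (le_trans (normM_le_sqrD _ _))//.
exact: ler_norm.
Qed.

Definition ip a F G (e : E) : R := a e * \int[m]_(t in I e) (F e t * G e t).

Lemma Rint_norm_ip F G e : m.-integrable (I e) (fun t => (F e t ^+ 2)%:E) ->
  m.-integrable (I e) (fun t => (G e t ^+ 2)%:E) ->
  m.-integrable (I e) (fun t => (F e t * G e t)%:E) ->
  `|\int[m]_(t in I e) (F e t * G e t)| <=
    \int[m]_(t in I e) (F e t ^+ 2) + \int[m]_(t in I e) (G e t ^+ 2).
Proof.
move=> iF iG iFG.
rewrite -RintegralD//; apply: le_trans (le_normr_Rintegral _ iFG) _ => //.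
apply: le_Rintegral => //.
- exact: integrable_norm.
- exact: integrableD iF iG.
by move=> t _ /=; exact: normM_le_sqrD.
Qed.

Lemma edgeL2_ip_summable a F G : (forall e, 0 <= a e) ->
  edgeL2 a F -> edgeL2 a G -> rsummable (ip a F G).
Proof.
move=> a0 lF lG.
apply: rsummable_le (rsummableD (edgeL2_summable lF) (edgeL2_summable lG)) => e /=.
rewrite -mulrDr !normrM ler_wpM2l// [leRHS]ger0_norm.
  apply: Rint_norm_ip; [exact: edgeL2_integrable lF e|exact: edgeL2_integrable lG e|].
  exact: edgeL2_integrableM lF lG.
by rewrite addr_ge0// Rintegral_ge0// => t _; exact: sqr_ge0.
Qed.

(** On square integrable families the extended-real integral is finite and equals a real bilinear
    expression, so the form can be expanded like an inner product. *)
Lemma edge_integral_ip a F G : (forall e, 0 <= a e) ->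
  edgeL2 a F -> edgeL2 a G ->
  edge_integral a (fun e t => F e t * G e t) = (tsum (ip a F G))%:E.
Proof.
move=> a0 lF lG; rewrite -esum_posnegE; last exact: edgeL2_ip_summable.
rewrite /esum_posneg (_ : EFin \o ip a F G = fun e =>
  (a e)%:E * \int[m]_(t in I e) (F e t * G e t)%:E)%E//.
apply/funext => e; rewrite /ip /= EFinM fineK//.
by apply: integrable_fin_num => //; exact: edgeL2_integrableM lF lG.
Qed.

Lemma ipBl a F G H e : edgeL2 a F -> edgeL2 a G -> edgeL2 a H ->
  ip a (fun e t => F e t - G e t) H e = ip a F H e - ip a G H e.
Proof.
move=> lF lG lH; rewrite /ip -mulrBr -RintegralB//.
- by congr (_ * _); apply: eq_Rintegral => t _; rewrite mulrBl.
- exact: edgeL2_integrableM lF lH.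
- exact: edgeL2_integrableM lG lH.
Qed.

Lemma ipC a F G e : ip a F G e = ip a G F e.
Proof. by congr (_ * _); apply: eq_Rintegral => t _; rewrite mulrC. Qed.

Lemma sqr_integrableB (D : set R) (f g : R -> R) : measurable D ->
  measurable_fun D f -> measurable_fun D g ->
  m.-integrable D (fun t => (f t ^+ 2)%:E) -> m.-integrable D (fun t => (g t ^+ 2)%:E) ->
  m.-integrable D (fun t => ((f t - g t) ^+ 2)%:E).
Proof.
move=> mD mf mg i_f ig.
have iD : m.-integrable D (fun t => (f t ^+ 2 + g t ^+ 2)%:E).
  exact: integrableD i_f ig.
have iDD : m.-integrable D
    (fun t => ((f t ^+ 2 + g t ^+ 2) + (f t ^+ 2 + g t ^+ 2))%:E).
  exact: (integrableD _ iD iD).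
apply: le_integrable iDD => //.
  by apply/measurable_EFinP; apply: measurable_funX; exact: measurable_funB.
move=> t _; rewrite !abse_EFin lee_fin ger0_norm ?sqr_ge0//.
by rewrite (le_trans (sqrB_le _ _))// ler_norm.
Qed.

Lemma edgeL2B a F G : (forall e, 0 <= a e) ->
  edgeL2 a F -> edgeL2 a G -> edgeL2 a (fun e t => F e t - G e t).
Proof.
move=> a0 lF lG.
have iD e : m.-integrable (I e) (fun t => (F e t ^+ 2 + G e t ^+ 2)%:E).
  exact: integrableD (edgeL2_integrable lF e) (edgeL2_integrable lG e).
have iDD e : m.-integrable (I e)
    (fun t => ((F e t ^+ 2 + G e t ^+ 2) + (F e t ^+ 2 + G e t ^+ 2))%:E).
  exact: integrableD (iD e) (iD e).
have iFG e : m.-integrable (I e) (fun t => ((F e t - G e t) ^+ 2)%:E).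
  by case: lF lG => mF iF _ [mG iG _]; apply: sqr_integrableB.
split => //.
  by move=> e; apply: measurable_funB; [exact: edgeL2_measurable lF e|exact: edgeL2_measurable lG e].
apply: rsummable_le (rsummableD (rsummableD (edgeL2_summable lF) (edgeL2_summable lG))
  (rsummableD (edgeL2_summable lF) (edgeL2_summable lG))) => e /=.
rewrite -!mulrDr !normrM ler_wpM2l//.
rewrite -!RintegralD//; [|exact: edgeL2_integrable lF e|exact: edgeL2_integrable lG e..].
rewrite !ger0_norm; [|apply: Rintegral_ge0 => t _..].
- by apply: le_Rintegral => // t _; exact: sqrB_le.
- by apply: le_trans (sqrB_le _ _); exact: sqr_ge0.
- exact: sqr_ge0.
Qed.

End EdgeL2.

(** * Finite norms and the orthogonality argument *)

Section Uniqueness.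
Context {R : realType} (M : metric_graph R).
Local Notation E := (mg_edge M).
Local Notation m := (@lebesgue_measure R).
Local Notation I e := (`[0%R, mg_len e]%classic : set R).
Local Notation edge_values f := (fun (e : E) (t : R) => f (mg_pt e t)).
Implicit Types (a : E -> R) (F G : E -> R -> R).
Hypothesis len_gt0 : forall e : E, 0 < mg_len e.

Lemma edgeL2N a F : edgeL2 a F -> edgeL2 a (fun e t => - F e t).
Proof.
move=> [mF iF sF]; split => [e|e|]; first exact: measurableT_comp.
- by apply: eq_integrable (iF e) => // t _; rewrite sqrrN.
- rewrite (_ : (fun e => _) = (fun e => a e * \int[m]_(t in I e) (F e t ^+ 2)))//.
  by apply/funext => e; congr (_ * _); apply: eq_Rintegral => t _; rewrite sqrrN.
Qed.

Lemma edge_integral_summable a F : (forall e, 0 <= a e) ->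
  (forall e t, 0 <= F e t) -> (forall e, m.-integrable (I e) (EFin \o F e)) ->
  (edge_integral a F < +oo)%E -> rsummable (fun e => a e * \int[m]_(t in I e) F e t).
Proof.
move=> a0 F0 iF; set J := (fun e => _).
have J0 e : 0 <= J e by rewrite mulr_ge0// Rintegral_ge0.
rewrite (_ : edge_integral a F = esum_posneg J).
  rewrite ge0_esum_posneg// /rsummable /summable; congr (_ < _)%E.
  by apply: eq_esum => e _; rewrite /= ger0_norm.
rewrite /esum_posneg (_ : EFin \o J = fun e => (a e)%:E * \int[m]_(t in I e) (F e t)%:E)%E//.
apply/funext => e; rewrite /J /= EFinM fineK//.
exact: integrable_fin_num.
Qed.

Lemma sobolev_edge_measurable (f : mg_point M -> R) f' : sobolev f f' ->
  forall e, measurable_fun (I e) (edge_values f e).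
Proof.
move=> [cf _ _ _] e; apply: measurable_funTS; apply: continuous_measurable_fun => t.
by apply: continuous_comp; [exact: mg_pt_continuous|exact: cf].
Qed.

Lemma sobolev_edge_sqr_integrable (f : mg_point M -> R) f' : sobolev f f' ->
  forall e, m.-integrable (I e) (fun t => (f (mg_pt e t) ^+ 2)%:E).
Proof.
move=> [cf _ _ _] e; apply: continuous_compact_integrable; first exact: segment_compact.
apply: continuous_subspaceT => t; apply: (@continuous_comp _ _ _ (edge_values f e) (fun x => x ^+ 2)).
  by apply: continuous_comp; [exact: mg_pt_continuous|exact: cf].
exact: exprn_continuous.
Qed.

Lemma sobolev_deriv_sqr_integrable (f : mg_point M -> R) f' : sobolev f f' ->
  forall e, m.-integrable (I e) (fun t => (f' e t ^+ 2)%:E).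
Proof.
move=> [_ mf' lf' _] e; apply/integrableP; split.
  by apply/measurable_EFinP; exact: measurable_funX (mf' e).
under eq_integral do rewrite gee0_abs ?lee_fin ?sqr_ge0//.
exact: lf'.
Qed.

(** No relation between [f] and [F] is imposed: the uniqueness argument only needs pairs that can be
    subtracted and on which the form is bilinear. *)
Definition finite_norm (f : mg_point M -> R) F :=
  edgeL2 (fun e => mg_cond e * mg_dens e) (edge_values f) /\ edgeL2 (@mg_cond R M) F.

Hypothesis cond_gt0 : forall e : E, 0 < mg_cond e.
Hypothesis dens_gt0 : forall e : E, 0 < mg_dens e.

Let half_lty (x : \bar R) : (2^-1%:E * x < +oo)%E -> (x < +oo)%E.
Proof.
case: x => [r _||]; [exact: ltry| |by rewrite ltNye].
by rewrite gt0_muley// lte_fin invr_gt0.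
Qed.

Let c_ge0 (e : E) : 0 <= mg_cond e.
Proof. exact: ltW. Qed.

Let cd_ge0 (e : E) : 0 <= mg_cond e * mg_dens e.
Proof. exact: mulr_ge0 (ltW (cond_gt0 e)) (ltW (dens_gt0 e)). Qed.

Lemma form_domain_finite_norm (f : mg_point M -> R) f' : form_domain f f' -> finite_norm f f'.
Proof.
move=> [sf _ W en].
have if2 := sobolev_edge_sqr_integrable sf.
have if2' := sobolev_deriv_sqr_integrable sf.
split; split => //.
- exact: sobolev_edge_measurable sf.
- have iW e : m.-integrable (I e) (EFin \o (fun t => f (mg_pt e t) ^+ 2 + f' e t ^+ 2)).
    exact: integrableD (if2 e) (if2' e).
  have F0 e t : 0 <= f (mg_pt e t) ^+ 2 + f' e t ^+ 2 by rewrite addr_ge0 ?sqr_ge0.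
  apply: rsummable_le (edge_integral_summable cd_ge0 F0 iW W) => e.
  rewrite !normrM ler_wpM2l ?mulr_ge0//.
  rewrite !ger0_norm ?Rintegral_ge0// => [|t _]; last exact: sqr_ge0.
  by apply: le_Rintegral => // t _; rewrite lerDl sqr_ge0.
- by case: sf.
- apply: edge_integral_summable => //.
  + by move=> e t; exact: sqr_ge0.
  + rewrite (_ : (fun e t => _) = (fun e t => f' e t * f' e t)); last first.
      by apply/funext => e; apply/funext => t; rewrite expr2.
    exact: half_lty en.
Qed.

Lemma edge_integral_ge0 a F : (forall e, 0 <= a e) ->
  (forall e t, 0 <= F e t) -> (0 <= edge_integral a F)%E.
Proof.
move=> a0 F0; have I0 e : (0 <= (a e)%:E * \int[m]_(t in I e) (F e t)%:E)%E.
  by rewrite mule_ge0 ?lee_fin// integral_ge0// => t _; rewrite lee_fin.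
rewrite /edge_integral [X in (_ - X)%E]esum1 => [|e _].
  by rewrite sube0; apply: esum_ge0 => e _.
by rewrite funenegE; apply/max_idPr; rewrite leeNl oppe0.
Qed.

(** One approximant [f] at squared distance less than [1] suffices: [u - f] has finite norm by the
    bound, and [f] because it lies in the form domain. *)
Lemma closed_form_domain_finite_norm (u : mg_point M -> R) u' :
  closed_form_domain u u' -> finite_norm u u'.
Proof.
move=> [su /(_ 1 ltr01)[f [f' [df lt1]]]].
have [sf _ _ _] := df; have [lf lf'] := form_domain_finite_norm df.
have mu e : measurable_fun (I e) (edge_values u e) by exact: (@sobolev_edge_measurable u u' su e).
have mf e : measurable_fun (I e) (edge_values f e) by exact: (@sobolev_edge_measurable f f' sf e).
have mu' e : measurable_fun (I e) (u' e) by exact: (@sobolev_measurable _ _ _ _ su e).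
have mf' e : measurable_fun (I e) (f' e) by exact: (@sobolev_measurable _ _ _ _ sf e).
have iuf e : m.-integrable (I e) (fun t => ((u (mg_pt e t) - f (mg_pt e t)) ^+ 2)%:E).
  apply: (@sqr_integrableB _ _ (edge_values u e) (edge_values f e)) => //.
    exact: sobolev_edge_sqr_integrable su e.
  exact: sobolev_edge_sqr_integrable sf e.
have iuf' e : m.-integrable (I e) (fun t => ((u' e t - f' e t) ^+ 2)%:E).
  apply: (@sqr_integrableB _ _ (u' e) (f' e)) => //.
    exact: sobolev_deriv_sqr_integrable su e.
  exact: sobolev_deriv_sqr_integrable sf e.
have sqrE (F : E -> R -> R) : (fun e t => F e t * F e t) = (fun e t => F e t ^+ 2).
  by apply/funext => e; apply/funext => t; rewrite expr2.
move: lt1; rewrite /energy /inner_mu /mu_integral.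
rewrite (sqrE (fun e t => u' e t - f' e t)) (sqrE (fun e t => u (mg_pt e t) - f (mg_pt e t))).
set A := edge_integral _ _; set B := edge_integral _ _ => lt1.
have A0 : (0 <= A)%E by apply: edge_integral_ge0 => // e t; exact: sqr_ge0.
have B0 : (0 <= B)%E by apply: edge_integral_ge0 => // e t; exact: sqr_ge0.
have Aoo : (A < +oo)%E.
  have : (2^-1%:E * A < +oo)%E.
    by apply: le_lt_trans (lt_trans lt1 (ltry 1)); rewrite leeDl.
  exact: half_lty.
have Boo : (B < +oo)%E.
  by apply: le_lt_trans (lt_trans lt1 (ltry 1)); rewrite leeDr// mule_ge0.
have L : edgeL2 (fun e => mg_cond e * mg_dens e) (fun e t => u (mg_pt e t) - f (mg_pt e t)).
  split => //.
    by move=> e; exact: measurable_funB (mu e) (mf e).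
  by apply: edge_integral_summable => // e t; exact: sqr_ge0.
have L' : edgeL2 mg_cond (fun e t => u' e t - f' e t).
  split => //.
    by move=> e; exact: measurable_funB (mu' e) (mf' e).
  by apply: edge_integral_summable => // e t; exact: sqr_ge0.
split.
  (* The sum [(u - f) + f] is written as a difference so that [edgeL2B] applies. *)
  rewrite (_ : edge_values u = fun e t => u (mg_pt e t) - f (mg_pt e t) - (- f (mg_pt e t))).
    by apply: edgeL2B => //; exact: edgeL2N.
  by apply/funext => e; apply/funext => t; ring.
rewrite (_ : u' = fun e t => u' e t - f' e t - (- f' e t)).
  by apply: edgeL2B => //; exact: edgeL2N.
by apply/funext => e; apply/funext => t; ring.
Qed.

Definition tip a F G : R := tsum (ip a F G).

Lemma tipBl a F G H : (forall e, 0 <= a e) -> edgeL2 a F -> edgeL2 a G -> edgeL2 a H ->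
  tip a (fun e t => F e t - G e t) H = tip a F H - tip a G H.
Proof.
move=> a0 lF lG lH; rewrite /tip -tsumB; [|exact: edgeL2_ip_summable..].
by congr tsum; apply/funext => e; rewrite (ipBl e lF lG lH).
Qed.

Lemma tipC a F G : tip a F G = tip a G F.
Proof. by congr tsum; apply/funext => e; rewrite ipC. Qed.

Lemma ip_ge0 a F e : (forall e, 0 <= a e) -> 0 <= ip a F F e.
Proof.
by move=> a0; rewrite mulr_ge0// Rintegral_ge0// => t _; rewrite -expr2 sqr_ge0.
Qed.

Lemma tip_ge0 a F : (forall e, 0 <= a e) -> 0 <= tip a F F.
Proof. by move=> a0; apply: tsum_ge0 => e; exact: ip_ge0. Qed.

Lemma energy_tip f f' g g' : finite_norm f f' -> finite_norm g g' ->
  energy f' g' = (2^-1 * tip mg_cond f' g')%:E.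
Proof.
by move=> [_ lf] [_ lg]; rewrite /energy edge_integral_ip.
Qed.

Lemma inner_mu_tip f f' g g' : finite_norm f f' -> finite_norm g g' ->
  inner_mu f g = (tip (fun e => mg_cond e * mg_dens e) (edge_values f) (edge_values g))%:E.
Proof.
move=> [lf _] [lg _]; rewrite /inner_mu /mu_integral.
by rewrite (edge_integral_ip _ lf lg).
Qed.

(** If [h t0] were nonzero, [|h|] would stay above [|h t0| / 2] on an interval of positive length
    inside [[0, l]]. *)
Lemma continuous_sqr_integral_eq0 (l : R) (h : R -> R) : 0 < l -> continuous h ->
  (\int[m]_(t in `[0%R, l]) (h t ^+ 2)%:E = 0)%E -> forall t, 0 <= t <= l -> h t = 0.
Proof.
move=> l0 ch h0 t0 /andP[t00 t0l]; apply: contrapT => /eqP ht0.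
have c0 : 0 < `|h t0| by rewrite normr_gt0.
have /cvgrPdist_lt/(_ _ (divr_gt0 c0 (ltr0n _ 2)))[d /= d0 hd] := ch t0.
(* Clipping keeps the interval inside [[0, l]], and it stays nondegenerate when [t0] is an end.
   Halving [d] puts the closed interval inside the open ball. *)
pose a := Num.max 0 (t0 - d / 2); pose b := Num.min l (t0 + d / 2).
have ab : a < b by rewrite /a /b lt_min !gt_max; lra.
have a0 : 0 <= a by rewrite le_max lexx.
have bl : b <= l by rewrite ge_min lexx.
suff : (((`|h t0| / 2) ^+ 2 * (b - a))%:E <= \int[m]_(t in `[0%R, l]) (h t ^+ 2)%:E)%E.
  by rewrite h0 lee_fin leNgt mulr_gt0// ?subr_gt0// exprn_gt0// divr_gt0.
have mh D : measurable_fun D (fun t => (h t ^+ 2)%:E).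
  apply/measurable_EFinP/measurable_funX/measurable_funTS.
  exact: continuous_measurable_fun.
apply: (@le_trans _ _ (\int[m]_(t in `[a, b]) (h t ^+ 2)%:E)%E); last first.
  apply: ge0_subset_integral => //; first exact: mh.
    by move=> t _; rewrite lee_fin sqr_ge0.
  by move=> t /=; rewrite !in_itv/= => /andP[at_ tb]; rewrite (le_trans a0 at_) (le_trans tb bl).
rewrite (_ : (_ * _)%:E = \int[m]_(t in `[a, b]) ((`|h t0| / 2) ^+ 2)%:E)%E; last first.
  by rewrite integral_cst//= lebesgue_measure_itv/= lte_fin ab EFinM.
apply: ge0_le_integral => //; first exact: mh.
- move=> t /=; rewrite in_itv/= => tab; rewrite lee_fin.
  rewrite -[leRHS](real_normK (num_real _)) lerXn2r ?nnegrE//.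
  have /hd : ball t0 d t.
    move: tab; rewrite /ball/= ge_max le_min => /andP[/andP[_ ?] /andP[_ ?]].
    by rewrite ltr_norml; apply/andP; split; lra.
  have := lerB_dist (h t0) (h t); lra.
Qed.

(** Since [x / 2 + alpha y <= (1 + alpha) (x / 2 + y)], approximating to within
    [eps * (alpha / (1 + alpha))] bounds [alpha t] by [alpha eps]. *)
Let combine (alpha eps x y z t : R) : 0 < alpha -> 0 <= x -> 0 <= y -> 0 <= z ->
  2^-1 * z + alpha * t <= 2^-1 * x + alpha * y ->
  2^-1 * x + y < eps * (alpha / (1 + alpha)) -> t <= eps.
Proof.
move=> alpha0 x0 y0 z0 le lt.
have : alpha * t <= (1 + alpha) * (eps * (alpha / (1 + alpha))) by nra.
rewrite (_ : _ * (eps * _) = alpha * eps); first by rewrite ler_pM2l.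
by field; rewrite gt_eqF// addr_gt0.
Qed.

(** The difference of the solutions is orthogonal to the form domain, so its norm is at most
    that of [w - g] for every [g] in the form domain. *)
Lemma weak_solution_unique (alpha : R) (w u : mg_point M -> R) w' u' : 0 < alpha ->
  closed_form_domain w w' -> form_domain u u' ->
  (forall (g : mg_point M -> R) g', form_domain g g' ->
    (energy w' g' + alpha%:E * inner_mu w g = energy u' g' + alpha%:E * inner_mu u g)%E) ->
  forall e t, 0 <= t <= mg_len e -> w (mg_pt e t) = u (mg_pt e t).
Proof.
move=> alpha0 dw du eqwu.
have fw := closed_form_domain_finite_norm dw; have fu := form_domain_finite_norm du.
pose dd (e : E) := mg_cond e * mg_dens e.
(* The form [energy + alpha * inner_mu], as a real bilinear form. *)
pose Q (x : mg_point M -> R) x' (y : mg_point M -> R) y' :=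
  2^-1 * tip mg_cond x' y' + alpha * tip dd (edge_values x) (edge_values y).
have Qbl (x y z : mg_point M -> R) x' y' z' : finite_norm x x' -> finite_norm y y' -> finite_norm z z' ->
    Q (fun p => x p - y p) (fun e t => x' e t - y' e t) z z' = Q x x' z z' - Q y y' z z'.
  move=> [lx lx'] [ly ly'] [lz lz'].
  by rewrite /Q (tipBl c_ge0 lx' ly' lz') (tipBl cd_ge0 lx ly lz) !mulrBr opprD addrACA.
have QC x x' y y' : Q x x' y y' = Q y y' x x'.
  by rewrite /Q tipC [in X in _ + X]tipC.
have Q0 (x : mg_point M -> R) x' : finite_norm x x' -> 0 <= Q x x' x x'.
  move=> [lx lx']; rewrite /Q addr_ge0// mulr_ge0// ?invr_ge0 ?tip_ge0//; exact: ltW.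
have QE (g : mg_point M -> R) g' : form_domain g g' -> Q w w' g g' = Q u u' g g'.
  move=> dg; have fg := form_domain_finite_norm dg; apply: EFin_inj.
  have := eqwu _ _ dg.
  by rewrite (energy_tip fw fg) (energy_tip fu fg) (inner_mu_tip fw fg) (inner_mu_tip fu fg).
have fB (x y : mg_point M -> R) x' y' : finite_norm x x' -> finite_norm y y' ->
    finite_norm (fun p => x p - y p) (fun e t => x' e t - y' e t).
  move=> [lx lx'] [ly ly']; split; first exact: (edgeL2B _ lx ly).
  exact: (edgeL2B _ lx' ly').
pose d p := w p - u p; pose d' e t := w' e t - u' e t.
have fd : finite_norm d d' by exact: fB.
suff B0 : tip dd (edge_values d) (edge_values d) = 0.
  move=> e t et; apply/eqP; rewrite -subr_eq0; apply/eqP.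
  have ip0 : ip dd (edge_values d) (edge_values d) e = 0.
    apply/eqP; rewrite eq_le ip_ge0// andbT -B0; apply: le_tsum => [|e']; last exact: ip_ge0.
    by apply: edgeL2_ip_summable => //; case: fd.
  move: ip0 => /eqP; rewrite mulf_eq0 (gt_eqF (mulr_gt0 (cond_gt0 e) (dens_gt0 e)))/=.
  move=> /eqP int0.
  apply: (@continuous_sqr_integral_eq0 (mg_len e) (fun t => d (mg_pt e t))) => //.
    have [[[cw _ _ _] _] [[cu _ _ _] _ _ _]] := (dw, du).
    move=> s; apply: (@continuousB _ _ _ (edge_values w e) (edge_values u e));
      (apply: continuous_comp; first exact: mg_pt_continuous).
      exact: cw.
    exact: cu.
  have [ld _] := fd.
  rewrite -[LHS]fineK; last first.
    by apply: integrable_fin_num => //; exact: edgeL2_integrable ld e.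
  apply: (congr1 EFin); rewrite -[RHS]int0; congr fine.
apply/eqP; rewrite eq_le tip_ge0// andbT; apply/ler_addgt0Pr => eps eps0; rewrite add0r.
have eps1 : 0 < eps * (alpha / (1 + alpha)) by rewrite mulr_gt0// divr_gt0// addr_gt0.
have [_ /(_ _ eps1)[g [g' [dg]]]] := dw.
have fg := form_domain_finite_norm dg.
set v := fun p => w p - g p; set v' := fun e t => w' e t - g' e t.
have fv : finite_norm v v' by exact: fB.
rewrite (energy_tip fv fv) (inner_mu_tip fv fv) -EFinD lte_fin => ltv.
have Qdg : Q d d' g g' = 0 by rewrite Qbl// QE// subrr.
have Qdu : Q d d' u u' = 0 by rewrite Qbl// QE// subrr.
have Qdd : Q d d' d d' = Q w w' d d'.
  by have := Qbl w u d w' u' d' fw fu fd; rewrite (QC u) Qdu subr0.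
have Qvd : Q v v' d d' = Q w w' d d'.
  by have := Qbl w g d w' g' d' fw fg fd; rewrite (QC g) Qdg subr0.
have fdv := fB _ _ _ _ fd fv.
(* The difference [d = w - u] is orthogonal to [u] and to [g], hence [Q v d = Q d d]. Expanding
   [0 <= Q (d - v) (d - v)] leaves [Q v v - Q d d]. *)
have Qle : Q d d' d d' <= Q v v' v v'.
  have := Q0 _ _ fdv.
  rewrite (Qbl _ _ _ _ _ _ fd fv fdv) (QC d) (QC v) (Qbl _ _ _ _ _ _ fd fv fd).
  rewrite (Qbl _ _ _ _ _ _ fd fv fv) (QC d d' v v') Qvd Qdd.
  by rewrite subrr sub0r opprB subr_ge0.
exact: (combine alpha0 (tip_ge0 v' c_ge0) (tip_ge0 (edge_values v) cd_ge0)
  (tip_ge0 d' c_ge0) Qle ltv).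
Qed.

End Uniqueness.

(** * Functions which are quadratic on every edge *)

Lemma in_segment {R : realType} (a b s : R) : (s \in (`[a, b]%classic : set R)) = (a <= s <= b).
Proof. by rewrite mem_setE/= in_itv. Qed.

(** * Integration by parts against affine functions *)

Section AffineByParts.
Context {R : realType}.
Local Notation m := (@lebesgue_measure R).
Local Notation U := (`[0%R, 1%R]%classic : set R).

(** Fubini on the triangle [s <= t]. It replaces the product rule, since a weak derivative is merely
    integrable. *)
Lemma Rintegral_triangle (h : R -> R) : m.-integrable U (EFin \o h) ->
  \int[m]_(t in U) \int[m]_(s in `[0, t]) h s = \int[m]_(s in U) ((1 - s) * h s).
Proof.
move=> ih; pose h0 := h \_ U.
have mh0 : measurable_fun setT h0.
  apply/measurable_EFinP; rewrite /h0 -restrict_EFin.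
  by apply/(measurable_restrictT _ _).1 => //; exact: measurable_int ih.
have ih0 : m.-integrable setT (EFin \o h0).
  by rewrite /h0 -restrict_EFin; apply/(integrable_mkcond _ _).1.
pose phi (p : R * R) : \bar R :=
  (if (0 <= p.1) && (p.1 <= 1) && (p.2 <= p.1) then h0 p.2 else 0)%:E.
have mphi : measurable_fun setT phi.
  apply/measurable_EFinP; apply: measurable_fun_ifT => //.
    apply: measurable_and; first apply: measurable_and.
    - exact: measurable_fun_ler.
    - exact: measurable_fun_ler.
    - exact: measurable_fun_ler.
  exact: measurableT_comp.
have ihs t : t \in U -> m.-integrable `[0, t] (EFin \o h).
  rewrite in_segment => /andP[_ t1]; apply: integrableS ih => //.
  by move=> r /=; rewrite !in_itv/= => /andP[-> rt]; exact: le_trans t1.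
have F1 t : (\int[m]_s phi (t, s) = ((fun t => (\int[m]_(s in `[0, t]) h s)%:E) \_ U) t)%E.
  rewrite patchE; have [tU|tU] := boolP (t \in U); last first.
    apply: integral0_eq => s _.
    by move: tU; rewrite in_segment /phi/= => /negbTE ->.
  rewrite fineK; last by apply: integrable_fin_num => //; exact: ihs.
  rewrite [RHS]integral_mkcond; apply: eq_integral => s _.
  move: tU; rewrite in_segment /phi/= patchE /h0 => t01; rewrite t01/=.
  have /andP[t0 t1] := t01.
  rewrite in_segment.
  case: ifPn => st; last by rewrite andbF.
  by rewrite patchE in_segment andbT (le_trans st t1) andbT; case: ifP.
have F2 s : (\int[m]_t phi (t, s) = ((fun s => ((1 - s) * h s)%:E) \_ U) s)%E.
  rewrite patchE; have [sU|sU] := boolP (s \in U); last first.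
    apply: integral0_eq => t _.
    by rewrite /phi/= /h0 patchE (negbTE sU); case: ifP.
  have := sU; rewrite in_segment => /andP[s0 s1].
  transitivity (\int[m]_(t in `[s, 1%R]) (h s)%:E)%E.
    rewrite [RHS]integral_mkcond; apply: eq_integral => t _.
    rewrite /phi/= patchE in_segment /h0 patchE sU.
    case: ifPn => [/andP[/andP[_ ->] ->]//|].
    have [st|//] := boolP (s <= t); have [t1|//] := boolP (t <= 1).
    by rewrite (le_trans s0 st).
  rewrite integral_cst//= lebesgue_measure_itv/= lte_fin EFinM muleC.
  move: s1; rewrite le_eqVlt => /predU1P[->|->]//.
  by rewrite ltxx subrr.
(* For each [t] in [[0, 1]] the section is dominated by [|h0|]; for other [t] it vanishes. *)
have iphi : (m \x m)%E.-integrable setT phi.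
  apply/integrable12ltyP => //.
  apply: (@le_lt_trans _ _ (\int[m]_(t in U) \int[m]_s `|(h0 s)%:E|)%E).
    rewrite [leRHS]integral_mkcond; apply: ge0_le_integral => //.
    - by move=> t _; exact: integral_ge0.
    - have mabs : measurable_fun setT (abse \o phi) by exact: measurableT_comp.
      exact: (measurable_fun_fubini_tonelli_F (m2 := m) _ mabs (fun=> abse_ge0 _)).
    - by apply/(measurable_restrictT _ _).1 => //; exact: measurable_cst.
    move=> t _; rewrite patchE in_segment /phi/=.
    case: ifPn => t01; last first.
      by under eq_integral do rewrite /= normr0; rewrite integral0.
    apply: ge0_le_integral => //.
    - do 2 apply: measurableT_comp => //; apply: measurable_fun_ifT => //.
      exact: (@measurable_fun_ler _ _ _ setT id (cst t)).
    - by apply/measurable_EFinP; exact: measurableT_comp.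
    - by move=> s _; rewrite lee_fin; case: ifP => // _; rewrite normr0.
  rewrite integral_cst//; apply: lte_mul_pinfty => //.
  - exact: integral_ge0.
  - have /integrableP[_ /= oo] := ih0.
    by rewrite ge0_fin_numE// integral_ge0.
  - by rewrite /= lebesgue_measure_itv/= lte01 ltry.
have := Fubini iphi.
under eq_integral do rewrite F1.
under [in RHS]eq_integral do rewrite F2.
by rewrite -!integral_mkcond /Rintegral => ->.
Qed.

(** Split [b + c s = (b + c) - c (1 - s)]: the constant integrates [h] to [g 1 - g 0], and the
    weight [1 - s] is that of the triangle. Affine weights suffice because they are the derivatives
    of quadratic functions. *)
Lemma Rintegral_affine_by_parts (b c : R) (g h : R -> R) : m.-integrable U (EFin \o h) ->
  m.-integrable U (EFin \o g) ->
  (forall t, 0 <= t <= 1 -> g t = g 0 + \int[m]_(s in `[0, t]) h s) ->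
  \int[m]_(s in U) ((b + c * s) * h s) =
    (b + c) * g 1 - b * g 0 - c * \int[m]_(t in U) g t.
Proof.
move=> ih ig gE.
have m1 : m U = 1%E by rewrite lebesgue_measure_itv/= lte01 oppr0 adde0.
have int_h : \int[m]_(s in U) h s = g 1 - g 0.
  by rewrite [g 1]gE ?ler01 ?lexx// addrC addKr.
have ish : m.-integrable U (EFin \o (fun s => (1 - s) * h s)).
  apply: le_integrable (ih) => //.
    apply/measurable_EFinP; apply: measurable_funM; first exact: measurable_funB.
    by apply/measurable_EFinP; exact: measurable_int ih.
  move=> s /=; rewrite in_itv/= => /andP[s0 s1]; rewrite lee_fin normrM ler_piMl//.
  by rewrite ger0_norm; lra.
have ig0 : m.-integrable U (EFin \o cst (g 0)).
  apply: continuous_compact_integrable; first exact: segment_compact.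
  by apply: continuous_subspaceT => t; exact: cvg_cst.
have tri : \int[m]_(s in U) ((1 - s) * h s) = \int[m]_(t in U) g t - g 0.
  rewrite -Rintegral_triangle// -[g 0 in RHS]mulr1.
  have -> : g 0 * 1 = \int[m]_(t in U) (cst (g 0) t).
    by rewrite Rintegral_cst//= m1.
  rewrite -RintegralB//; apply: eq_Rintegral => t; rewrite in_segment => t01.
  by rewrite [g t]gE//= addrC addKr.
transitivity (\int[m]_(s in U) ((b + c) * h s - c * ((1 - s) * h s))).
  by apply: eq_Rintegral => s _; ring.
have iZ k (f : R -> R) : m.-integrable U (EFin \o f) -> m.-integrable U (EFin \o (fun s => k * f s)).
  by move=> i_f; apply: eq_integrable (integrableZl _ k i_f) => // s _ /=; rewrite EFinM.
rewrite RintegralB//; [|exact: iZ..].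
by rewrite !RintegralZl// int_h tri; ring.
Qed.

End AffineByParts.

(** * Finite unions of edges and extension by zero *)

Section EdgeUnion.
Context {R : realType} {M : metric_graph R}.
Local Notation E := (mg_edge M).
Hypothesis len_gt0 : forall e : E, 0 < mg_len e.
Definition edge_union (F : set E) : set (mg_point M) :=
  \bigcup_(e in F) [set mg_pt e t | t in (`[0%R, mg_len e]%classic : set R)].

Lemma edge_union_compact (F : set E) : finite_set F -> compact (edge_union F).
Proof.
move=> fF; rewrite /edge_union bigcup_fset_set//.
elim/big_ind : _ => [|A B|e _]; first exact: compact0.
  exact: compactU.
apply: continuous_compact; last exact: segment_compact.
by apply: continuous_subspaceT; exact: mg_pt_continuous.
Qed.

Lemma mg_pt_clamp (e : E) (t : R) :
  exists2 s, 0 <= s <= mg_len e & mg_pt e t = mg_pt e s.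
Proof.
have [t0|t0] := leP t 0.
  by exists 0; rewrite ?lexx ?ltW// !mg_pt0.
have [tl|tl] := leP t (mg_len e); first by exists t; rewrite ?tl ?ltW.
by exists (mg_len e); rewrite ?lexx ?ltW// !mg_ptl// ltW.
Qed.

(** In the parametrization of an edge of [F] the preimage is the whole line. For any other edge only
    end vertices can belong to the union, so the preimage is made of the half-lines that [mg_pt]
    sends to these ends. *)
Lemma edge_union_closed (F : set E) : closed (edge_union F).
Proof.
rewrite -openC mg_openE => e; rewrite preimage_setC.
pose A : set R := mg_pt e @^-1` edge_union F; suff : closed A by exact: closed_openC.
have [Fe|Fe] := pselect (F e).
  rewrite (_ : A = setT); first exact: closedT.
  apply/seteqP; split => // t _; have [s sl ts] := mg_pt_clamp e t.
  by rewrite /A /preimage/= ts; exists e => //; exists s => //=; rewrite in_itv.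
pose H v (B : set R) := if `[< edge_union F (Vtx v) >] then B else set0.
rewrite (_ : A = H (mg_src e) `]-oo, 0]%classic `|` H (mg_tgt e) `[mg_len e, +oo[%classic).
  by apply: closedU; rewrite /H; case: ifP => _;
    first [exact: closed0|exact: interval_closed].
apply/seteqP; split => t; rewrite /H /A /preimage/=.
  have [t0|t0] := leP t 0.
    by rewrite mg_pt0// => /asboolT ->; left; rewrite /= in_itv.
  have [tl|tl] := leP (mg_len e) t.
    by rewrite mg_ptl// => /asboolT ->; right; rewrite /= in_itv/= tl.
  have tin : 0 < t < mg_len e by rewrite t0.
  rewrite (mg_pt_in tin) => -[e' Fe' [s _]]; rewrite /mg_pt.
  destruct idP as [h|h] => [[ee']|]; last by case: ifP.
  by rewrite ee' in Fe'.
case=> [|]; case: asboolP => // h; rewrite /= in_itv/=.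
  by move=> t0; rewrite mg_pt0.
by rewrite andbT => tl; rewrite mg_ptl.
Qed.

Local Notation opc := (one_point_compactification (mg_point M)).

Definition ext0 (f : mg_point M -> R) (z : opc) : R := if z is Some y then f y else 0.

(** Neighbourhoods of infinity are complements of closed compact sets, and [edge_union F] is such a
    set when [F] is finite. *)
Lemma ext0_continuous (f : mg_point M -> R) (F : set E) : finite_set F ->
  continuous f -> (forall z, ~ edge_union F z -> f z = 0) -> continuous (ext0 f).
Proof.
move=> fF cf f0 [y|] A /=; first by move=> /cf.
move=> /nbhs_singleton A0; exists (edge_union F).
  by split; [exact: edge_union_compact|exact: edge_union_closed].
by move=> z [[y yF <-]|->]//=; rewrite f0.
Qed.

Lemma edge_union_compact_support (f : mg_point M -> R) (F : set E) : finite_set F ->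
  (forall z, ~ edge_union F z -> f z = 0) -> compact_support f.
Proof.
move=> fF f0; apply: (subclosed_compact _ (edge_union_compact fF)); first exact: closed_closure.
rewrite closureE; apply: smallest_sub; first exact: edge_union_closed.
by move=> z /= fz; apply: contrapT => /f0/eqP; exact/negP.
Qed.

End EdgeUnion.

Section FiniteEdgeSums.
Context {R : realType} {T : choiceType}.

Lemma tsum_finite (f : T -> R) (F : set T) : finite_set F -> (forall e, ~ F e -> f e = 0) ->
  esum_posneg f = (\sum_(e \in F) f e)%:E.
Proof.
move=> fF f0.
have esumE (g : T -> R) : (forall e, 0 <= g e) -> (forall e, ~ F e -> g e = 0) ->
    \esum_(e in [set: T]) (g e)%:E = (\sum_(e \in F) g e)%:E.
  move=> g0 gF; rewrite -fsumEFin// -esum_fset//; last by move=> e _; rewrite lee_fin.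
  rewrite [RHS]esum_mkcond; apply: eq_esum => e _; case: ifPn => //.
  by rewrite notin_setE => /gF ->.
rewrite /esum_posneg.
have -> : (EFin \o f)^\+%E = EFin \o f^\+%R by apply/funext => e; rewrite funeposE /= -EFin_max.
have -> : (EFin \o f)^\-%E = EFin \o f^\-%R by apply/funext => e; rewrite funenegE /= -EFin_max.
rewrite !esumE; [|move=> e..].
- rewrite -EFinB; congr EFin; rewrite !fsbig_finite//= -sumrB; apply: eq_bigr => e _.
  by rewrite -[RHS](congr1 (@^~ e) (funrposBneg f)).
- by rewrite funrneg_ge0.
- by move=> /f0; rewrite /funrneg => ->; rewrite oppr0 maxxx.
- by rewrite funrpos_ge0.
- by move=> /f0; rewrite /funrpos => ->; rewrite maxxx.
Qed.

End FiniteEdgeSums.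

Section SquareIntegrable.
Context {R : realType}.
Local Notation m := (@lebesgue_measure R).

Lemma Rintegral_eq0 (D : set R) (f : R -> R) : (forall t, D t -> f t = 0) ->
  \int[m]_(t in D) f t = 0.
Proof. by move=> f0; rewrite /Rintegral integral0_eq// => t /f0 ->. Qed.

Lemma sqr_integrableM (D : set R) (f g : R -> R) : measurable D ->
  measurable_fun D f -> measurable_fun D g ->
  m.-integrable D (fun t => (f t ^+ 2)%:E) -> m.-integrable D (fun t => (g t ^+ 2)%:E) ->
  m.-integrable D (fun t => (f t * g t)%:E).
Proof.
move=> mD mf mg i_f ig.
have iD : m.-integrable D (fun t => (f t ^+ 2 + g t ^+ 2)%:E) by exact: integrableD i_f ig.
apply: le_integrable iD => //.
  by apply/measurable_EFinP; exact: measurable_funM.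
move=> t _; rewrite !abse_EFin lee_fin (le_trans (normM_le_sqrD _ _))//.
exact: ler_norm.
Qed.

End SquareIntegrable.

(** * Quadratic functions as explicit weak solutions *)

Section QuadraticFunctions.
Context {R : realType} {M : metric_graph R}.
Local Notation E := (mg_edge M).
Local Notation V := (mg_vertex M).
Local Notation m := (@lebesgue_measure R).
Local Notation U := (`[0%R, 1%R]%classic : set R).
Hypothesis len1 : forall e : E, mg_len e = 1.
Let len_gt0 (e : E) : 0 < mg_len e. Proof. by rewrite len1. Qed.

Lemma edge_integral_finite (a : E -> R) (Phi : E -> R -> R) (F : set E) : finite_set F ->
  (forall e, \int[m]_(t in U) (Phi e t)%:E \is a fin_num)%E ->
  (forall e, ~ F e -> \int[m]_(t in U) Phi e t = 0) ->
  edge_integral a Phi = (\sum_(e \in F) a e * \int[m]_(t in U) Phi e t)%:E.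
Proof.
move=> fF iPhi Phi0; rewrite -tsum_finite//; last by move=> e /Phi0 ->; rewrite mulr0.
rewrite /esum_posneg (_ : EFin \o _ = fun e =>
  (a e)%:E * \int[m]_(t in `[0%R, mg_len e]) (Phi e t)%:E)%E//.
by apply/funext => e /=; rewrite len1 EFinM fineK.
Qed.

Variables (a : V -> R) (k : E -> R).

(** The last term vanishes at both ends, so vertex values and curvatures are prescribed
    independently. The second derivative is [- 2 * k e]. *)
Definition quad_edge (e : E) (t : R) : R :=
  a (mg_src e) * (1 - t) + a (mg_tgt e) * t + k e * (t * (1 - t)).

Definition quad (z : mg_point M) : R :=
  match z with Vtx v => a v | Inner e t _ => quad_edge e t end.

Definition dquad (e : E) (t : R) : R :=
  (a (mg_tgt e) - a (mg_src e) + k e) + (- 2 * k e) * t.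

Lemma quad_pt e t : 0 <= t <= 1 -> quad (mg_pt e t) = quad_edge e t.
Proof.
move=> /andP[t0 t1]; have [t0'|t0'] := leP t 0.
  by rewrite (_ : t = 0) ?mg_pt0//=; [rewrite /quad_edge; ring|apply/eqP; rewrite eq_le t0'].
have [t1'|t1'] := leP 1 t.
  rewrite (_ : t = 1); last by apply/eqP; rewrite eq_le t1.
  by rewrite mg_ptl ?len1//= /quad_edge; ring.
have tin : 0 < t < mg_len e by rewrite t0' len1.
by rewrite (mg_pt_in tin).
Qed.

Lemma quad_edge_continuous e : continuous (quad_edge e).
Proof.
move=> t; rewrite /quad_edge.
apply: cvgD; first apply: cvgD.
- by apply: cvgMr; apply: cvgB; [exact: cvg_cst|exact: cvg_id].
- by apply: cvgMr; exact: cvg_id.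
- by apply: cvgMr; apply: cvgM; [exact: cvg_id|apply: cvgB; [exact: cvg_cst|exact: cvg_id]].
Qed.

Lemma quad_continuous : continuous quad.
Proof.
apply: mg_continuous => e.
(* [mg_pt] is constant beyond the ends of the edge, whereas the polynomial is not: the parameter has
   to be clamped. *)
have -> : (fun t => quad (mg_pt e t)) = quad_edge e \o (fun t => Num.max 0 (Num.min t 1)).
  apply/funext => t /=; have [t0|t0] := leP t 0.
    rewrite (mg_pt0 e t0) -(mg_pt0 e (lexx 0)) quad_pt ?lexx ?ler01//.
    by rewrite min_l ?(le_trans t0)// max_l.
  have [t1|t1] := leP t 1; first by rewrite max_r ?ltW// quad_pt// t1 ltW.
  rewrite mg_ptl ?len1 ?ltW// max_r// -quad_pt ?lexx ?ler01//.
  by rewrite mg_ptl ?len1.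
move=> t; apply: continuous_comp; last exact: quad_edge_continuous.
by apply: continuous_max; [exact: cvg_cst|apply: continuous_min; [exact: cvg_id|exact: cvg_cst]].
Qed.

Lemma dquad_continuous e : continuous (dquad e).
Proof.
move=> t; apply: cvgD; first exact: cvg_cst.
by apply: cvgMr; exact: cvg_id.
Qed.

Lemma dquad_integral e (t : R) : 0 <= t ->
  \int[m]_(s in `[0, t]) dquad e s = quad_edge e t - quad_edge e 0.
Proof.
rewrite le_eqVlt => /predU1P[<-|t0].
  by rewrite set_itv1 Rintegral_set1 subrr.
have dq (x : R) : is_derive x 1 (quad_edge e) (dquad e x).
  rewrite /quad_edge; apply: is_derive_eq; rewrite /dquad /GRing.scale/=; ring.
rewrite /Rintegral (@continuous_FTC2 _ _ (quad_edge e))//.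
- exact: continuous_subspaceT (@dquad_continuous e).
- split => [x _| |]; first exact: ex_derive.
    by apply: cvg_at_right_filter; exact: quad_edge_continuous.
  by apply: cvg_at_left_filter; exact: quad_edge_continuous.
- by move=> x _; rewrite derive1E; exact: derive_val.
Qed.

Let segment_integrable (f : R -> R) : continuous f -> m.-integrable U (EFin \o f).
Proof.
move=> cf; apply: continuous_compact_integrable; first exact: segment_compact.
exact: continuous_subspaceT.
Qed.

Lemma quad_sobolev : sobolev quad dquad.
Proof.
split => [|e|e|e t].
- exact: quad_continuous.
- apply: measurable_funTS; apply: continuous_measurable_fun; exact: dquad_continuous.
- have cd : continuous (fun t => dquad e t ^+ 2).
    move=> t; apply: (@continuous_comp _ _ _ (dquad e) (fun x => x ^+ 2)).
      exact: dquad_continuous.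
    exact: exprn_continuous.
  rewrite len1; have /integrableP[_] := segment_integrable cd.
  by under eq_integral do rewrite /= ger0_norm ?sqr_ge0//.
- rewrite len1 => t01; rewrite !quad_pt ?lexx ?ler01//.
  have /andP[t0 _] := t01.
  by rewrite dquad_integral// addrC subrK.
Qed.

Variable loop : V -> E.
Hypothesis src_loop : forall v, mg_src (loop v) = v.
Variable F : set E.
Hypothesis finF : finite_set F.
Hypothesis out : forall e, ~ F e -> [/\ a (mg_src e) = 0, a (mg_tgt e) = 0 & k e = 0].

(** This is [u'' / (2 omega)] for [u'' = - 2 k]. Vertices have measure zero, so the weak equation
    leaves the value there free; taking that of the loop will make the function constant on a whole
    star, centre included. *)
Definition lap (z : mg_point M) : R :=
  match z with
  | Vtx v => - (k (loop v) / mg_dens (loop v))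
  | Inner e t _ => - (k e / mg_dens e)
  end.

Let out_vtx v : ~ edge_union F (Vtx v) -> ~ F (loop v).
Proof.
move=> nF Fl; apply: nF; exists (loop v) => //; exists 0 => /=.
  by rewrite in_itv/= lexx len1 ler01.
by rewrite mg_pt0// src_loop.
Qed.

Let out_inner e t (h : 0 < t < mg_len e) : ~ edge_union F (Inner h) -> ~ F e.
Proof.
move=> nF Fe; apply: nF; exists e => //; exists t => /=.
  by have /andP[/ltW t0 /ltW tl] := h; rewrite in_itv/= t0.
by rewrite (mg_pt_in h).
Qed.

Lemma quad_out z : ~ edge_union F z -> quad z = 0.
Proof.
case: z => [v /out_vtx/out[+ _ _]|e t h /out_inner/out[aS aT k0]]/=.
  by rewrite src_loop.
by rewrite /quad_edge aS aT k0 !mul0r !addr0.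
Qed.

Lemma quad_form_domain : form_domain quad dquad.
Proof.
have dq0 e t : ~ F e -> dquad e t = 0.
  by move=> /out[aS aT k0]; rewrite /dquad aS aT k0 !mulr0 !mul0r subr0 !addr0.
have q0 e t : ~ F e -> 0 <= t <= 1 -> quad (mg_pt e t) = 0.
  move=> /out[aS aT k0] t01; rewrite quad_pt// /quad_edge aS aT k0.
  by rewrite !mul0r !addr0.
have isq (f : R -> R) : continuous f -> continuous (fun t => f t ^+ 2).
  move=> cf t; apply: (@continuous_comp _ _ _ f (fun x => x ^+ 2)); first exact: cf.
  exact: exprn_continuous.
have iq e : continuous (fun t => quad (mg_pt e t)).
  move=> t; apply: continuous_comp; first exact: mg_pt_continuous.
  exact: quad_continuous.
split.
- exact: quad_sobolev.
- move=> eps eps0; exists quad; split.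
  + exact: quad_continuous.
  + exact: edge_union_compact_support quad_out.
  + by move=> z; rewrite subrr normr0 ltW.
- rewrite /mu_integral (@edge_integral_finite _ _ F)//; first exact: ltry.
  + move=> e; apply: integrable_fin_num => //; apply: segment_integrable => t.
    apply: cvgD; [exact: (isq _ (iq e))|exact: (isq _ (@dquad_continuous e))].
  + move=> e Fe; apply: Rintegral_eq0 => t /=; rewrite in_itv/= => t01.
    by rewrite q0// dq0// expr0n/= addr0.
- rewrite /energy (@edge_integral_finite _ _ F)//; first exact: ltry.
  + move=> e; apply: integrable_fin_num => //; apply: segment_integrable => t.
    by apply: cvgM; exact: dquad_continuous.
  + by move=> e Fe; apply: Rintegral_eq0 => t _; rewrite dq0// mulr0.
Qed.

Hypothesis dens_gt0 : forall e : E, 0 < mg_dens e.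
(** The vertex conditions tested against [phi]: the two coefficients are the derivatives of [quad]
    at the source and at the target, both directed into the edge. *)
Hypothesis kirchhoff : forall phi : V -> R,
  \sum_(e \in F) mg_cond e *
    ((a (mg_tgt e) - a (mg_src e) + k e) * phi (mg_src e) +
     (a (mg_src e) - a (mg_tgt e) + k e) * phi (mg_tgt e)) = 0.

(** Integrate by parts on every edge: the boundary terms cancel by [kirchhoff], and the second
    derivative is constant on the edge. All sums are finite because [quad] is carried by [F], so [g]
    can be any Sobolev function. *)
Lemma quad_weak_solution (alpha : R) (g : mg_point M -> R) g' : sobolev g g' ->
  (energy dquad g' + alpha%:E * inner_mu quad g =
   inner_mu (fun z => alpha * quad z - lap z)%R g)%E.
Proof.
move=> [cg mg' lg' pg].
have cge e : continuous (fun t => g (mg_pt e t)).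
  by move=> t; apply: continuous_comp; [exact: mg_pt_continuous|exact: cg].
have cqe e : continuous (fun t => quad (mg_pt e t)).
  move=> t; apply: continuous_comp; first exact: mg_pt_continuous.
  exact: quad_continuous.
have ig'2 e : m.-integrable U (fun t => (g' e t ^+ 2)%:E).
  apply/integrableP; split.
    by apply/measurable_EFinP; apply: measurable_funX; rewrite -(len1 e); exact: mg'.
  under eq_integral do rewrite gee0_abs ?lee_fin ?sqr_ge0//.
  by rewrite -[X in `[0%R, X]](len1 e); exact: lg'.
have mg'1 e : measurable_fun U (g' e) by rewrite -(len1 e); exact: mg'.
have isq (f : R -> R) : continuous f -> m.-integrable U (fun t => (f t ^+ 2)%:E).
  move=> cf; apply: (@segment_integrable (fun t => f t ^+ 2)) => t.
  by apply: (@continuous_comp _ _ _ f (fun x => x ^+ 2)); [exact: cf|exact: exprn_continuous].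
have cm (f : R -> R) : continuous f -> measurable_fun U f.
  by move=> cf; apply: measurable_funTS; exact: continuous_measurable_fun.
have iM (f : R -> R) e : continuous f -> m.-integrable U (EFin \o (fun t => f t * g' e t)).
  by move=> cf; apply: sqr_integrableM => //; [exact: cm|exact: isq].
have ig' e : m.-integrable U (EFin \o g' e).
  have := iM (cst 1) e (@cst_continuous _ _ _); apply: eq_integrable => // t _ /=.
  by rewrite mul1r.
pose G e := \int[m]_(t in U) g (mg_pt e t).
pose K e := (a (mg_tgt e) - a (mg_src e) + k e) * g (Vtx (mg_src e)) +
     (a (mg_src e) - a (mg_tgt e) + k e) * g (Vtx (mg_tgt e)).
have parts e : \int[m]_(t in U) (dquad e t * g' e t) = 2 * k e * G e - K e.
  rewrite /dquad (@Rintegral_affine_by_parts _ _ _ (fun t => g (mg_pt e t)))//.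
  - by rewrite (mg_pt0 e (lexx 0)) (@mg_ptl _ _ e 1) ?len1// /K /G; ring.
  - exact: segment_integrable.
  - by move=> t t01; apply: pg; rewrite len1.
pose L e t := (alpha * quad_edge e t + k e / mg_dens e) * g (mg_pt e t).
have cL e : continuous (L e).
  move=> t; apply: cvgM; last exact: cge.
  apply: cvgD; last exact: cvg_cst.
  by apply: cvgMr; exact: quad_edge_continuous.
have eL e t : 0 < t < 1 -> (alpha * quad (mg_pt e t) - lap (mg_pt e t)) * g (mg_pt e t) = L e t.
  move=> t01; have tin : 0 < t < mg_len e by rewrite len1.
  by rewrite /L (mg_pt_in tin)/= opprK.
(* At the ends [lap] takes the values of loops, which may differ from that of [e]; two points do not
   change the integral. *)
have intL e : (\int[m]_(t in U)
    ((alpha * quad (mg_pt e t) - lap (mg_pt e t)) * g (mg_pt e t))%:E =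
    \int[m]_(t in U) (L e t)%:E)%E.
  have mL : measurable_fun (`]0%R, 1%R[%classic : set R) (L e).
    by apply: measurable_funTS; apply: continuous_measurable_fun; exact: cL.
  apply: eq_integral_itv_bounded => //; last by move=> t; rewrite in_itv/= => /eL.
  by apply: eq_measurable_fun mL => t; rewrite inE/= in_itv/= => /eL.
rewrite /energy (@edge_integral_finite _ _ F)//; last 2 first.
- by move=> e; apply: integrable_fin_num => //; exact: (iM _ _ (@dquad_continuous e)).
- move=> e /out[aS aT k0]; apply: Rintegral_eq0 => t _.
  by rewrite /dquad aS aT k0 !mulr0 !mul0r subr0 !addr0 mul0r.
rewrite /inner_mu /mu_integral (@edge_integral_finite _ _ F)//; last 2 first.
- move=> e; apply: integrable_fin_num => //; apply: segment_integrable => t.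
  by apply: cvgM; [exact: cqe|exact: cge].
- move=> e /out[aS aT k0]; apply: Rintegral_eq0 => t /=; rewrite in_itv/= => t01.
  by rewrite quad_pt// /quad_edge aS aT k0 !mul0r !addr0 mul0r.
rewrite (@edge_integral_finite _ _ F)//; last 2 first.
- move=> e; rewrite intL; apply: integrable_fin_num => //; exact: segment_integrable.
- move=> e /out[aS aT k0]; rewrite /Rintegral intL; apply: Rintegral_eq0 => t _.
  by rewrite /L /quad_edge aS aT k0 !mul0r !addr0 mulr0 mul0r.
rewrite -!EFinM -EFinD; congr EFin; rewrite !fsbig_finite//= !mulr_sumr -big_split/=.
have := kirchhoff (fun v => g (Vtx v)); rewrite fsbig_finite//= => kir.
(* The two sides differ by [- 1 / 2] times the boundary sum, the factor being that of the energy. *)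
apply/eqP; rewrite -subr_eq0 -sumrB -[X in _ == X](mulr0 (- 2^-1)) -[X in _ == _ * X]kir mulr_sumr.
apply/eqP; apply: eq_bigr => e _.
have -> : \int[m]_(t in U) ((alpha * quad (mg_pt e t) - lap (mg_pt e t)) * g (mg_pt e t)) =
    alpha * \int[m]_(t in U) (quad (mg_pt e t) * g (mg_pt e t)) + k e / mg_dens e * G e.
  rewrite /Rintegral intL -/(Rintegral m U (L e)).
  have iqg : m.-integrable U (EFin \o (fun t => quad (mg_pt e t) * g (mg_pt e t))).
    by apply: segment_integrable => t; apply: cvgM; [exact: cqe|exact: cge].
  have ig : m.-integrable U (EFin \o (fun t => g (mg_pt e t))) by exact: segment_integrable.
  rewrite -!RintegralZl// -RintegralD//; last 2 first.
  - exact: (integrableZl _ alpha iqg).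
  - exact: (integrableZl _ (k e / mg_dens e) ig).
  by apply: eq_Rintegral => t; rewrite in_segment => t01; rewrite quad_pt// /L; ring.
rewrite parts -/(K e); have d0 : mg_dens e != 0 by rewrite gt_eqF.
by set Q := Rintegral _ _ _; field.
Qed.

End QuadraticFunctions.

(** * Hitting times of vertices *)

Section PathMeasurability.
Context {R : realType} {d : measure_display} {W : measurableType d} {S : ptopologicalType}.
Variable Y : R -> W -> S.
Hypothesis contY : forall w, {within `[0, +oo[, continuous (fun t => Y t w)}.
Hypothesis measY : forall t : R, 0 <= t ->
  measurable_fun setT (Y t : W -> g_sigma_algebraType (@open S)).

(** Paths are controlled at nonnegative times only; clamping gives maps that are continuous and
    measurable on the whole line, ready for Fubini. *)
Definition clamp_path (p : R * W) : S := Y (Num.max 0 p.1) p.2.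

Lemma path_continuous (f : S -> R) (w : W) : continuous f ->
  continuous (fun t : R => f (clamp_path (t, w))).
Proof.
move=> cf t; apply: (@cvg_comp _ _ _ (fun s => Y (Num.max 0 s) w) f); last exact: cf.
have /subspace_continuousP/(_ (Num.max 0 t)) := @contY w.
move=> cY; apply: cvg_trans (cY _); last by rewrite /= in_itv/= andbT le_max lexx.
move=> A /= ; rewrite /within/= => nA.
have : Num.max 0 s @[s --> t] --> Num.max 0 t.
  by apply: continuous_max; [exact: cvg_cst|exact: cvg_id].
have nA' : nbhs (Num.max 0 t) (fun s : R => `[0, +oo[%classic s -> A (Y s w)) by exact: nA.
move=> /(_ _ nA') h; suff : nbhs t ((fun s : R => Y (Num.max 0 s) w) @^-1` A) by [].
apply: (@filterS _ (nbhs t) _ _ _ _ h) => s /=; apply.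
by rewrite in_itv/= andbT le_max lexx.
Qed.

Lemma continuous_borel_measurable (f : S -> R) : continuous f ->
  measurable_fun setT (f : g_sigma_algebraType (@open S) -> R).
Proof.
move=> cf; apply: (measurability _ (RGenOpens.measurableE R)) => _ [_ [a [b ->] <-]].
rewrite setTI; apply: sub_sigma_algebra.
by move/continuousP : cf; apply; exact: interval_open.
Qed.

Lemma clamp_path_measurable (f : S -> R) (t : R) :
  measurable_fun setT (f : g_sigma_algebraType (@open S) -> R) ->
  measurable_fun setT (fun w => f (clamp_path (t, w))).
Proof.
move=> mf; have mY := @measY (Num.max 0 t) (ltac:(by rewrite le_max lexx)).
exact: (measurableT_comp mf mY).
Qed.

Let grid (n : nat) (t : R) : R := (Num.truncn (t * n.+1%:R))%:R / n.+1%:R.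

Let grid_cvg (t : R) : 0 <= t -> grid n t @[n --> \oo] --> t.
Proof.
move=> t0; apply/cvgrPdist_lt => e e0; near=> n.
have n0 : 0 < n.+1%:R :> R by rewrite ltr0n.
have /truncn_itv/andP[h1 h2] : 0 <= t * n.+1%:R by rewrite mulr_ge0// ltW.
rewrite /grid ger0_norm; last by rewrite subr_ge0 ler_pdivrMr.
rewrite ltrBlDr -ltrBlDl -(ltr_pM2r n0) -/(grid n t).
rewrite [X in _ < X]divfK ?gt_eqF//.
rewrite mulrBl (lt_trans _ (_ : t * n.+1%:R - 1 < _))//.
  rewrite ltrD2l ltrN2 -ltr_pdivrMl// mulr1 (@lt_trans _ _ n%:R) ?ltr_nat//.
  by near: n; exact: nbhs_infty_gtr.
by rewrite ltrBlDr natr1.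
Unshelve. all: by end_near. Qed.

(** The process read at the grid times [k / (n + 1)] is jointly measurable because it uses countably
    many times, and continuity of the paths makes it converge pointwise. *)
Lemma clamp_path_jointly_measurable (f : S -> R) : continuous f ->
  measurable_fun setT (fun p : R * W => f (clamp_path p)).
Proof.
move=> cf.
apply: (@measurable_fun_cvg _ _ _ setT
  (fun (n : nat) (p : R * W) => f (clamp_path (grid n (Num.max 0 p.1), p.2)))).
  move=> n; have -> : [set: R * W] = \bigcup_k
      ([set t : R | Num.truncn (Num.max 0 t * n.+1%:R) = k] `*` [set: W]).
    by apply/seteqP; split => // -[t w] _; exists (Num.truncn (Num.max 0 t * n.+1%:R)).
  have mE k : measurable ([set t : R | Num.truncn (Num.max 0 t * n.+1%:R) = k] `*` [set: W]).
    apply: measurableX => //; set c := fun t : R => Num.max 0 t * n.+1%:R.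
    have mc : measurable_fun setT c.
      by apply: measurable_funM => //; exact: measurable_maxr.
    have mb : measurable_fun setT (fun t : R => (k%:R <= c t) && (c t < k.+1%:R)).
      by apply: measurable_and; [exact: measurable_fun_ler|exact: measurable_fun_ltr].
    have -> : [set t : R | Num.truncn (c t) = k] =
        setT `&` (fun t : R => (k%:R <= c t) && (c t < k.+1%:R)) @^-1` [set true].
      rewrite setTI; apply/seteqP; split=> t /=.
        by move=> <-; rewrite truncn_itv// mulr_ge0// le_max lexx.
      by move=> h; apply/eqP; rewrite truncn_eq// mulr_ge0// le_max lexx.
    exact: mb.
  apply/measurable_fun_bigcup => // k.
  apply: (@eq_measurable_fun _ _ _ _ _ (fun p => f (clamp_path (k%:R / n.+1%:R, p.2)))).
    by move=> [t w]; rewrite inE /grid => -[/= -> _].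
  have mk := @clamp_path_measurable f (k%:R / n.+1%:R) (continuous_borel_measurable cf).
  by apply: measurable_funTS; exact: (measurableT_comp mk (@measurable_snd _ _ R W)).
move=> [t w] _ /=.
have -> : f (clamp_path (t, w)) = f (clamp_path (Num.max 0 t, w)).
  by rewrite /clamp_path/= maxA maxxx.
apply: (@cvg_comp _ _ _ _ (fun s => f (clamp_path (s, w)))); last exact: path_continuous.
by apply: grid_cvg; rewrite le_max lexx.
Qed.

End PathMeasurability.

Lemma first_time_lt {R : realType} (A : set R) (t : R) :
  (first_time A < t%:E)%E <-> exists s, [/\ 0 <= s, A s & s < t].
Proof.
split.
  by move=> /ereal_inf_lt[_ [s [s0 As] <-]]; rewrite lte_fin => st; exists s.
move=> [s [s0 As st]]; apply: le_lt_trans (_ : (s%:E < _)%E); last by rewrite lte_fin.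
by apply: ereal_inf_lbound; exists s.
Qed.

Lemma first_time_ge0 {R : realType} (A : set R) : (0 <= first_time A)%E.
Proof. by apply: le_ereal_inf_tmp => _ [s [s0 _] <-]; rewrite lee_fin. Qed.

Lemma first_time_le {R : realType} (A : set R) (t : R) : 0 <= t -> A t ->
  (first_time A <= t%:E)%E.
Proof. by move=> t0 At; apply: ereal_inf_lbound; exists t. Qed.

(** * Zeros of a continuous function along a path *)

Section HittingTimes.
Context {R : realType} {M : metric_graph R} {d : measure_display} {W : measurableType d}.
Local Notation opc := (one_point_compactification (mg_point M)).
Local Notation borel := (g_sigma_algebraType (@open opc)).
Variables (Y : R -> W -> opc).
Hypothesis contY : forall w, {within `[0, +oo[, continuous (fun t => Y t w)}.

Lemma path_clampE (t : R) w : 0 <= t -> clamp_path Y (t, w) = Y t w.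
Proof. by move=> t0; rewrite /clamp_path/= max_r. Qed.

Variable (phi : opc -> R).
Hypothesis cphi : continuous phi.
Hypothesis phi_ge0 : forall z, 0 <= phi z.

Definition zero_time (w : W) : \bar R := first_time [set t | phi (Y t w) = 0].

(** On a compact interval of time, a nonnegative continuous function has a zero as soon as its
    values at rational times come arbitrarily close to [0]. The right-hand side involves only
    countable operations on events prior to [t]. *)
Lemma zero_time_lt w (t : R) : (zero_time w < t%:E)%E <->
  exists q : rat, 0 <= (ratr q : R) < t /\
    forall n : nat, exists r : rat, 0 <= (ratr r : R) <= ratr q /\ phi (Y (ratr r) w) < n.+1%:R^-1.
Proof.
have cf := path_continuous contY (w := w) cphi.
split.
  move=> /first_time_lt[s [s0 Ys st]].
  have [q /[!in_itv]/= /andP[sq qt]] := rat_in_itvoo st.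
  exists q; split; first by rewrite qt (le_trans s0 (ltW sq)).
  move=> n; have n0 : 0 < n.+1%:R^-1 :> R by rewrite invr_gt0.
  have /cvgrPdist_lt/(_ _ n0)[e /= e0 he] := cf s.
  have slt : s < Num.min (s + e) (ratr q) by rewrite lt_min sq ltrDl e0.
  have [r /[!in_itv]/= /andP[sr]] := rat_in_itvoo slt.
  rewrite lt_min => /andP[re rq]; exists r; split; first by rewrite (ltW rq) (le_trans s0 (ltW sr)).
  have := he (ratr r); rewrite /ball_/= !path_clampE//; last by rewrite (le_trans s0 (ltW sr)).
  rewrite Ys sub0r normrN (ger0_norm (phi_ge0 _)); apply.
  by rewrite ltr0_norm ?subr_lt0//; lra.
move=> [q [/andP[q0 qt] hq]]; apply/first_time_lt.
have [c /[!in_itv]/= /andP[c0 cq] hc] := EVT_min q0 (continuous_subspaceT cf).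
exists c; split => //=; last exact: le_lt_trans qt.
apply/eqP; rewrite eq_le phi_ge0 andbT; apply/ler_addgt0Pr => e e0; rewrite add0r.
near \oo => n.
have [r [/andP[r0 rq] hr]] := hq n.
have := hc (ratr r); rewrite in_itv/= r0 rq => /(_ isT).
rewrite !path_clampE// => /le_trans; apply; apply: le_trans (ltW hr) _.
rewrite invf_ple ?posrE// (@le_trans _ _ n%:R) ?ler_nat// ltW//.
by near: n; exact: nbhs_infty_gtr.
Unshelve. all: by end_near. Qed.

Lemma zero_time_attained w (t : R) : zero_time w = t%:E -> 0 <= t /\ phi (Y t w) = 0.
Proof.
move=> Tt; have cf := path_continuous contY (w := w) cphi.
have t0 : 0 <= t by rewrite -lee_fin -Tt first_time_ge0.
split=> //; apply/eqP; rewrite eq_le phi_ge0 andbT leNgt; apply/negP => p0.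
have /cvgrPdist_lt/(_ _ p0)[e /= e0 he] := cf t.
have : (zero_time w < (t + e)%:E)%E by rewrite Tt lte_fin ltrDl.
move=> /first_time_lt[s [s0 Ys st]].
have ts : t <= s by rewrite -lee_fin -Tt first_time_le.
have hs : ball_ Num.norm t e s by rewrite /ball_/= ler0_norm; lra.
by have := he s hs; rewrite /= !path_clampE// Ys subr0 ger0_norm ?phi_ge0// ltxx.
Qed.

Lemma natural_filtration_mono (s t : R) : s <= t ->
  natural_filtration Y s `<=` natural_filtration Y t.
Proof.
move=> st; apply: sub_sigma_algebra2 => A [r [B [/andP[r0 rs] oB ->]]].
by exists r, B; split => //; rewrite r0 (le_trans rs st).
Qed.

Lemma zero_time_optional (t : R) : natural_filtration Y t [set w | (zero_time w < t%:E)%E].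
Proof.
rewrite (_ : mkset _ = \bigcup_(q : rat) ((if 0 <= (ratr q : R) < t then setT else set0) `&`
  \bigcap_(n : nat) \bigcup_(r : rat)
    (if 0 <= (ratr r : R) <= ratr q then [set w | phi (Y (ratr r) w) < n.+1%:R^-1] else set0))).
  pose F := [set A | exists (s : R) B, [/\ 0 <= s <= t, open B & A = Y s @^-1` B]].
  have : F.-sigma.-measurable (\bigcup_(q : rat) ((if 0 <= (ratr q : R) < t then setT else set0) `&`
  \bigcap_(n : nat) \bigcup_(r : rat)
    (if 0 <= (ratr r : R) <= ratr q then [set w | phi (Y (ratr r) w) < n.+1%:R^-1] else set0))).
    apply: bigcupT_measurable_rat => q.
    case: ifPn => [/andP[q0 qt]|_]; last by rewrite set0I; exact: measurable0.
    rewrite setTI; apply: bigcapT_measurable => n; apply: bigcupT_measurable_rat => r.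
    case: ifPn => [/andP[r0 rq]|_]; last exact: measurable0.
    apply: sub_sigma_algebra; exists (ratr r), (phi @^-1` `]-oo, n.+1%:R^-1[%classic).
    split; first by rewrite r0 (le_trans rq (ltW qt)).
    - by move/continuousP : cphi; apply; exact: lray_open.
    - by apply/seteqP; split => w /=; rewrite in_itv.
  by [].
apply/seteqP; split => w /=.
  move=> /zero_time_lt[q [q0t hq]]; exists q => //; split; first by rewrite q0t.
  by move=> n _; have [r [r0 hr]] := hq n; exists r => //; rewrite r0.
move=> [q _ [+ hq]]; case: ifPn => // q0t _; apply/zero_time_lt; exists q; split => //.
move=> n; have [r _] := hq n I; case: ifPn => // r0 hr; by exists r.
Qed.

End HittingTimes.

(** * Hitting times of vertices and exit events *)

Section VertexHitting.
Context {R : realType} {M : metric_graph R} {d : measure_display} {W : measurableType d}.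
Local Notation opc := (one_point_compactification (mg_point M)).
Local Notation borel := (g_sigma_algebraType (@open opc)).
Local Notation V := (mg_vertex M).
Variables (P : mg_point M -> probability W R) (Y : R -> W -> opc).
Hypothesis smd : strong_markov_diffusion P Y.
Hypothesis countV : countable [set: V].

Variable hat : V -> opc -> R.
Hypothesis hat_continuous : forall v, continuous (hat v).
Hypothesis hat_le1 : forall v z, hat v z <= 1.
Hypothesis hat_eq1 : forall v z, hat v z = 1 <-> z = Some (Vtx v).

(** As [hat v] reaches its maximum [1] at [v] only, visits to [v] are the zeros of a nonnegative
    continuous function. *)
Definition vertex_time (v : V) (w : W) : \bar R := zero_time Y (fun z => 1 - hat v z) w.

Let contY := bm_continuous smd.

Let chat v : continuous (fun z => 1 - hat v z).
Proof.
move=> z; apply: (@continuous_comp _ _ _ (hat v) (fun r : R => 1 - r)); first exact: hat_continuous.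
by apply: cvgB; [exact: cvg_cst|exact: cvg_id].
Qed.

Let hat_ge0 v z : 0 <= 1 - hat v z. Proof. by rewrite subr_ge0. Qed.

Let hat_eq0 v z : 1 - hat v z = 0 <-> z = Some (Vtx v).
Proof.
rewrite -hat_eq1; split => [/eqP|->]; last by rewrite subrr.
by rewrite subr_eq0 => /eqP ->.
Qed.

Lemma vertex_time_attained v w (t : R) : vertex_time v w = t%:E -> 0 <= t /\ Y t w = Some (Vtx v).
Proof.
by move=> /(zero_time_attained contY (@chat v) (@hat_ge0 v))[t0 /hat_eq0].
Qed.

Lemma vertex_time_le v w (t : R) : 0 <= t -> Y t w = Some (Vtx v) -> (vertex_time v w <= t%:E)%E.
Proof. by move=> t0 Yt; apply: first_time_le => //=; apply/hat_eq0. Qed.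

Lemma vertex_time_ge0 v w : (0 <= vertex_time v w)%E.
Proof. exact: first_time_ge0. Qed.

Variable x : V.
Local Notation T := (vertex_hitting_time Y x).

Lemma hitting_lt w (t : R) : (T w < t%:E)%E <-> exists2 v, v <> x & (vertex_time v w < t%:E)%E.
Proof.
split.
  move=> /first_time_lt[s [s0 [v vx Ys] st]]; exists v => //; apply/first_time_lt.
  by exists s; split => //=; apply/hat_eq0.
move=> [v vx /first_time_lt[s [s0 /hat_eq0 Ys st]]]; apply/first_time_lt.
by exists s; split => //; exists v.
Qed.

Lemma hitting_ge0 w : (0 <= T w)%E.
Proof. exact: first_time_ge0. Qed.

Lemma hitting_le v w : v <> x -> (T w <= vertex_time v w)%E.
Proof.
move=> vx; apply: le_ereal_inf_tmp => _ [s [s0 /hat_eq0 Ys] <-].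
by apply: first_time_le => //; exists v.
Qed.

Let F (t : R) : set (set W) := [set A | exists (s : R) B, [/\ 0 <= s <= t, @open opc B & A = Y s @^-1` B]].

Let filtrationE (t : R) A : natural_filtration Y t A = (F t).-sigma.-measurable A.
Proof. by []. Qed.

Lemma vertex_time_lt_filtration v (t : R) :
  natural_filtration Y t [set w | (vertex_time v w < t%:E)%E].
Proof. exact: zero_time_optional. Qed.

Lemma hitting_optional : optional_time Y T.
Proof.
split; first exact: hitting_ge0.
move=> t t0; rewrite (_ : mkset _ = \bigcup_(v : V)
  (if `[< v <> x >] then [set w | (vertex_time v w < t%:E)%E] else set0)).
  rewrite filtrationE; apply: countable_bigcupT_measurable => // v.
  case: ifPn => _; last exact: measurable0.
  exact: vertex_time_lt_filtration.
apply/seteqP; split => w /=.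
  by move=> /hitting_lt[v vx Tv]; exists v => //; rewrite asboolT.
by move=> [v _]; case: asboolP => // vx Tv; apply/hitting_lt; exists v.
Qed.

(** The exit position is encoded by comparing two optional times instead of evaluating [Y] at a
    random time, which makes measurability and priority to [T] accessible. *)
Definition exit_at (v : V) : set W := [set w | T w = vertex_time v w /\ (T w < +oo)%E].

Lemma exit_atP v w : exit_at v w <->
  exists t, [/\ 0 <= t, T w = t%:E, Y t w = Some (Vtx v) & vertex_time v w = t%:E].
Proof.
split=> [[Tv Too]|[t [t0 Tt _ Tvt]]]; last by rewrite /exit_at/= Tt Tvt ltry.
exists (fine (T w)).
have TE : T w = (fine (T w))%:E by rewrite fineK// ge0_fin_numE// hitting_ge0.
have [t0 Yt] := vertex_time_attained (etrans (esym Tv) TE).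
by rewrite -Tv.
Qed.

Lemma at_hitting_time v : v <> x -> at_time Y T (Some (Vtx v)) = exit_at v.
Proof.
move=> vx; apply/seteqP; split=> w.
  move=> [t Tt Yt]; have t0 : 0 <= t by rewrite -lee_fin -Tt hitting_ge0.
  apply/exit_atP; exists t; split => //; apply/eqP; rewrite eq_le vertex_time_le//=.
  by rewrite -Tt hitting_le.
by move=> /exit_atP[t [t0 Tt Yt _]]; exists t.
Qed.

(** Since [T <= vertex_time v], the two times differ exactly when a rational separates them; the
    separating rational can be taken below [s], which keeps every event involved prior to [s]. The
    truncation [T < r] later produces the discount factor [exp (- a T)]. *)
Lemma exit_at_prior v (r : R) : v <> x ->
  prior_event Y T (exit_at v `&` [set w | (T w < r%:E)%E]).
Proof.
move=> vx t t0; pose s := Num.min r t.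
have [T0 opt] := hitting_optional.
apply: (@natural_filtration_mono _ _ _ _ _ s); first by rewrite /s ge_min lexx orbT.
have -> : exit_at v `&` [set w | (T w < r%:E)%E] `&` [set w | (T w < t%:E)%E] =
    [set w | (vertex_time v w < s%:E)%E] `\`
    \bigcup_(q : rat) (if (0 < (ratr q : R) < s) then
      [set w | (T w < (ratr q : R)%:E)%E] `\` [set w | (vertex_time v w < (ratr q : R)%:E)%E] else set0).
  apply/seteqP; split => w /=.
    move=> [[[Tv Too] Tr] Tt]; split.
      by rewrite -Tv /s minEle; case: ifP.
    by move=> [q _]; case: ifPn => // _ [/=]; rewrite Tv.
  move=> [Tvs nq].
  have Tle := hitting_le w vx.
  have Ts := le_lt_trans Tle Tvs.
  have [Tr Tt] : (T w < r%:E)%E /\ (T w < t%:E)%E.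
    by split; apply: (lt_le_trans Ts); rewrite lee_fin /s ge_min lexx ?orbT.
  split => //; split => //; split; last exact: lt_trans Tr (ltry _).
  apply/eqP; rewrite eq_le Tle/= leNgt; apply/negP => Tlt.
  have fT : T w \is a fin_num by rewrite ge0_fin_numE ?hitting_ge0// (lt_trans Ts)// ltry.
  have fTv : vertex_time v w \is a fin_num.
    by rewrite ge0_fin_numE ?vertex_time_ge0// (lt_trans Tvs)// ltry.
  have : fine (T w) < fine (vertex_time v w) by apply: fine_lt.
  move=> /rat_in_itvoo[q /[!in_itv]/= /andP[q1 q2]].
  apply: nq; exists q => //.
  rewrite (le_lt_trans _ q1) ?fine_ge0 ?hitting_ge0//=.
  rewrite -lte_fin fineK// in q2; rewrite -lte_fin fineK// in q1.
  rewrite -lte_fin (lt_trans q2 Tvs); split => //=.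
  by apply/negP; rewrite -leNgt ltW.
rewrite filtrationE; apply: measurableD; first exact: vertex_time_lt_filtration.
apply: bigcupT_measurable_rat => q; case: ifPn => [/andP[q0 qs]|_]; last exact: measurable0.
apply: (@natural_filtration_mono _ _ _ _ _ (ratr q)); first exact: ltW.
rewrite filtrationE; apply: measurableD; first exact: opt.
exact: vertex_time_lt_filtration.
Qed.

End VertexHitting.

(** * The strong Markov property at the first visit to another vertex *)

Section LebesgueShift.
Context {R : realType}.
Local Notation m := (@lebesgue_measure R).

Lemma lebesgue_measure_shift (c : R) (A : set R) : measurable A ->
  m ((fun t => t + c) @^-1` A) = m A.
Proof.
have ms : @measurable_fun _ _ (measurableTypeR R) (measurableTypeR R) setT (fun t => t + c).
  exact: measurable_funD.
move=> mA; apply/esym.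
pose mu : {measure set (measurableTypeR R) -> \bar R} :=
  pushforward m (fun t : measurableTypeR R => (t + c : measurableTypeR R)).
apply: (lebesgue_measure_unique (mu := mu ms)) mA => _ [[a b] _ <-].
have preE : (fun t => t + c) @^-1` `]a, b]%classic = `]a - c, b - c]%classic.
  by apply/seteqP; split => t /=; rewrite !in_itv/= ltrBlDr lerBrDr.
transitivity (m ((fun t => t + c) @^-1` `]a, b]%classic)); last by [].
rewrite preE/= !lebesgue_measure_itv/= !lte_fin ltrD2r; case: ifP => // _.
by rewrite -!EFinB; congr EFin; ring.
Qed.

Lemma lebesgue_integral_shift (c : R) (f : R -> \bar R) : m.-integrable setT f ->
  (\int[m]_t f (t + c)%R = \int[m]_t f t)%E.
Proof.
have ms : @measurable_fun _ _ (measurableTypeR R) (measurableTypeR R) setT (fun t => t + c).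
  exact: measurable_funD.
move=> i_f; have mf := measurable_int _ i_f.
have absE : (\int[m]_t `|f (t + c)%R| = \int[m]_t `|f t|)%E.
  have mabs : measurable_fun setT (abse \o f) by exact: measurableT_comp.
  rewrite -[LHS](ge0_integral_pushforward ms m measurableT mabs (fun y _ => abse_ge0 _)).
  by apply: eq_measure_integral => A mA _; exact: lebesgue_measure_shift.
have ifc : m.-integrable setT (f \o (fun t => t + c)).
  apply/integrableP; split; first exact: measurableT_comp.
  by rewrite /= absE; case/integrableP : i_f.
rewrite -[LHS](integral_pushforward ms (f := f) (mu := m) (D := setT))//.
by apply: eq_measure_integral => A mA _; exact: lebesgue_measure_shift.
Qed.

End LebesgueShift.

(** * Integrals discounted by an exponential density *)

Section Discount.
Context {R : realType} {d : measure_display} {W : measurableType d}.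
Local Notation m := (@lebesgue_measure R).
Variable a : R.
Hypothesis a_gt0 : 0 < a.
Local Notation kappa := (exponential_pdf a).

Let kappa_ge0 t : 0 <= kappa t.
Proof. by apply: exponential_pdf_ge0; exact: ltW. Qed.

Let mkappa : measurable_fun setT kappa.
Proof. exact: measurable_exponential_pdf. Qed.

Lemma exponential_pdfD (s t : R) : 0 <= s -> 0 <= t ->
  kappa (s + t) = expR (- a * s) * kappa t.
Proof.
move=> s0 t0; rewrite !exponential_pdfE ?addr_ge0//.
by rewrite mulrDr expRD mulrCA.
Qed.

Lemma discount_integrable (g : R -> R) (K : R) : measurable_fun setT g ->
  (forall t, `|g t| <= K) -> m.-integrable setT (fun t => (kappa t * g t)%:E).
Proof.
move=> mg gK; have iK := integrableZl measurableT K (integrable_exponential_pdf a_gt0).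
apply: le_integrable iK => //; first by apply/measurable_EFinP; exact: measurable_funM.
move=> t _; rewrite /= lee_fin normrM mulrC [leRHS]normrM ler_wpM2r//.
exact: le_trans (ler_norm _).
Qed.

Lemma Rintegral_discount_cst (c : R) : \int[m]_t (kappa t * c) = c.
Proof.
rewrite RintegralZr//; last exact: integrable_exponential_pdf.
by rewrite /Rintegral integral_exponential_pdf// mul1r.
Qed.

(** Memorylessness: the part after [c], shifted back to time [0], sees the same density up to the
    factor [exp (- a c)]. *)
Lemma discount_split (c : R) (h : R -> R) (K : R) : 0 <= c ->
  measurable_fun setT h -> (forall t, `|h t| <= K) ->
  \int[m]_t (kappa t * h t) =
  \int[m]_t (kappa t * (if t < c then h t else 0)) +
    expR (- a * c) * \int[m]_t (kappa t * h (c + t)).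
Proof.
move=> c0 mh hK; have K0 : 0 <= K by apply: le_trans (hK 0).
have mlt : measurable_fun setT (fun t : R => t < c) by exact: measurable_fun_ltr.
have i1 : m.-integrable setT (fun t => (kappa t * (if t < c then h t else 0))%:E).
  apply: (discount_integrable (K := K)) => [|t]; first exact: measurable_fun_ifT.
  by case: ifP; rewrite ?normr0.
have i2 : m.-integrable setT (fun t => (kappa t * (if t < c then 0 else h t))%:E).
  apply: (discount_integrable (K := K)) => [|t]; first exact: measurable_fun_ifT.
  by case: ifP; rewrite ?normr0.
have i3 : m.-integrable setT (fun t => (kappa t * h (c + t))%:E).
  apply: (discount_integrable (K := K)) => [|t]; last exact: hK.
  by apply: measurableT_comp => //; exact: measurable_funD.
rewrite -RintegralZl//.
transitivity (\int[m]_t (kappa t * (if t < c then h t else 0) + kappa t * (if t < c then 0 else h t))).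
  by apply: eq_Rintegral => t _; rewrite -mulrDr; case: ifP; rewrite ?addr0 ?add0r.
rewrite RintegralD//; congr (_ + _); rewrite /Rintegral -(lebesgue_integral_shift c i2).
congr fine; apply: eq_integral => t _; congr EFin.
(* For negative [t] the left side vanishes by the indicator and the right side by the density. *)
have [t0|t0] := ltP t 0.
  by rewrite gtrDr t0 mulr0 (lt0_exponential_pdf _ t0) mul0r mulr0.
rewrite ltNge lerDr t0/= (addrC t) exponential_pdfD// mulrA; congr (_ * _).
Qed.

Lemma discount_tail (c : R) : 0 <= c ->
  \int[m]_t (kappa t * (if c < t then 1 else 0)) = expR (- a * c).
Proof.
move=> c0; have K1 t : `|if t < c then 0 else 1 : R| <= 1.
  by case: ifP; rewrite ?normr0 ?normr1.
(* The strict inequality is relaxed at the single point [c], so that [discount_split] applies to the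
   indicator of [t >= c]. *)
transitivity (\int[m]_t (kappa t * (if t < c then 0 else 1))).
  transitivity (\int[m]_(t in `]c, +oo[) kappa t).
    rewrite [RHS]Rintegral_mkcond; apply: eq_Rintegral => t _.
    rewrite patchE; have -> : (t \in [set` `]c, +oo[]) = (c < t).
      by apply/idP/idP; rewrite inE/= in_itv/= andbT.
    by case: ifP; rewrite ?mulr1 ?mulr0.
  rewrite Rintegral_itv_obnd_cbnd; last first.
    by apply: integrableS (integrable_exponential_pdf a_gt0).
  rewrite [LHS]Rintegral_mkcond; apply: eq_Rintegral => t _.
  rewrite patchE; have -> : (t \in [set` `[c, +oo[]) = ~~ (t < c).
    by rewrite -leNgt; apply/idP/idP; rewrite inE/= in_itv/= andbT.
  by case: (t < c); rewrite ?mulr1 ?mulr0.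
have ml : measurable_fun setT (fun t : R => if t < c then 0 else 1 : R).
  by apply: measurable_fun_ifT => //; exact: measurable_fun_ltr.
rewrite (discount_split c0 ml K1) (_ : \int[m]_t _ = 0); last first.
  by apply: Rintegral_eq0 => t _; case: (t < c); rewrite mulr0.
rewrite add0r (_ : \int[m]_t _ = 1) ?mulr1// -[RHS]Rintegral_discount_cst.
apply: eq_Rintegral => t _; have [t0|t0] := ltP t 0; first by rewrite lt0_exponential_pdf// !mul0r.
by rewrite ltNge lerDl t0 mulr1.
Qed.

Variable Q : probability W R.

Lemma bounded_integrable (h : W -> R) (K : R) (A : set W) : measurable A -> measurable_fun setT h ->
  (forall w, `|h w| <= K) -> Q.-integrable A (EFin \o h).
Proof.
move=> mA mh hK; apply: measurable_bounded_integrable => //.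
- by rewrite (le_lt_trans (probability_le1 _ _))// ltry.
- exact: measurable_funTS.
- by exists K; split => [|x Kx w _]; [exact: num_real|exact: le_trans (hK w) (ltW Kx)].
Qed.

Variables (g : R * W -> R) (K : R).
Hypothesis mg : measurable_fun setT g.
Hypothesis gK : forall p, `|g p| <= K.

Let G (p : R * W) : \bar R := (kappa p.1 * g p)%:E.

Let mG : measurable_fun setT G.
Proof.
apply/measurable_EFinP; apply: measurable_funM => //.
exact: (measurableT_comp mkappa (@measurable_fst _ _ R W)).
Qed.

Let mg1 (t : R) : measurable_fun setT (fun w => g (t, w)).
Proof. by apply: (measurableT_comp mg); exact: pair1_measurable. Qed.

Let mg2 (w : W) : measurable_fun setT (fun t => g (t, w)).
Proof. by apply: (measurableT_comp mg); exact: pair2_measurable. Qed.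

Let iG : (m \x Q)%E.-integrable setT G.
Proof.
apply/integrable12ltyP => //.
have K0 : 0 <= K.
  have [w _] : exists w : W, True by exists point.
  by apply: le_trans (gK (0, w)).
apply: (@le_lt_trans _ _ (\int[m]_t (kappa t * K)%:E)%E).
  apply: ge0_le_integral => //.
  - by move=> t _; exact: integral_ge0.
  - have mabs : measurable_fun setT (abse \o G) by exact: measurableT_comp.
    exact: (measurable_fun_fubini_tonelli_F (m2 := Q) _ mabs (fun=> abse_ge0 _)).
  - by apply/measurable_EFinP; exact: measurable_funM.
  - move=> t _; apply: (@le_trans _ _ (\int[Q]_w (kappa t * K)%:E)%E).
      apply: ge0_le_integral => //.
      + do 2 apply: measurableT_comp => //; exact: measurable_funM.
      + by move=> w _; rewrite lee_fin normrM (ger0_norm (kappa_ge0 _)) ler_wpM2l.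
    by rewrite integral_cst//= probability_setT mule1.
under eq_integral do rewrite EFinM.
rewrite ge0_integralZr//; last 2 first.
- by apply/measurable_EFinP.
- by move=> t _; rewrite lee_fin.
by rewrite integral_exponential_pdf// mul1e ltry.
Qed.

Lemma discount_measurable : measurable_fun setT (fun w => \int[m]_t (kappa t * g (t, w))).
Proof.
apply/measurable_EFinP.
rewrite (_ : EFin \o _ = fubini_G m G); first exact: (measurable_fubini_G iG).
apply/funext => w; rewrite /fubini_G /= fineK//.
by apply: integrable_fin_num => //; exact: (discount_integrable (mg2 w)).
Qed.

Lemma discount_bounded w : `|\int[m]_t (kappa t * g (t, w))| <= K.
Proof.
have i1 := discount_integrable (mg2 w) (fun t => gK (t, w)).
apply: le_trans (le_normr_Rintegral _ i1) _ => //.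
rewrite -[leRHS]Rintegral_discount_cst; apply: le_Rintegral => //.
- exact: integrable_norm.
- have K0 : 0 <= K by apply: le_trans (gK (0, w)).
  by apply: (@discount_integrable _ K) => // t; rewrite ger0_norm.
- by move=> t _; rewrite normrM (ger0_norm (kappa_ge0 _)) ler_wpM2l.
Qed.

Lemma discount_slice_integrable :
  m.-integrable setT (fun t => (kappa t * \int[Q]_w g (t, w))%:E).
Proof.
rewrite (_ : (fun t => _) = fubini_F Q G); first exact: (integrable_fubini_F iG).
apply/funext => t; rewrite /fubini_F /G/=.
have i1 : Q.-integrable setT (fun w => (g (t, w))%:E) by apply: (bounded_integrable (K := K)).
rewrite (eq_integral (fun w => ((kappa t)%:E * (g (t, w))%:E)%E)) => [|w _]; last by rewrite EFinM.
by rewrite integralZl// EFinM fineK//; exact: integrable_fin_num.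
Qed.

Lemma discount_Fubini :
  \int[m]_t (kappa t * \int[Q]_w g (t, w)) = \int[Q]_w \int[m]_t (kappa t * g (t, w)).
Proof.
have := Fubini iG; rewrite /Rintegral => FG; congr fine.
transitivity (\int[m]_x \int[Q]_y G (x, y))%E.
  apply: eq_integral => t _; rewrite /G/= EFinM fineK.
    rewrite -integralZl//; last by apply: (bounded_integrable (K := K)).
  by apply: integrable_fin_num => //; apply: (bounded_integrable (K := K)).
rewrite FG; apply: eq_integral => w _; rewrite /G/= fineK//.
by apply: integrable_fin_num => //; exact: (discount_integrable (mg2 w)).
Qed.

End Discount.

(** * From conditional laws to conditional expectations *)

Section ConditionalLaw.
Context {R : realType} {d1 d2 : measure_display} {W1 : measurableType d1} {W2 : measurableType d2}.
Variables (P : probability W1 R) (Q : probability W2 R).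
Variables (A : set W1) (f : W1 -> R) (g : W2 -> R) (K : R).
Hypotheses (mA : measurable A) (mf : measurable_fun setT f) (mg : measurable_fun setT g).
Hypotheses (fK : forall w, `|f w| <= K) (gK : forall w, `|g w| <= K).
Hypothesis law : forall C : set R, measurable C ->
  P (A `&` f @^-1` C) = (P A * Q (g @^-1` C))%E.

Lemma ge0_integral_mrestr (h : W1 -> \bar R) : measurable_fun setT h ->
  (forall w, (0 <= h w)%E) -> (\int[mrestr P mA]_w h w = \int[P]_(w in A) h w)%E.
Proof.
move=> mh h0; rewrite -(setUv A) ge0_integral_setU//=; last 3 first.
- exact: measurableC.
- by rewrite setUv.
- by apply/disj_setPS; rewrite setICr.
rewrite [X in (_ + X)%E]null_set_integral ?adde0//.
- by apply: eq_measure_integral => B mB BA /=; rewrite /mrestr; congr (P _); exact: setIidl.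
- exact: measurableC.
- exact: measurable_funTS.
- by rewrite /= /mrestr setICl measure0.
Qed.

(** The hypothesis says that the image by [f] of [P] restricted to [A] is [P A] times the image of
    [Q] by [g]; integrating the identity against both images gives the claim. *)
Lemma Rintegral_conditional_law :
  \int[P]_(w in A) f w = fine (P A) * \int[Q]_w g w.
Proof.
have K0 : 0 <= K by apply: le_trans (fK point).
(* The change of variables is used for nonnegative integrands; the shift by [K] is undone at the end
   by linearity. *)
pose f' w := f w + K; pose g' w := g w + K.
have f'0 w : 0 <= f' w by have := fK w; rewrite ler_norml => /andP[]; rewrite /f'; lra.
have g'0 w : 0 <= g' w by have := gK w; rewrite ler_norml => /andP[]; rewrite /g'; lra.
have mf' : measurable_fun setT f' by exact: measurable_funD.
have mg' : measurable_fun setT g' by exact: measurable_funD.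
have PA : P A \is a fin_num by exact: fin_num_measure.
have PAnn : 0 <= fine (P A) by rewrite fine_ge0.
pose D : set R := `[0, +oo[%classic.
have mD : measurable D by exact: measurable_itv.
have preT (T0 : Type) (h : T0 -> R) : (forall w, 0 <= h w) -> h @^-1` D = setT.
  by move=> h0; apply/seteqP; split => // w _; rewrite /preimage/= /D/= in_itv/= h0.
have iE : (\int[P]_(w in A) (f' w)%:E = P A * \int[Q]_w (g' w)%:E)%E.
  rewrite -ge0_integral_mrestr; [|exact/measurable_EFinP|by move=> w; rewrite lee_fin].
  rewrite -[X in integral _ X _](preT _ f')//
    -[LHS](ge0_integral_pushforward mf' _ mD (f := EFin))//; last first.
    by move=> y; rewrite inE/= /D/= in_itv/= andbT lee_fin.
  rewrite -[X in (_ * integral _ X _)%E](preT _ g')//.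
  rewrite -[X in (_ * X)%E](ge0_integral_pushforward mg' _ mD (f := EFin))//; last first.
    by move=> y; rewrite inE/= /D/= in_itv/= andbT lee_fin.
  have <- : ((NngNum PAnn)%:num)%:E = P A by rewrite /= fineK.
  have mE : measurable_fun D (EFin : R -> \bar R) by [].
  have E0 y : D y -> (0 <= EFin y)%E by rewrite /D/= in_itv/= andbT lee_fin.
  have scaleE := @ge0_integral_mscale _ _ _ (pushforward Q g') _ mD (NngNum PAnn).
  rewrite -(scaleE mg' _ mE E0).
  apply: eq_measure_integral => B mB _.
  have mC : measurable ((fun y : R => y + K) @^-1` B).
    by rewrite -[X in measurable X]setTI; apply: (measurable_funD _ _ measurableT mB) => //.
  have lawC := law mC.
  transitivity (P (f' @^-1` B `&` A)); first by [].
  rewrite setIC; transitivity ((fine (P A))%:E * Q (g' @^-1` B))%E; last by [].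
  by rewrite fineK//; exact: lawC.
have prob_cst d (T : measurableType d) (P0 : probability T R) : P0 setT = 1%E by exact: probability_setT.
have if' : P.-integrable A (EFin \o f).
  exact: (bounded_integrable P mA mf fK).
have ig' : Q.-integrable setT (EFin \o g).
  exact: (bounded_integrable Q measurableT mg gK).
have icP : P.-integrable A (EFin \o cst K).
  by apply: (bounded_integrable P mA (@measurable_cst _ _ _ _ setT K) (K := `|K|)).
have icQ : Q.-integrable setT (EFin \o cst K).
  by apply: (bounded_integrable Q measurableT (@measurable_cst _ _ _ _ setT K) (K := `|K|)).
have eP : \int[P]_(w in A) f' w = \int[P]_(w in A) f w + K * fine (P A).
  by rewrite RintegralD// Rintegral_cst.
have eQ : \int[Q]_w g' w = \int[Q]_w g w + K.
  by rewrite RintegralD// Rintegral_cst//= probability_setT/= mulr1.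
have iE' : \int[P]_(w in A) f' w = fine (P A) * \int[Q]_w g' w.
  rewrite /Rintegral iE fineM//; apply: integrable_fin_num => //.
  exact: (integrableD _ ig' icQ).
move: iE'; rewrite eP eQ mulrDr (mulrC K); exact: addIr.
Qed.

End ConditionalLaw.

Section Slices.
Context {R : realType} {d : measure_display} {W : measurableType d}.
Variable g : R * W -> R.
Hypothesis mg : measurable_fun setT g.

Lemma measurable_slice1 (t : R) : measurable_fun setT (fun w => g (t, w)).
Proof. by apply: (measurableT_comp mg); exact: pair1_measurable. Qed.

Lemma measurable_slice2 (w : W) : measurable_fun setT (fun t => g (t, w)).
Proof. by apply: (measurableT_comp mg); exact: pair2_measurable. Qed.

End Slices.

(** * Decomposition at the first visit to another vertex *)

Section Dynkin.
Context {R : realType} {M : metric_graph R} {d : measure_display} {W : measurableType d}.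
Local Notation opc := (one_point_compactification (mg_point M)).
Local Notation borel := (g_sigma_algebraType (@open opc)).
Local Notation V := (mg_vertex M).
Local Notation m := (@lebesgue_measure R).
Variables (P : mg_point M -> probability W R) (Y : R -> W -> opc).
Hypothesis smd : strong_markov_diffusion P Y.
Hypothesis countV : countable [set: V].

Variable hat : V -> opc -> R.
Hypothesis hat_continuous : forall v, continuous (hat v).
Hypothesis hat_le1 : forall v z, hat v z <= 1.
Hypothesis hat_eq1 : forall v z, hat v z = 1 <-> z = Some (Vtx v).

Variable x : V.
Hypothesis separated : forall z : mg_point M, (forall v, v <> x -> z <> Vtx v) ->
  exists b : opc -> R, [/\ continuous b, b (Some z) != 0 &
    forall v, v <> x -> b (Some (Vtx v)) = 0].

Local Notation T := (vertex_hitting_time Y x).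
Local Notation exit_at := (exit_at Y hat x).
Local Notation vertex_time := (vertex_time Y hat).

Lemma filtration_measurable (t : R) (A : set W) : natural_filtration Y t A -> measurable A.
Proof.
apply: smallest_sub; first exact: sigma_algebra_measurable.
move=> _ [s [B [/andP[s0 _] oB ->]]].
rewrite -[X in measurable X]setTI; apply: (bm_measurable smd s0) => //.
exact: sub_sigma_algebra.
Qed.

Lemma time_measurable (tau : W -> \bar R) :
  (forall t, natural_filtration Y t [set w | (tau w < t%:E)%E]) -> measurable_fun setT tau.
Proof.
move=> ftau; apply: (measurability _ (ErealGenInftyO.measurableE R)) => _ /= -[_ [r ->] <-].
rewrite setTI; have := filtration_measurable (ftau r).
by congr measurable; apply/seteqP; split => w /=; rewrite in_itv.
Qed.

Lemma hitting_measurable : measurable_fun setT T.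
Proof.
have [T0 opt] := hitting_optional smd countV hat_continuous hat_le1 hat_eq1 x.
apply: time_measurable => t; have [t0|t0] := ltP 0 t; first exact: opt.
rewrite (_ : mkset _ = set0); last first.
  apply/seteqP; split => // w /=; apply/negP; rewrite -leNgt.
  by apply: le_trans (T0 w); rewrite lee_fin.
exact: (@measurable0 _ (g_sigma_algebraType
  [set A | exists (s : R) B, [/\ 0 <= s <= t, @open opc B & A = Y s @^-1` B]])).
Qed.

Lemma vertex_time_measurable v : measurable_fun setT (vertex_time v).
Proof.
apply: time_measurable => t.
exact: (vertex_time_lt_filtration smd hat_continuous hat_le1).
Qed.

Lemma measurable_exit_at v : measurable (exit_at v).
Proof.
have -> : exit_at v = [set w | T w = vertex_time v w] `&` [set w | (T w < +oo)%E] by [].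
apply: measurableI.
  rewrite -[X in measurable X]setTI.
  by apply: measurable_eqe => //; [exact: hitting_measurable|exact: vertex_time_measurable].
rewrite -[X in measurable X]setTI.
by apply: measurable_lte => //; exact: hitting_measurable.
Qed.

(** The set of targets may be infinite, so attainment needs an argument. Visits occur arbitrarily
    soon after [T]; if [Y] were not at a target at time [T], the function [b] of [separated] would
    be nonzero there and yet vanish at these visits. *)
Lemma exit_vertex w : (T w < +oo)%E -> exists2 v, v <> x & exit_at v w.
Proof.
move=> Too; have contY := bm_continuous smd.
have T0 : (0 <= T w)%E by exact: first_time_ge0.
have TE : T w = (fine (T w))%:E by rewrite fineK// ge0_fin_numE.
move: TE; set t := fine _ => TE.
have t0 : 0 <= t by rewrite -lee_fin -TE.
have after e : 0 < e -> exists s v, [/\ t <= s, s < t + e, v <> x & Y s w = Some (Vtx v)].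
  move=> e0; have : (T w < (t + e)%:E)%E by rewrite TE lte_fin ltrDl.
  move=> /first_time_lt[s [s0 [v vx Ys] st]]; exists s, v; split => //.
  by rewrite -lee_fin -TE; apply: first_time_le => //; exists v.
suff [v vx Yt] : exists2 v, v <> x & Y t w = Some (Vtx v).
  exists v => //; split => //; apply/eqP; rewrite eq_le.
  rewrite (hitting_le Y hat_eq1 w vx) TE /=.
  exact: (vertex_time_le hat_eq1).
(* The cemetery is absorbing, so it cannot be occupied before a visit to a vertex. *)
case Yt : (Y t w) => [z|]; last first.
  have [s [v [ts _ _ Ys]]] := after 1 ltr01.
  by have := bm_cemetery smd (_ : 0 <= t <= s) Yt; rewrite t0 ts Ys => /(_ isT).
apply: contrapT => nv; have [v vx zv|b [cb bz b0]] := separated (z := z).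
  by apply: nv; exists v => //; rewrite zv.
have cf := path_continuous contY (w := w) cb.
have bz' : 0 < `|b (Some z)| by rewrite normr_gt0.
have /cvgrPdist_lt/(_ _ bz')[e /= e0 he] := cf t.
have [s [v [ts st vx Ys]]] := after e e0.
have hs : ball_ Num.norm t e s by rewrite /ball_/= ler0_norm; lra.
have := he s hs; rewrite /= !path_clampE ?(le_trans t0)// Yt Ys b0// subr0.
by rewrite ltxx.
Qed.

Variables (f : opc -> R) (K : R).
Hypothesis mf : measurable_fun setT (f : borel -> R).
Hypothesis jf : measurable_fun setT (fun p : R * W => f (clamp_path Y p)).
Hypothesis fK : forall z, `|f z| <= K.

Local Notation Tr w := (fine (T w)).

Let mTr : measurable_fun setT (fun w => Tr w).
Proof. exact: (measurableT_comp (fine_measurable measurableT) hitting_measurable). Qed.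

(** Where [T] is infinite, [fine] gives the default time [0]; the events on which [post] is
    integrated all lie in [T < +oo]. *)
Let post (s : R) (w : W) : R := f (clamp_path Y (Tr w + s, w)).

Let mpost : measurable_fun setT (fun p : R * W => post p.1 p.2).
Proof.
have mh : measurable_fun setT (fun p : R * W => (Tr p.2 + p.1, p.2)).
  apply/measurable_fun_pairP; split; last exact: measurable_snd.
  apply: measurable_funD; last exact: measurable_fst.
  exact: (measurableT_comp mTr (@measurable_snd _ _ R W)).
exact: (measurableT_comp jf mh).
Qed.

Let mpost1 s : measurable_fun setT (post s).
Proof. exact: (measurable_slice1 mpost s). Qed.

Let mf1 s : measurable_fun setT (fun w => f (clamp_path Y (s, w))).
Proof. exact: (measurable_slice1 jf s). Qed.

(** On this event the position at [T] is the fixed vertex [v], so the transition probability in the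
    strong Markov property is constant and the law factorizes. *)
Lemma strong_markov_expectation (v : V) (s r : R) : v <> x -> 0 <= s ->
  \int[P (Vtx x)]_(w in exit_at v `&` [set w | (T w < r%:E)%E]) post s w =
  fine (P (Vtx x) (exit_at v `&` [set w | (T w < r%:E)%E])) *
    \int[P (Vtx v)]_w f (clamp_path Y (s, w)).
Proof.
move=> vx s0; set A := _ `&` _.
have mA : measurable A.
  apply: measurableI; first exact: measurable_exit_at.
  rewrite -[X in measurable X]setTI.
  by apply: measurable_lte => //; exact: hitting_measurable.
apply: (@Rintegral_conditional_law _ _ _ _ _ _ _ _ (post s) (fun w => f (clamp_path Y (s, w))) K) => //.
  by move=> w; exact: fK.
move=> C mC; pose B : set borel := f @^-1` C.
have mB : measurable B by rewrite -[X in measurable X]setTI; exact: mf.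
have opt := hitting_optional smd countV hat_continuous hat_le1 hat_eq1 x.
have pri := exit_at_prior smd countV hat_continuous hat_le1 hat_eq1 r vx.
have TA w : A w -> [/\ (T w < +oo)%E, 0 <= Tr w & Y (Tr w) w = Some (Vtx v)].
  move=> [/(exit_atP smd hat_continuous hat_le1 hat_eq1)[t [t0 Tt Yt _]] _].
  by rewrite Tt /= ltry.
have := bm_strong_markov smd (Vtx x) opt pri s0 mB.
rewrite -/A (_ : [set w | _] = A `&` post s @^-1` C); last first.
  apply/seteqP; split=> w.
    by move=> [Aw Too BY]; split => //; rewrite /preimage/= /post path_clampE ?addr_ge0//; have [] := TA w Aw.
  move=> [Aw Cw]; have [Too Tr0 _] := TA w Aw; split => //.
  by move: Cw; rewrite /preimage/= /post path_clampE ?addr_ge0.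
move=> ->; rewrite (_ : A `&` _ = A); last first.
  by apply/seteqP; split => [w []//|w Aw]; split => //; have [] := TA w Aw.
rewrite (eq_integral (fun=> P (Vtx v) (Y s @^-1` B))); last first.
  by move=> w; rewrite inE => /TA[_ _ ->].
rewrite integral_cst//= muleC; congr (_ * P _ _)%E.
by apply/seteqP; split => w; rewrite /preimage/= path_clampE.
Qed.

Variable a : R.
Hypothesis a_gt0 : 0 < a.
Local Notation kappa := (exponential_pdf a).

(** The Laplace transform of [E_v (f (Y_t))], normalized to be [a] times the resolvent. *)
Definition laplace (v : V) : R := \int[m]_t (kappa t * \int[P (Vtx v)]_w f (clamp_path Y (t, w))).

Let Z (w : W) : R := \int[m]_t (kappa t * post t w).

Let mZ : measurable_fun setT Z.
Proof. exact: (discount_measurable a_gt0 (P (Vtx x)) mpost (fun p => fK _)). Qed.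

Let ZK w : `|Z w| <= K.
Proof. exact: (discount_bounded a_gt0 mpost (fun p => fK _)). Qed.

Lemma post_expectation (v : V) (r : R) : v <> x ->
  \int[P (Vtx x)]_(w in exit_at v `&` [set w | (T w < r%:E)%E]) Z w =
  fine (P (Vtx x) (exit_at v `&` [set w | (T w < r%:E)%E])) * laplace v.
Proof.
move=> vx; set A := _ `&` _.
have mA : measurable A.
  apply: measurableI; first exact: measurable_exit_at.
  rewrite -[X in measurable X]setTI.
  by apply: measurable_lte => //; exact: hitting_measurable.
have Rmk (h : W -> R) : \int[P (Vtx x)]_(w in A) h w = \int[P (Vtx x)]_w (\1_A w * h w).
  rewrite Rintegral_mkcond; apply: eq_Rintegral => w _.
  by rewrite patchE indicE; case: ifP => _; rewrite ?mul1r ?mul0r.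
rewrite Rmk.
pose g (p : R * W) := \1_A p.2 * post p.1 p.2.
have mg : measurable_fun setT g.
  apply: measurable_funM => //.
  exact: (measurableT_comp (measurable_indic mA) (@measurable_snd _ _ R W)).
have gK p : `|g p| <= K.
  rewrite normrM; apply: le_trans (fK (clamp_path Y (Tr p.2 + p.1, p.2))).
  by rewrite ler_piMl// indicE; case: (_ \in _); rewrite ?normr0 ?normr1.
transitivity (\int[P (Vtx x)]_w \int[m]_t (kappa t * g (t, w))).
  apply: eq_Rintegral => w _.
  rewrite -RintegralZl//; last first.
    apply: (discount_integrable a_gt0 (K := K)) => [|t]; last exact: fK.
    exact: (measurable_slice2 mpost w).
  by apply: eq_Rintegral => t _; rewrite /g/= mulrCA.
rewrite -(discount_Fubini a_gt0 (P (Vtx x)) mg gK) -RintegralZl//; last first.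
  exact: (discount_slice_integrable a_gt0 (P (Vtx v)) jf (fun p => fK _)).
apply: eq_Rintegral => t _.
have [t0|t0] := ltP t 0; first by rewrite lt0_exponential_pdf ?mul0r ?mulr0.
by rewrite -Rmk /= strong_markov_expectation// mulrCA.
Qed.

(** Integrating [post_expectation] against the exponential density in [r] turns the
    events [T < r] into the factor [exp (- a T)]. *)
Lemma discounted_exit (v : V) : v <> x ->
  \int[P (Vtx x)]_(w in exit_at v) (expR (- a * Tr w) * (Z w - laplace v)) = 0.
Proof.
move=> vx; have mA := measurable_exit_at v.
pose c := laplace v.
pose g (p : R * W) : R :=
  if (p.2 \in exit_at v) && (T p.2 < p.1%:E)%E then Z p.2 - c else 0.
have mg : measurable_fun setT g.
  apply: measurable_fun_ifT => //; last first.
    apply: measurable_funD => //; exact: (measurableT_comp mZ (@measurable_snd _ _ R W)).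
  apply: measurable_and.
    have mind : measurable_fun setT (fun w => w \in exit_at v).
      apply: (@measurable_fun_bool _ _ _ _ true); rewrite setTI.
      by rewrite (_ : _ @^-1` _ = exit_at v)//; apply/seteqP; split=> w /=; [move/set_mem|move/mem_set].
    exact: (measurableT_comp mind (@measurable_snd _ _ R W)).
  apply: (@measurable_fun_bool _ _ _ _ true); apply: measurable_lte => //.
    exact: (measurableT_comp hitting_measurable (@measurable_snd _ _ R W)).
  exact: (measurableT_comp _ (@measurable_fst _ _ R W)).
have gK p : `|g p| <= K + `|c|.
  rewrite /g; case: ifP => _; last by rewrite normr0 addr_ge0// (le_trans (normr_ge0 (Z p.2))).
  by rewrite (le_trans (ler_normB _ _))// lerD2r.
have gE r w : g (r, w) = ((fun w => Z w - c) \_ (exit_at v `&` [set w | (T w < r%:E)%E])) w.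
  rewrite /g patchE/= in_setI; congr (if _ && _ then _ else _).
  by apply/idP/idP; rewrite inE.
have H := discount_Fubini a_gt0 (P (Vtx x)) mg gK.
transitivity (\int[m]_r (kappa r * \int[P (Vtx x)]_w g (r, w))).
  rewrite H Rintegral_mkcond; apply: eq_Rintegral => w _; rewrite patchE.
  case: ifPn => wA; last first.
    by apply/esym/Rintegral_eq0 => t _; rewrite /g/= (negbTE wA) mulr0.
  move: (wA); rewrite inE => /(exit_atP smd hat_continuous hat_le1 hat_eq1)[t [t0 Tt _ _]].
  rewrite Tt/= -(discount_tail a_gt0 t0) -RintegralZr//; last first.
    apply: (discount_integrable a_gt0 (K := 1)) => [|s].
      by apply: measurable_fun_ifT => //; exact: measurable_fun_ltr.
    by case: ifP; rewrite ?normr0 ?normr1.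
  apply: eq_Rintegral => s _; rewrite /g/= wA Tt lte_fin/= -mulrA; congr (_ * _).
  by case: ifP; rewrite ?mul1r ?mul0r.
apply: Rintegral_eq0 => r _; apply/eqP; rewrite mulf_eq0; apply/orP; right; apply/eqP.
have mC : measurable (exit_at v `&` [set w | (T w < r%:E)%E]).
  apply: measurableI => //; rewrite -[X in measurable X]setTI.
  by apply: measurable_lte => //; exact: hitting_measurable.
under eq_Rintegral do rewrite gE.
rewrite -Rintegral_mkcond RintegralB//.
- by rewrite post_expectation// Rintegral_cst// mulrC subrr.
- exact: (bounded_integrable (P (Vtx x)) mC mZ ZK).
- exact: (bounded_integrable (P (Vtx x)) mC (@measurable_cst _ _ _ _ _ c) (K := `|c|)).
Qed.

Lemma exit_at_disjoint (v v' : V) w : exit_at v w -> exit_at v' w -> v = v'.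
Proof.
move=> /(exit_atP smd hat_continuous hat_le1 hat_eq1)[t [t0 Tt Yt _]].
move=> /(exit_atP smd hat_continuous hat_le1 hat_eq1)[t' [t'0 Tt' Yt' _]].
move: Tt'; rewrite Tt => -[tt']; move: Yt'; rewrite -tt' Yt => -[].
by [].
Qed.

Let h (w : W) : R := expR (- a * Tr w) * Z w.

Let mexp : measurable_fun setT (fun w => expR (- a * Tr w)).
Proof. by apply: measurableT_comp => //; apply: measurable_funM. Qed.

Let Tr_ge0 w : 0 <= Tr w.
Proof. by rewrite fine_ge0//; exact: first_time_ge0. Qed.

Let exp_le1 w : `|expR (- a * Tr w)| <= 1.
Proof.
rewrite ger0_norm ?expR_ge0// -expR0 ler_expR mulNr oppr_le0.
by rewrite mulr_ge0// ltW.
Qed.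

Let mh : measurable_fun setT h.
Proof. exact: measurable_funM. Qed.

Let hK w : `|h w| <= K.
Proof. by rewrite normrM (le_trans _ (ZK w))// ler_piMl. Qed.

Lemma discounted_exit_at (v : V) : v <> x ->
  \int[P (Vtx x)]_(w in exit_at v) h w =
  laplace v * \int[P (Vtx x)]_(w in exit_at v) expR (- a * Tr w).
Proof.
move=> vx; have mA := measurable_exit_at v.
have ih := bounded_integrable (P (Vtx x)) mA mh hK.
have ie := bounded_integrable (P (Vtx x)) mA mexp exp_le1.
have ic : (P (Vtx x)).-integrable (exit_at v) (EFin \o (fun w => laplace v * expR (- a * Tr w))).
  exact: (integrableZl mA (laplace v) ie).
apply/eqP; rewrite -subr_eq0 -RintegralZl// -RintegralB//.
rewrite -[X in _ == X](discounted_exit vx); apply/eqP; apply: eq_Rintegral => w _.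
by rewrite mulrBr; congr (_ - _); rewrite mulrC.
Qed.

Variable j : V.
Hypothesis jx : j <> x.
Hypothesis laplace_eq0 : forall v, v <> x -> v <> j -> laplace v = 0.

(** The exit events partition [T < +oo], and by hypothesis all of them except the exit at [j]
    contribute zero. The vertices are numbered in order to use countable additivity. *)
Lemma discounted_exit_total :
  \int[P (Vtx x)]_(w in [set w | (T w < +oo)%E]) h w =
  laplace j * \int[P (Vtx x)]_(w in exit_at j) expR (- a * Tr w).
Proof.
have /countable_injP[num numI] := countV.
have num_inj v v' : num v = num v' -> v = v' by apply: numI; rewrite inE.
(* Empty when [k] is not the number of a vertex different from [x]. *)
pose F (k : nat) := [set w | exists v, [/\ v <> x, num v = k & exit_at v w]].
have FE v : v <> x -> F (num v) = exit_at v.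
  move=> vx; apply/seteqP; split=> [w [v' [_ /num_inj <-]]//|w Aw].
  by exists v.
have F0 k : (forall v, v <> x -> num v <> k) -> F k = set0.
  by move=> nk; apply/seteqP; split => // w [v [/nk]].
have mF k : measurable (F k).
  have [[v [vx <-]]|nv] := pselect (exists v, v <> x /\ num v = k).
    by rewrite FE//; exact: measurable_exit_at.
  by rewrite F0// => v vx vk; apply: nv; exists v.
have tF : trivIset setT F.
  apply/trivIsetP => k l _ _ /eqP kl; apply/seteqP; split => // w.
  move=> [[v [_ vk Av]] [v' [_ vl Av']]]; apply: kl.
  by rewrite -vk -vl (exit_at_disjoint Av Av').
pose F' k := if k == num j then set0 else F k.
have mF' k : measurable (F' k) by rewrite /F'; case: ifP.
have tF' : trivIset setT F'.
  move/trivIsetP: tF => tF; apply/trivIsetP => k l _ _ kl; rewrite /F'.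
  by case: ifP => _; rewrite ?set0I//; case: ifP => _; rewrite ?setI0//; exact: tF.
have -> : [set w | (T w < +oo)%E] = exit_at j `|` \bigcup_k F' k.
  apply/seteqP; split => w.
    move=> /exit_vertex[v vx Av]; have [vj|vj] := eqVneq v j; first by left; rewrite -vj.
    right; exists (num v) => //; rewrite /F' ifN ?FE//.
    by apply: contra_neq vj; exact: num_inj.
  by move=> [[]//|[k _]]; rewrite /F'; case: ifP => // _ [v [_ _ []]].
have mU : measurable (\bigcup_k F' k) by exact: bigcup_measurable.
have mj := measurable_exit_at j.
have ih D : measurable D -> (P (Vtx x)).-integrable D (EFin \o h).
  by move=> mD; exact: (bounded_integrable (P (Vtx x)) mD mh hK).
rewrite -discounted_exit_at// Rintegral_setU//; last 2 first.
- by apply: ih; exact: measurableU.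
- apply/disj_setPS => w [Aj [k _]]; rewrite /F'; case: ifPn => // /eqP kj.
  by move=> [v [_ vk Av]]; apply: kj; rewrite -vk (exit_at_disjoint Aj Av).
rewrite [X in _ + X](_ : _ = 0) ?addr0// /Rintegral integral_bigcup//; last exact: ih.
rewrite eseries0// => k _ _; rewrite /F'; case: ifPn => [_|kj]; first by rewrite integral_set0.
have [[v [vx vk]]|nv] := pselect (exists v, v <> x /\ num v = k); last first.
  by rewrite F0 ?integral_set0// => v vx vk; apply: nv; exists v.
have vj : v <> j by move=> vj; move: kj; rewrite -vk vj eqxx.
have mv := measurable_exit_at v.
rewrite -vk FE//= -[LHS]fineK; last by apply: integrable_fin_num => //; exact: ih.
by have := discounted_exit_at vx; rewrite laplace_eq0// mul0r /Rintegral => ->.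
Qed.

Definition killed (p : R * W) : R := if (p.1%:E < T p.2)%E then f (clamp_path Y p) else 0.

Lemma killed_measurable : measurable_fun setT killed.
Proof.
apply: measurable_fun_ifT => //; apply: (@measurable_fun_bool _ _ _ _ true); apply: measurable_lte => //.
  exact: (measurableT_comp _ (@measurable_fst _ _ R W)).
exact: (measurableT_comp hitting_measurable (@measurable_snd _ _ R W)).
Qed.

Lemma killed_bounded p : `|killed p| <= K.
Proof. by rewrite /killed; case: ifP => // _; rewrite normr0 (le_trans _ (fK None)). Qed.

(** Each path integral is cut at [T] by [discount_split]; the part after [T] is evaluated by
    [discounted_exit_total], and it is absent where [T] is infinite. *)
Lemma dynkin_formula :
  laplace x =
  \int[P (Vtx x)]_w \int[m]_t (kappa t * killed (t, w)) +
  laplace j * \int[P (Vtx x)]_(w in exit_at j) expR (- a * Tr w).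
Proof.
rewrite -discounted_exit_total /laplace (discount_Fubini a_gt0 (P (Vtx x)) jf (fun p => fK _)).
have mfin : measurable [set w | (T w < +oo)%E].
  rewrite -[X in measurable X]setTI.
  by apply: measurable_lte => //; exact: hitting_measurable.
rewrite [X in _ + X]Rintegral_mkcond -RintegralD//.
- apply: eq_Rintegral => w _; rewrite patchE.
  have -> : (w \in [set w | (T w < +oo)%E]) = (T w < +oo)%E by apply/idP/idP; rewrite inE.
  have [Too|Too] := boolP (T w < +oo)%E; last first.
    rewrite addr0; apply: eq_Rintegral => t _; congr (_ * _); rewrite /killed/=.
    have -> : T w = +oo%E by move: Too; rewrite ltey negbK => /eqP.
    by rewrite ltry.
  have TE : T w = (Tr w)%:E by rewrite fineK// ge0_fin_numE ?first_time_ge0.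
  rewrite (discount_split a_gt0 (Tr_ge0 w) (measurable_slice2 jf w) (fun t => fK _)).
  congr (_ + _); apply: eq_Rintegral => t _; congr (_ * _).
  by rewrite /killed/= [in RHS]TE lte_fin.
- exact: (bounded_integrable (P (Vtx x)) measurableT
    (discount_measurable a_gt0 (P (Vtx x)) killed_measurable killed_bounded)
    (discount_bounded a_gt0 killed_measurable killed_bounded)).
- apply: (bounded_integrable (P (Vtx x)) measurableT (K := K)) => [|w].
    by apply: (measurable_restrictT _ _).1 => //; exact: measurable_funTS.
  by rewrite patchE; case: ifP => // _; rewrite normr0 (le_trans _ (fK None)).
Qed.

End Dynkin.

(** * The limit of small discount rate *)

Section KilledMass.
Context {R : realType}.
Implicit Types (alpha r : R) (t : \bar R).

(** The mass before [t] of an exponential time of rate [alpha]. *)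
Definition killed_mass alpha t : R := if t is r%:E then 1 - expR (- alpha * r) else 1.

Lemma killed_mass_ge0 alpha t : 0 <= alpha -> (0 <= t)%E -> 0 <= killed_mass alpha t.
Proof.
move=> a0; case: t => [r|//|//] r0 /=; rewrite subr_ge0 -expR0 ler_expR mulNr oppr_le0.
by rewrite mulr_ge0.
Qed.

Lemma killed_mass_le1 alpha t : killed_mass alpha t <= 1.
Proof. by case: t => //= r; rewrite gerBl expR_ge0. Qed.

Lemma killed_mass_le alpha t : 0 < alpha -> (0 <= t)%E ->
  ((killed_mass alpha t)%:E <= alpha%:E * t)%E.
Proof.
move=> a0; case: t => [r|//|//] r0 /=; last by rewrite gt0_muley ?lte_fin// leey.
by rewrite -EFinM lee_fin; have := expR_ge1Dx (- alpha * r); lra.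
Qed.

(** With [y = alpha * min t N], the bound [exp y >= 1 + y] gives [1 - exp (- y) >= y / (1 + y) >= y
    (1 - y)], and [y <= alpha N]. *)
Lemma killed_mass_ge alpha (N : R) t : 0 < alpha -> 0 <= N -> (0 <= t)%E ->
  alpha * (1 - alpha * N) * fine (mine t N%:E) <= killed_mass alpha t.
Proof.
move=> a0 N0 t0; set mm := fine _.
have [m0 mN mt] : [/\ 0 <= mm, mm <= N & 1 - expR (- alpha * mm) <= killed_mass alpha t].
  rewrite /mm; case: t t0 {mm} => [r|//|//] r0 /=; last first.
    by rewrite N0 lexx gerBl expR_ge0.
  rewrite lee_fin in r0; rewrite (_ : fine _ = Num.min r N); last by rewrite -EFin_min.
  split; first by rewrite le_min r0.
    by rewrite ge_min lexx orbT.
  by rewrite lerD2l lerN2 ler_expR !mulNr lerN2 ler_pM2l// ge_min lexx.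
apply: le_trans mt.
set y := alpha * mm; have y0 : 0 <= y by rewrite mulr_ge0// ltW.
have e1 := expR_ge1Dx y.
have : expR (- alpha * mm) * (1 + y) <= 1.
  by rewrite mulNr -/y expRN ler_pdivrMl ?expR_gt0// mulr1.
have e0 := expR_ge0 (- alpha * mm).
have yN : y <= alpha * N by rewrite ler_pM2l.
set z := expR _ in e0 *; rewrite mulrAC -/y; nra.
Qed.

Context {d : measure_display} {W : measurableType d}.
Variable (Q : probability W R) (T : W -> \bar R).
Hypothesis mT : measurable_fun setT T.
Hypothesis T0 : forall w, (0 <= T w)%E.

Lemma killed_mass_measurable alpha : measurable_fun setT (fun w => killed_mass alpha (T w)).
Proof.
rewrite (_ : (fun w => _) = (fun w => if T w == +oo%E then 1 else 1 - expR (- alpha * fine (T w)))).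
  apply: measurable_fun_ifT => //; first exact: measurable_fun_eqe.
  apply: measurable_funB => //; apply: measurableT_comp => //; apply: measurable_funM => //.
  exact: (measurableT_comp (fine_measurable measurableT) mT).
by apply/funext => w; have := T0 w; case: (T w).
Qed.

Local Notation theta alpha := (\int[Q]_w killed_mass alpha (T w)).

Lemma killed_mass_integrable alpha D : 0 < alpha -> measurable D ->
  Q.-integrable D (EFin \o (fun w => killed_mass alpha (T w))).
Proof.
move=> a0 mD; apply: (bounded_integrable Q mD (killed_mass_measurable alpha) (K := 1)) => w.
by rewrite ger0_norm ?killed_mass_le1// killed_mass_ge0// ltW.
Qed.

Lemma expectation_killed_mass_ge0 alpha : 0 < alpha -> 0 <= theta alpha.
Proof. by move=> a0; apply: Rintegral_ge0 => w _; rewrite killed_mass_ge0// ltW. Qed.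

Lemma expectation_killed_mass_le alpha : 0 < alpha ->
  ((theta alpha)%:E <= alpha%:E * \int[Q]_w T w)%E.
Proof.
move=> a0; rewrite fineK; last by apply: integrable_fin_num => //; exact: killed_mass_integrable.
rewrite -ge0_integralZl//; last by rewrite lee_fin ltW.
apply: ge0_le_integral => //.
- by move=> w _; rewrite lee_fin killed_mass_ge0// ltW.
- by apply/measurable_EFinP; exact: killed_mass_measurable.
- exact: measurable_funeM.
- by move=> w _; exact: killed_mass_le.
Qed.

Lemma le_of_linear_gap (x y c del : R) : 0 < del ->
  (forall alpha, 0 < alpha <= del -> x <= y + alpha * c) -> x <= y.
Proof.
move=> d0 h; apply/ler_addgt0Pr => e e0.
pose b := Num.min del (e / (`|c| + 1)).
have c1 : 0 < `|c| + 1 by rewrite ltr_wpDl.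
have b0 : 0 < b by rewrite lt_min d0 divr_gt0.
have := h b; rewrite b0 ge_min lexx => /(_ isT) hb.
apply: le_trans hb _; rewrite lerD2l.
have be : b * (`|c| + 1) <= e by rewrite -ler_pdivlMr// ge_min lexx orbT.
apply: le_trans be; rewrite ler_wpM2l ?(ltW b0)//.
by rewrite (le_trans (ler_norm _))// lerDl.
Qed.

(** As [alpha] decreases to [0], [killed_mass alpha t / alpha] increases to [t]. *)
Lemma expectation_of_killed_mass (A K : R) : 0 <= A ->
  (forall alpha, 0 < alpha -> `|alpha * A - theta alpha| <= alpha * K * theta alpha) ->
  (\int[Q]_w T w = A%:E)%E.
Proof.
move=> A0 hA; pose K' := Num.max K 0.
have K'0 : 0 <= K' by rewrite le_max lexx orbT.
have hA' alpha : 0 < alpha -> `|alpha * A - theta alpha| <= alpha * K' * theta alpha.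
  move=> a0; apply: le_trans (hA _ a0) _; rewrite ler_wpM2r ?expectation_killed_mass_ge0//.
  by rewrite ler_pM2l// le_max lexx.
apply/eqP; rewrite eq_le; apply/andP; split.
  (* Upper bound: [T] is truncated at [n], which makes its mean finite, and the truncation is
     removed by monotone convergence. *)
  pose g (n : nat) w : \bar R := mine (T w) n%:R%:E.
  have mg n : measurable_fun setT (g n) by exact: measurable_mine.
  have g0 n w : (0 <= g n w)%E by rewrite /g le_min T0 lee_fin ler0n.
  have gn n w : (g n w <= n%:R%:E)%E by rewrite /g ge_min lexx orbT.
  have gfin n w : (g n w = (fine (g n w))%:E)%E.
    by rewrite fineK// ge0_fin_numE// (le_lt_trans (gn n w))// ltry.
  have gcvg w : g n w @[n --> \oo] --> T w.
    have := T0 w; rewrite /g; case: (T w) => [r| |//] r0.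
      apply: cvg_near_cst; near=> n; rewrite min_l// lee_fin ltW//.
      by near: n; exact: nbhs_infty_gtr.
    rewrite (_ : (fun n => _) = (fun n => n%:R%:E)); last first.
      by apply/funext => n; rewrite min_r// leey.
    by apply/cvgeyPge => r; near=> n; rewrite lee_fin; near: n; exact: nbhs_infty_ger.
  have gE n : (\int[Q]_w g n w <= A%:E)%E.
    have ig : Q.-integrable setT (EFin \o (fun w => fine (g n w))).
      apply: (bounded_integrable Q measurableT (K := n%:R)) => [|w].
        exact: (measurableT_comp (fine_measurable measurableT) (mg n)).
      by rewrite ger0_norm ?fine_ge0// -lee_fin -gfin.
    rewrite (eq_integral (fun w => (fine (g n w))%:E)) => [|w _]; last exact: gfin.
    rewrite -[leLHS]fineK; last exact: integrable_fin_num.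
    set m := fine _; rewrite lee_fin.
    have m0 : 0 <= m by apply: Rintegral_ge0 => w _; rewrite fine_ge0.
    (* The aim is [(1 - alpha n) (1 - alpha K') m <= A], whose first-order loss is
       [alpha (n + K') m]; the range of [alpha] keeps [1 - alpha K'] nonnegative. *)
    apply: (@le_of_linear_gap _ _ ((n%:R + K') * m) (K' + 1)^-1); first by rewrite invr_gt0 ltr_wpDl.
    move=> alpha /andP[a0 aK].
    have aK1 : alpha * K' <= 1.
      rewrite (le_trans _ (_ : alpha * (K' + 1) <= 1))//; first by rewrite ler_pM2l// lerDl.
      by rewrite -ler_pdivlMr ?ltr_wpDl// mul1r.
    have le1 : alpha * (1 - alpha * n%:R) * m <= theta alpha.
      rewrite /m -RintegralZl//; apply: le_Rintegral => //.
      - exact: (integrableZl measurableT (alpha * (1 - alpha * n%:R)) ig).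
      - exact: killed_mass_integrable.
      - by move=> w _; exact: killed_mass_ge.
    have := hA' _ a0; rewrite ler_norml => /andP[le2 _].
    have le3 : theta alpha * (1 - alpha * K') <= alpha * A by nra.
    have le4 : alpha * ((1 - alpha * n%:R) * (1 - alpha * K') * m) <= alpha * A.
      apply: le_trans le3; apply: (@le_trans _ _ (alpha * (1 - alpha * n%:R) * m * (1 - alpha * K'))).
        by rewrite le_eqVlt; apply/orP; left; apply/eqP; ring.
      by rewrite ler_wpM2r// subr_ge0.
    move: le4; rewrite ler_pM2l// => le4.
    have : 0 <= alpha * alpha * n%:R * K' * m by rewrite !mulr_ge0// ltW.
    by nra.
  have gnd w : nondecreasing_seq (g ^~ w).
    by move=> p q pq; rewrite /g le_min ge_min lexx/= ge_min lee_fin ler_nat pq orbT.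
  have := @cvg_monotone_convergence _ _ _ Q setT measurableT g mg (fun n w _ => g0 n w) (fun w _ => gnd w).
  rewrite (eq_integral T) => [|w _]; last exact/cvg_lim/gcvg.
  move=> gT; rewrite -(cvg_lim _ gT)//.
  by apply: lime_le; [apply/cvg_ex; eexists; exact: gT|apply: nearW].
(* Lower bound: it is trivial for an infinite mean, and otherwise follows from the killed mass being
   at most [alpha e] on average. *)
case eE : (\int[Q]_w T w)%E => [e| |]; [|by rewrite leey|].
  rewrite lee_fin; apply: (@le_of_linear_gap _ _ (K' * e) 1) => // alpha /andP[a0 _].
  have := expectation_killed_mass_le a0; rewrite eE -EFinM lee_fin => le1.
  have := hA' _ a0; rewrite ler_norml => /andP[_ le2].
  have th0 := expectation_killed_mass_ge0 a0.
  rewrite -(ler_pM2l a0).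
  have : alpha * K' * theta alpha <= alpha * K' * (alpha * e).
    by rewrite ler_wpM2l// mulr_ge0// ltW.
  lra.
have : (0 <= \int[Q]_w T w)%E by exact: integral_ge0.
by rewrite eE.
Unshelve. all: by end_near. Qed.

(** On [D] the discount factor differs from [1] by the killed mass, whose mean is at most [alpha A].
    Finiteness of the mean of [T] thus sends both errors to [0]. *)
Lemma probability_of_killed_mass (D : set W) (p K A : R) : measurable D ->
  (forall w, D w -> (T w < +oo)%E) -> (\int[Q]_w T w = A%:E)%E ->
  (forall alpha, 0 < alpha ->
    `|p - \int[Q]_(w in D) expR (- alpha * fine (T w))| <= K * theta alpha) ->
  Q D = p%:E.
Proof.
move=> mD Doo TA h; pose q := fine (Q D).
have qE : Q D = q%:E by rewrite fineK// fin_num_measure.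
rewrite qE; congr EFin; apply/eqP; rewrite -subr_eq0 -normr_eq0 eq_le normr_ge0 andbT.
pose K' := Num.max K 0; have K'0 : 0 <= K' by rewrite le_max lexx orbT.
apply: (@le_of_linear_gap _ 0 ((K' + 1) * A) 1) => // alpha /andP[a0 _]; rewrite add0r.
have th0 := expectation_killed_mass_ge0 a0.
have thA : theta alpha <= alpha * A.
  by have := expectation_killed_mass_le a0; rewrite TA -EFinM lee_fin.
have hK : `|p - \int[Q]_(w in D) expR (- alpha * fine (T w))| <= K' * theta alpha.
  by apply: le_trans (h _ a0) _; rewrite ler_wpM2r// le_max lexx.
have ikm D' : measurable D' -> Q.-integrable D' (EFin \o (fun w => killed_mass alpha (T w))).
  by move=> mD'; exact: killed_mass_integrable.
have ie : Q.-integrable D (EFin \o (fun w => expR (- alpha * fine (T w)))).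
  apply: (bounded_integrable Q mD (K := 1)) => [|w].
    apply: measurableT_comp => //; apply: measurable_funM => //.
    exact: (measurableT_comp (fine_measurable measurableT) mT).
  rewrite ger0_norm ?expR_ge0// -expR0 ler_expR mulNr oppr_le0.
  by rewrite mulr_ge0 ?fine_ge0// ltW.
have kmE : \int[Q]_(w in D) killed_mass alpha (T w) = q - \int[Q]_(w in D) expR (- alpha * fine (T w)).
  have i1 : Q.-integrable D (EFin \o cst 1).
    by apply: (bounded_integrable Q mD (@measurable_cst _ _ _ _ setT (1 : R)) (K := 1)) => w; rewrite normr1.
  rewrite -[q]mul1r /q -Rintegral_cst// -RintegralB//; apply: eq_Rintegral => w.
  by rewrite inE => /Doo; have := T0 w; case: (T w).
have kmD0 : 0 <= \int[Q]_(w in D) killed_mass alpha (T w).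
  by apply: Rintegral_ge0 => w _; rewrite killed_mass_ge0// ltW.
have kmD : \int[Q]_(w in D) killed_mass alpha (T w) <= theta alpha.
  rewrite Rintegral_mkcond; apply: le_Rintegral => //.
  - apply: (bounded_integrable Q measurableT (K := 1)) => [|w].
      by apply: (measurable_restrictT _ _).1 => //; apply: measurable_funTS; exact: killed_mass_measurable.
    rewrite patchE; case: ifP => _; last by rewrite normr0.
    by rewrite ger0_norm ?killed_mass_le1// killed_mass_ge0// ltW.
  - exact: ikm.
  - by move=> w _; rewrite patchE; case: ifP => // _; rewrite killed_mass_ge0// ltW.
move: hK kmD kmD0; rewrite kmE !ler_norml => /andP[h1 h2] h3 h4.
have : K' * theta alpha <= K' * (alpha * A) by rewrite ler_wpM2l.
by move=> h5; apply/andP; split; lra.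
Qed.

End KilledMass.

(** * Test functions on the graph with loops *)

Section LoopGraphFunctions.
Context {R : realType} {V : countType} (adj : rel V) (wt rho : V -> V -> R).
Hypothesis Hgraph : weighted_graph adj wt.
Hypothesis Hrho : is_distance rho.
Local Notation M := (adapted_X_loop adj wt rho).
Local Notation E := (mg_edge M).
Local Notation opc := (one_point_compactification (mg_point M)).
Local Notation GE := (graph_edge adj).

Let len1 (e : E) : mg_len e = 1. Proof. by []. Qed.
Let len_gt0 (e : E) : 0 < mg_len e. Proof. by rewrite len1. Qed.

Definition conductance (e : GE) : R := wt (val e).1 (val e).2.

Lemma edge_ends (e : GE) : adj (val e).1 (val e).2.
Proof. by case: e => -[u v] /= /andP[]. Qed.

Lemma edge_ends_neq (e : GE) : (val e).1 != (val e).2.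
Proof. by apply/eqP => uv; have := edge_ends e; rewrite uv (adj_irr Hgraph). Qed.

Lemma conductance_gt0 e : 0 < conductance e.
Proof. by apply/(wt_gt0 Hgraph); exact: edge_ends. Qed.

Lemma distance_gt0 (u v : V) : u <> v -> 0 < rho u v.
Proof.
move=> uv; rewrite lt_neqAle (distance_ge0 Hrho) andbT eq_sym.
by apply/eqP => /(distance_eq0 Hrho).
Qed.

Lemma mg_cond_gt0 (e : E) : 0 < mg_cond e.
Proof. by case: e => [e|v] /=; [exact: conductance_gt0|rewrite invr_gt0 ltr0n]. Qed.

Lemma mg_dens_gt0 (e : E) : 0 < mg_dens e.
Proof.
case: e => [e|v] /=; rewrite ?ltr01// exprn_gt0// distance_gt0//.
exact/eqP/edge_ends_neq.
Qed.

Definition star (x : V) : set GE := [set e | (val e).1 = x \/ (val e).2 = x].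

Definition other_end (x : V) (e : GE) : V :=
  if (val e).1 == x then (val e).2 else (val e).1.

(** Turns sums over incident edges into sums over neighbours. Injectivity rests on each edge being
    stored with one orientation only, the increasing one for [pickle]. *)
Lemma star_bij (x : V) : set_bij (star x) [set y | adj x y] (other_end x).
Proof.
split.
- move=> e; rewrite /star/other_end/= => h; have ad := edge_ends e.
  case: eqP => [<-//|]; case: h => // <- _.
  by rewrite (adj_sym Hgraph).
- move=> e e'; rewrite !inE /star/other_end => h h' ee; apply: val_inj.
  have := edge_ends_neq e; have := edge_ends_neq e'.
  move: e e' h h' ee => [[u v] /= /andP[_ uv]] [[u' v'] /= /andP[_ uv']].
  case: eqP => [ux|ux]; case: eqP => [u'x|u'x] /=.
  + by move=> _ _ ->; rewrite ux u'x.
  + move=> _ [|]// v'x vu; move: uv uv'; rewrite ux v'x vu.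
    by move=> /ltn_trans h /h; rewrite ltnn.
  + move=> [|]// vx _ uv'E; move: uv uv'; rewrite uv'E vx u'x.
    by move=> /ltn_trans h /h; rewrite ltnn.
  + by move=> [|]// -> [|]// -> ->.
- move=> y /= xy; have xny : x <> y by move=> xy'; move: xy; rewrite xy' (adj_irr Hgraph).
  have [lt|lt|/(pcan_inj pickleK)//] := ltngtP (pickle x) (pickle y).
    have h : adj (x, y).1 (x, y).2 && (pickle (x, y).1 < pickle (x, y).2)%N by rewrite /= xy.
    by exists (Sub (x, y) h : GE); rewrite /star/other_end/= ?SubK/= ?eqxx//; left.
  have h : adj (y, x).1 (y, x).2 && (pickle (y, x).1 < pickle (y, x).2)%N.
    by rewrite /= (adj_sym Hgraph) xy.
  exists (Sub (y, x) h : GE); rewrite /star/other_end/= ?SubK/=; first by right.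
  by case: eqP => // yx; case: xny.
Qed.

Lemma finite_star (x : V) : finite_set (star x).
Proof.
pose A := [set y | adj x y]; have fA : finite_set A := adj_locally_finite Hgraph x.
apply: (@sub_finite_set _ _ (val @^-1` (([set x] `*` A) `|` (A `*` [set x])))).
  move=> e [h|h]; have ad := edge_ends e; [left|right]; split=> //=; rewrite /A/= -h//.
  by rewrite (adj_sym Hgraph).
apply: finite_preimage; first by move=> ? ? _ _; exact: val_inj.
by rewrite finite_setU; split; apply: finite_setX => //; exact: finite_set1.
Qed.

Variables (a : V -> R) (k0 : GE -> R) (F0 : set GE) (S : set V).
Hypotheses (finF0 : finite_set F0) (finS : finite_set S).
Hypothesis endsF0 : forall e, F0 e -> S (val e).1 /\ S (val e).2.
Hypothesis outF0 : forall e, ~ F0 e -> [/\ a (val e).1 = 0, a (val e).2 = 0 & k0 e = 0].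
Hypothesis outS : forall v, ~ S v -> a v = 0.

Definition slope_src (e : GE) : R := a (val e).2 - a (val e).1 + k0 e.
Definition slope_tgt (e : GE) : R := a (val e).1 - a (val e).2 + k0 e.

(** The vertex condition at [v] restricted to the non-loop edges of [F0]: conductances times
    derivatives at [v] directed into the edge, [v] being either the source or the target. *)
Definition kirchhoff_defect (v : V) : R :=
  \sum_(e \in F0) conductance e *
    (slope_src e * ((val e).1 == v)%:R + slope_tgt e * ((val e).2 == v)%:R).

(** A loop of conductance [1/2] contributes its curvature to the vertex condition,
    so that curving the loops absorbs the Kirchhoff defect of the rest. *)
Definition curvature (e : E) : R :=
  match e with inl e => k0 e | inr v => - kirchhoff_defect v end.

Definition support_edges : set E := inl @` F0 `|` inr @` S.

Lemma finite_support_edges : finite_set support_edges.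
Proof. by rewrite finite_setU; split; exact: finite_image. Qed.

Lemma fsbig_support_edges (g : E -> R) :
  \sum_(e \in support_edges) g e = \sum_(e \in F0) g (inl e) + \sum_(v \in S) g (inr v).
Proof.
rewrite fsbigU0; [|exact: finite_image|exact: finite_image|].
  by rewrite !fsbig_image// => u v _ _ [].
by move=> _ [[e _ <-] [v _]].
Qed.

Lemma support_edgesC (e : E) : ~ support_edges e ->
  [/\ a (mg_src e) = 0, a (mg_tgt e) = 0 & curvature e = 0].
Proof.
case: e => [e|v] nF.
  have /outF0[] // : ~ F0 e by move=> Fe; apply: nF; left; exists e.
have nS : ~ S v by move=> Sv; apply: nF; right; exists v.
split; [exact: outS|exact: outS|].
rewrite /= /kirchhoff_defect fsbig1 ?oppr0// => e /endsF0[s1 s2].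
have [ev|_] := eqVneq (val e).1 v; first by case: nS; rewrite -ev.
have [ev|_] := eqVneq (val e).2 v; first by case: nS; rewrite -ev.
by rewrite !mulr0 addr0 mulr0.
Qed.

(** Regroup the edge sum by vertices: at [v] it gives the defect times [phi v]. The loop there has
    two ends of conductance [1 / 2] and slope minus the defect, which cancels it. *)
Lemma curvature_kirchhoff (phi : V -> R) :
  \sum_(e \in support_edges) mg_cond e *
    ((a (mg_tgt e) - a (mg_src e) + curvature e) * phi (mg_src e) +
     (a (mg_src e) - a (mg_tgt e) + curvature e) * phi (mg_tgt e)) = 0.
Proof.
rewrite fsbig_support_edges/=.
have -> : \sum_(v \in S) 2^-1 * ((a v - a v - kirchhoff_defect v) * phi v +
    (a v - a v - kirchhoff_defect v) * phi v) =
    - \sum_(v \in S) \sum_(e \in F0) (conductance e * (slope_src e * ((val e).1 == v)%:R +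
      slope_tgt e * ((val e).2 == v)%:R)) * phi v.
  rewrite !fsbig_finite//= -sumrN; apply: eq_bigr => v _.
  rewrite subrr add0r !mulNr -opprD mulrN; congr (- _).
  rewrite (_ : 2^-1 * _ = kirchhoff_defect v * phi v) /kirchhoff_defect; last by field.
  by rewrite !fsbig_finite//= mulr_suml.
rewrite exchange_fsbig// !fsbig_finite//= -sumrB big_seq big1// => e.
rewrite in_fset_set// inE => Fe; apply/eqP; rewrite subr_eq0; apply/eqP.
have [s1 s2] := endsF0 Fe.
have pick u (c : R) : S u -> \sum_(v \in S) c * (u == v)%:R * phi v = c * phi u.
  move=> Su; rewrite (fsbigD1 u)//= eqxx mulr1 fsbig1 ?addr0// => v [_ /eqP vu].
  by rewrite eq_sym (negbTE vu) mulr0 mul0r.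
rewrite mulrDr !mulrA -!pick// !fsbig_finite//= -big_split/=.
by apply: eq_bigr => v _; rewrite /slope_src /slope_tgt /conductance/=; ring.
Qed.

End LoopGraphFunctions.

(** * Continuous bumps and step functions *)

Section TestFunctions.
Context {R : realType} {V : countType} (adj : rel V) (wt rho : V -> V -> R).
Hypothesis Hgraph : weighted_graph adj wt.
Local Notation M := (adapted_X_loop adj wt rho).
Local Notation E := (mg_edge M).
Local Notation opc := (one_point_compactification (mg_point M)).
Local Notation GE := (graph_edge adj).

Let len1 (e : E) : mg_len e = 1. Proof. by []. Qed.
Let len_gt0 (e : E) : 0 < mg_len e. Proof. by rewrite len1. Qed.
Let src_loop (v : V) : mg_src (inr v : E) = v. Proof. by []. Qed.

(** A continuous function positive exactly on the interior of [e]: it detects the edge by an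
    inequality. *)
Definition edge_bump (e : E) : opc -> R :=
  ext0 (@quad R M (fun=> 0) (fun e' => (e' == e)%:R)).

(** The curvature makes the function drop below [1] inside the loop at [v]. *)
Definition hat (v : V) : opc -> R :=
  ext0 (@quad R M (fun u => (u == v)%:R) (fun e => - (e == inr v)%:R)).

Lemma edge_bump_continuous e : continuous (edge_bump e).
Proof.
apply: (ext0_continuous len_gt0 (finite_set1 e)); first exact: quad_continuous.
move=> z; apply: (quad_out len1 src_loop) => e' /= /eqP e'e.
by rewrite (negbTE e'e).
Qed.

Lemma edge_bump_vtx e v : edge_bump e (Some (@Vtx R M v)) = 0.
Proof. by []. Qed.

Lemma edge_bump_gt0 e e' t (h : 0 < t < mg_len e') : (0 < edge_bump e (Some (Inner h))) = (e' == e).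
Proof.
have /andP[t0 t1] := h; rewrite len1 in t1.
rewrite /edge_bump/= /quad_edge !mul0r !add0r; case: eqP => _; last by rewrite mul0r ltxx.
by rewrite mul1r mulr_gt0// subr_gt0.
Qed.

Lemma hat_continuous v : continuous (hat v).
Proof.
pose F : set E := inl @` star v `|` [set inr v].
have fF : finite_set F.
  by rewrite finite_setU; split; [apply/finite_image/finite_star/Hgraph|exact: finite_set1].
apply: (ext0_continuous len_gt0 fF); first exact: quad_continuous.
move=> z; apply: (quad_out len1 src_loop) => -[e|u] nF /=.
  have [e1 e2] : (val e).1 != v /\ (val e).2 != v.
    by split; apply: contra_notN nF => /eqP ev; left; exists e => //; [left|right].
  by rewrite (negbTE e1) (negbTE e2) oppr0.
have uv : u != v by apply: contra_notN nF => /eqP ->; right.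
by rewrite (_ : (inr u == _) = (u == v))// (negbTE uv) oppr0.
Qed.

Lemma hat_inner v e (t : R) (h : 0 < t < mg_len e) : hat v (Some (Inner h)) < 1.
Proof.
have /andP[t0 t1] := h; rewrite len1 in t1.
rewrite /hat/= /quad_edge; case: e h => [e|u] h /=.
  have := edge_ends_neq Hgraph e; change (sval e) with (val e); rewrite oppr0 mul0r addr0.
  have [->|_] := eqVneq (val e).1 v; last by case: ((val e).2 == v) => _ /=; lra.
  by rewrite eq_sym => /negbTE -> /=; lra.
rewrite (_ : (inr u == _) = (u == v))//; case: (u == v) => /=; last lra.
by have : 0 < t * (1 - t); [rewrite mulr_gt0//; lra|lra].
Qed.

Lemma hat_eq1 v z : hat v z = 1 <-> z = Some (@Vtx R M v).
Proof.
split=> [|->]; last by rewrite /hat/= eqxx.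
case: z => [[u|e t h]|].
- by rewrite /hat/=; have [->//|_] := eqVneq u v => /esym/eqP; rewrite oner_eq0.
- by move=> h1; have := hat_inner v h; rewrite h1 ltxx.
- by rewrite /hat/= => /esym/eqP; rewrite oner_eq0.
Qed.

Lemma hat_le1 v z : hat v z <= 1.
Proof.
case: z => [[u|e t h]|]; last by rewrite /hat/= ler01.
- by rewrite /hat/=; case: (u == v); rewrite ?ler01.
- by rewrite ltW// hat_inner.
Qed.

Lemma vertex_separated x (z : mg_point M) : (forall v, v <> x -> z <> @Vtx R M v) ->
  exists b : opc -> R, [/\ continuous b, b (Some z) != 0 &
    forall v, v <> x -> b (Some (@Vtx R M v)) = 0].
Proof.
case: z => [v|e t h] nz.
  have [vx|vx] := eqVneq v x; last by case: (nz v) => //; exact/eqP.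
  exists (hat x); split; first exact: hat_continuous.
    by rewrite vx (hat_eq1 _ _).2// oner_neq0.
  by move=> u /eqP/negbTE ux; rewrite /hat/= ux.
exists (edge_bump e); split; first exact: edge_bump_continuous.
  by rewrite gt_eqF// edge_bump_gt0.
by move=> v _; exact: edge_bump_vtx.
Qed.

Section StepFunctions.
Variable c : E -> R.
Variables (F0 : set GE) (S : set V).
Hypotheses (finF0 : finite_set F0) (finS : finite_set S).
Let F := @support_edges R V adj wt rho F0 S.
Hypothesis outF : forall e, ~ F e -> c e = 0.

Definition step (z : mg_point M) : R :=
  match z with Vtx v => c (inr v) | Inner e _ _ => c e end.

Let finF : finite_set F. Proof. exact: finite_support_edges. Qed.

(** A step function is discontinuous, but its level sets are read off the continuous functions
    [edge_bump] and [hat]. Boundedness and measurability follow from this finite sum. *)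
Lemma ext0_stepE z : ext0 step z =
  \sum_(e \in F) (if 0 < edge_bump e z then c e else 0) +
  \sum_(v \in S) (if hat v z == 1 then c (inr v) else 0).
Proof.
case: z => [[u|e t h]|].
- rewrite fsbig1 => [|e _]; last by rewrite edge_bump_vtx ltxx.
  rewrite add0r; have hatE v : (hat v (Some (@Vtx R M u)) == 1) = (v == u).
    by apply/eqP/eqP => [/hat_eq1[->]//|->]; apply/hat_eq1.
  have [Su|Su] := pselect (S u).
    rewrite (fsbigD1 u)//= hatE eqxx fsbig1 ?addr0// => v [_ /eqP/negbTE vu].
    by rewrite hatE vu.
  rewrite fsbig1 => [|v Sv]; last by rewrite hatE; case: eqP => // vu; case: Su; rewrite -vu.
  by rewrite /= outF// => -[[]//|[v Sv [vu]]]; apply: Su; rewrite -vu.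
- rewrite [X in _ + X]fsbig1 => [|v _]; last by rewrite lt_eqF// hat_inner.
  rewrite addr0; have [Fe|Fe] := pselect (F e).
    rewrite (fsbigD1 e)// [X in if X then _ else _]edge_bump_gt0 eqxx fsbig1 => [|e' [_ /eqP/negbTE ee]].
      by rewrite /= addr0.
    by rewrite [X in if X then _ else _]edge_bump_gt0 eq_sym ee.
  rewrite fsbig1 => [|e' Fe']; first by rewrite /= outF.
  by rewrite edge_bump_gt0; case: eqP => // ee; case: Fe; rewrite ee.
- by rewrite !fsbig1 ?addr0// => [v _|e _]; rewrite /hat/edge_bump/= ?ltxx// eq_sym oner_eq0.
Qed.

Lemma ext0_step_le z : `|ext0 step z| <= \sum_(e \in F) `|c e| + \sum_(v \in S) `|c (inr v)|.
Proof.
rewrite ext0_stepE !fsbig_finite//= (le_trans (ler_normD _ _))// lerD//.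
  rewrite (le_trans (ler_norm_sum _ _ _))//; apply: ler_sum => e _.
  by case: ifP; rewrite ?normr0.
rewrite (le_trans (ler_norm_sum _ _ _))//; apply: ler_sum => v _.
by case: ifP; rewrite ?normr0.
Qed.

(** The map [phi] is left free because, through [source_measurable], it serves as the
    parametrization of an edge, as the identity of the Borel space and as the joint path map. *)
Lemma ext0_step_measurable d (T : measurableType d) (phi : T -> opc) :
  (forall g : opc -> R, continuous g -> measurable_fun setT (g \o phi)) ->
  measurable_fun setT (ext0 step \o phi).
Proof.
move=> mphi; rewrite (_ : _ \o _ = (fun w =>
    \sum_(e <- finmap.enum_fset (fset_set F)) (if 0 < edge_bump e (phi w) then c e else 0) +
    \sum_(v <- finmap.enum_fset (fset_set S)) (if hat v (phi w) == 1 then c (inr v) else 0))); last first.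
  by apply/funext => w /=; rewrite ext0_stepE !fsbig_finite.
apply: measurable_funD; [apply: measurable_sum => e|apply: measurable_sum => v].
  apply: measurable_fun_ifT => //; apply: measurable_fun_ltr => //.
  exact: (mphi _ (@edge_bump_continuous e)).
apply: measurable_fun_ifT => //; apply: measurable_fun_eqr => //.
exact: (mphi _ (@hat_continuous v)).
Qed.

End StepFunctions.
End TestFunctions.

(** * Identification of the resolvent *)

Section Resolvent.
Context {R : realType} {V : countType} (adj : rel V) (wt rho : V -> V -> R).
Hypothesis Hgraph : weighted_graph adj wt.
Hypothesis Hrho : is_distance rho.
Local Notation M := (adapted_X_loop adj wt rho).
Local Notation E := (mg_edge M).
Local Notation opc := (one_point_compactification (mg_point M)).
Local Notation borel := (g_sigma_algebraType (@open opc)).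
Local Notation GE := (graph_edge adj).
Local Notation m := (@lebesgue_measure R).
Local Notation vtx := (@Vtx R M).

Let len1 (e : E) : mg_len e = 1. Proof. by []. Qed.
Let len_gt0 (e : E) : 0 < mg_len e. Proof. by rewrite len1. Qed.
Let loop : V -> E := inr.
Let src_loop (v : V) : mg_src (loop v) = v. Proof. by []. Qed.

Variables (a : V -> R) (k0 : GE -> R) (F0 : set GE) (S : set V).
Hypotheses (finF0 : finite_set F0) (finS : finite_set S).
Hypothesis endsF0 : forall e, F0 e -> S (val e).1 /\ S (val e).2.
Hypothesis outF0 : forall e, ~ F0 e -> [/\ a (val e).1 = 0, a (val e).2 = 0 & k0 e = 0].
Hypothesis outS : forall v, ~ S v -> a v = 0.

Let k : E -> R := @curvature R V adj wt rho a k0 F0.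
Let F : set E := @support_edges R V adj wt rho F0 S.
Let finF : finite_set F. Proof. exact: finite_support_edges. Qed.
Let outF (e : E) : ~ F e -> [/\ a (mg_src e) = 0, a (mg_tgt e) = 0 & k e = 0].
Proof. exact: support_edgesC. Qed.

Definition potential : mg_point M -> R := @quad R M a k.
Definition laplacian : mg_point M -> R := @lap R M k loop.
Definition source (alpha : R) (z : mg_point M) : R := alpha * potential z - laplacian z.

Lemma potential_continuous : continuous (ext0 potential).
Proof.
apply: (ext0_continuous len_gt0 finF); first exact: quad_continuous.
by move=> z; apply: (quad_out len1 src_loop) => e /outF.
Qed.

Lemma potential_bounded : exists K, forall z, `|ext0 potential z| <= K.
Proof.
have cpt : compact ((@potential) @` edge_union F).
  apply: continuous_compact; last exact: edge_union_compact.
  by apply: continuous_subspaceT; exact: quad_continuous.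
have [K [_ /(_ (K + 1))hK]] := compact_bounded cpt.
have hK' y : edge_union F y -> `|potential y| <= K + 1.
  by move=> Fy; apply: hK; [rewrite ltrDl|exists y].
exists (Num.max 0 (K + 1)) => -[y|]; last by rewrite /= normr0 le_max lexx.
have [Fy|Fy] := pselect (edge_union F y); first by rewrite le_max hK' ?orbT.
rewrite [ext0 _ _](_ : _ = 0) ?normr0 ?le_max ?lexx//.
by apply: (quad_out len1 src_loop outF).
Qed.

Lemma laplacian_step : laplacian = step (fun e => - (k e / mg_dens e)).
Proof. by apply/funext => -[]. Qed.

Let outc (e : E) : ~ F e -> - (k e / mg_dens e) = 0.
Proof. by move=> /outF[_ _ ->]; rewrite mul0r oppr0. Qed.

Lemma laplacian_bounded : exists K, forall z, `|ext0 laplacian z| <= K.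
Proof.
rewrite laplacian_step; eexists => z.
exact: (ext0_step_le Hgraph finF0 finS outc z).
Qed.

Lemma ext0_source alpha z : ext0 (source alpha) z = alpha * ext0 potential z - ext0 laplacian z.
Proof. by case: z => //=; rewrite mulr0 subr0. Qed.

Lemma source_bounded alpha : exists K, forall z, `|ext0 (source alpha) z| <= K.
Proof.
have [K1 h1] := potential_bounded; have [K2 h2] := laplacian_bounded.
exists (`|alpha| * K1 + K2) => z; rewrite ext0_source (le_trans (ler_normB _ _))// lerD//.
by rewrite normrM ler_wpM2l.
Qed.

Lemma source_measurable alpha d (T : measurableType d) (phi : T -> opc) :
  (forall g : opc -> R, continuous g -> measurable_fun setT (g \o phi)) ->
  measurable_fun setT (ext0 (source alpha) \o phi).
Proof.
move=> mphi; rewrite (_ : _ \o _ = fun w => alpha * ext0 potential (phi w) - ext0 laplacian (phi w)).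
  apply: measurable_funB.
    by apply: measurable_funM => //; exact: (mphi _ (@potential_continuous)).
  by rewrite laplacian_step; exact: (ext0_step_measurable Hgraph finF0 finS outc mphi).
by apply/funext => w /=; rewrite ext0_source.
Qed.

Lemma source_square_integrable alpha : (inner_mu (source alpha) (source alpha) < +oo)%E.
Proof.
rewrite /inner_mu /mu_integral (edge_integral_finite len1 _ finF); first exact: ltry.
- move=> e; apply: integrable_fin_num => //.
  have [K hK] := source_bounded alpha.
  have ms : measurable_fun setT (fun t : R => source alpha (mg_pt e t)).
    apply: (@source_measurable alpha _ _ (fun t : R => Some (mg_pt e t))) => g cg.
    apply: continuous_measurable_fun => t.
    apply: (@continuous_comp _ _ _ (mg_pt e : R -> mg_point M) (fun y => g (Some y))).
      exact: mg_pt_continuous.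
    by move=> A /(cg (Some (mg_pt e t))).
  apply: measurable_bounded_integrable => //.
  + by rewrite /= lebesgue_measure_itv/= lte01 ltry.
  + by apply: measurable_funTS; exact: measurable_funM.
  + exists (K * K); split => [|x Kx t _]; first exact: num_real.
    rewrite /= normrM (le_trans _ (ltW Kx))// ler_pM//.
    * exact: (hK (Some _)).
    * exact: (hK (Some _)).
- move=> e Fe; have [aS aT k_e] := outF Fe.
  (* Restricted to the open edge: an end vertex may carry a curved loop, and then [laplacian] is
     nonzero there. *)
  have s0 t : 0 < t < 1 -> source alpha (mg_pt e t) * source alpha (mg_pt e t) = 0.
    move=> t01; have tin : 0 < t < mg_len e by [].
    by rewrite (mg_pt_in tin) /source /potential /= /quad_edge aS aT k_e !(mul0r, addr0, mulr0, oppr0).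
  rewrite /Rintegral (@eq_integral_itv_bounded _ 0 1 (fun=> 0) _ true false)//.
  - by rewrite integral0_eq.
  - by apply: eq_measurable_fun (@measurable_cst _ _ _ _ _ (0 : R)) => t; rewrite inE/= in_itv/= => /s0.
Qed.

Context {d : measure_display} {W : measurableType d}.
Variables (P : mg_point M -> probability W R) (Y : R -> W -> opc).
Hypothesis HY : is_brownian_motion P Y.
Variable alpha : R.
Hypothesis alpha_gt0 : 0 < alpha.

Lemma source_borel : measurable_fun setT (ext0 (source alpha) : borel -> R).
Proof.
apply: (@source_measurable alpha _ borel (fun z => z)) => g cg.
exact: continuous_borel_measurable.
Qed.

Lemma source_path : measurable_fun setT (fun p : R * W => ext0 (source alpha) (clamp_path Y p)).
Proof.
have [smd _] := HY.
apply: (@source_measurable alpha _ _ (clamp_path Y)) => g cg.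
exact: (clamp_path_jointly_measurable (bm_continuous smd) (bm_measurable smd) cg).
Qed.

Lemma resolvent_source (y : mg_point M) :
  resolvent P Y alpha (ext0 (source alpha)) y = potential y.
Proof.
have [_ assoc] := HY.
have [u' cu' hu'] := assoc _ _ alpha_gt0 source_borel erefl (source_square_integrable alpha).
have fd : form_domain potential (@dquad R M a k) := quad_form_domain len1 src_loop finF outF.
have eqn g g' : form_domain g g' ->
    (energy u' g' + alpha%:E * inner_mu (resolvent P Y alpha (ext0 (source alpha))) g =
     energy (@dquad R M a k) g' + alpha%:E * inner_mu potential g)%E.
  move=> fg; rewrite (hu' _ _ fg) (quad_weak_solution len1 loop finF outF)//.
  - exact: mg_dens_gt0.
  - exact: curvature_kirchhoff.
  - exact: form_sobolev fg.
have uniq := weak_solution_unique len_gt0 (mg_cond_gt0 Hgraph) (mg_dens_gt0 Hgraph Hrho)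
  alpha_gt0 cu' fd eqn.
(* Uniqueness is an equality along edges. A vertex is reached as the end [0] of its loop. *)
case: y => [v|e t h].
  by have := uniq (loop v) 0; rewrite lexx ler01 mg_pt0// => /(_ isT).
by have := uniq e t; rewrite (mg_pt_in h); apply; have /andP[/ltW -> /ltW ->] := h.
Qed.

(** The factor [alpha] is the normalization of the exponential density, which [resolvent] does not
    carry. *)
Lemma laplace_source (v : V) : laplace P Y (ext0 (source alpha)) alpha v = alpha * a v.
Proof.
have [K hK] := source_bounded alpha; have [smd _] := HY.
have := resolvent_source (vtx v); rewrite /potential/= => <-.
have i_f := discount_slice_integrable alpha_gt0 (P (vtx v)) source_path (fun p => hK _).
pose G t := \int[P (vtx v)]_w ext0 (source alpha) (clamp_path Y (t, w)).
rewrite /resolvent Rintegral_mkcond.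
pose h := (fun t => expR (- alpha * t) * \int[P (vtx v)]_w ext0 (source alpha) (Y t w)) \_ `[0, +oo[.
have hE t : exponential_pdf alpha t * G t = alpha * h t.
  rewrite /h patchE; have [t0|t0] := leP 0 t.
    rewrite ifT; last by rewrite inE/= in_itv/= t0.
    rewrite exponential_pdfE// -mulrA; congr (_ * (_ * _)).
    by apply: eq_Rintegral => w _; rewrite path_clampE.
  rewrite lt0_exponential_pdf// mul0r ifF ?mulr0//.
  by apply/negbTE; rewrite notin_setE/= in_itv/= andbT; apply/negP; rewrite -ltNge.
have ih : m.-integrable setT (EFin \o h).
  have := integrableZl measurableT alpha^-1 i_f; apply: eq_integrable => // t _.
  by rewrite -EFinM hE mulKf// gt_eqF.
by rewrite -RintegralZl//; apply: eq_Rintegral => t _; rewrite -hE.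
Qed.

End Resolvent.

(** * The exit from a star *)

Lemma continuous_left_const {R : realType} (h : R -> R) (c t : R) : continuous h -> 0 < t ->
  (forall s, 0 <= s < t -> h s = c) -> h t = c.
Proof.
move=> ch t0 hc; apply/eqP; rewrite -subr_eq0 -normr_eq0 eq_le normr_ge0 andbT.
rewrite leNgt; apply/negP => p0.
have /cvgrPdist_lt/(_ _ p0)[e /= e0 he] := ch t.
pose s := Num.max 0 (t - e / 2).
have s0 : 0 <= s by rewrite le_max lexx.
have st : s < t by rewrite gt_max t0/=; lra.
have se : t - e / 2 <= s by rewrite le_max lexx orbT.
have hs : ball_ Num.norm t e s by rewrite /ball_/= gtr0_norm ?subr_gt0//; lra.
have hst : h s = c by apply: hc; rewrite s0.
by have /= := he s hs; rewrite hst ltxx.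
Qed.

(** This is how [killed_mass] enters: a constant source collected until time [t]. *)
Lemma discount_killed {R : realType} (alpha c : R) (t : \bar R) : 0 < alpha -> (0 <= t)%E ->
  \int[@lebesgue_measure R]_s (exponential_pdf alpha s * (if (s%:E < t)%E then c else 0)) =
  c * killed_mass alpha t.
Proof.
move=> a0; case: t => [r|_|//].
  rewrite lee_fin => r0 /=; under eq_Rintegral do rewrite lte_fin.
  have := discount_split a0 (h := cst c) (K := `|c|) r0 (@measurable_cst _ _ _ _ _ _) (fun=> lexx _).
  rewrite /= !Rintegral_discount_cst// => h; rewrite mulrBr mulr1 [X in X - _]h; ring.
rewrite /= mulr1; under eq_Rintegral do rewrite ltry.
exact: Rintegral_discount_cst.
Qed.

(** * Confinement to the open star *)

Section Star.
Context {R : realType} {V : countType} (adj : rel V) (wt rho : V -> V -> R).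
Hypothesis Hgraph : weighted_graph adj wt.
Hypothesis Hrho : is_distance rho.
Local Notation M := (adapted_X_loop adj wt rho).
Local Notation E := (mg_edge M).
Local Notation opc := (one_point_compactification (mg_point M)).
Local Notation GE := (graph_edge adj).
Local Notation m := (@lebesgue_measure R).
Local Notation vtx := (@Vtx R M).
Local Notation hat := (@hat R V adj wt rho).

Let len1 (e : E) : mg_len e = 1. Proof. by []. Qed.
Let len_gt0 (e : E) : 0 < mg_len e. Proof. by rewrite len1. Qed.
Let loop : V -> E := inr.
Let src_loop (v : V) : mg_src (loop v) = v. Proof. by []. Qed.

Variable x : V.

Definition star_edges : set E := inl @` star x `|` [set inr x].

Lemma hat_ge0 z : 0 <= hat x z.
Proof.
case: z => [[u|e t h]|//]; first by rewrite /hat/=; case: (u == x).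
have /andP[t0 t1] := h; rewrite len1 in t1.
rewrite /hat/= /quad_edge; case: e h => [e|u] h /=.
  rewrite oppr0 mul0r addr0.
  by case: (_ == x); case: (_ == x); rewrite /= ?mul1r ?mul0r; lra.
rewrite (_ : (inr u == _) = (u == x))//; case: (u == x) => /=; last lra.
by have : t * (1 - t) < 1; [nra|lra].
Qed.

Lemma hat_gt0_inner e (t : R) (h : 0 < t < mg_len e) :
  0 < hat x (Some (Inner h)) <-> star_edges e.
Proof.
have /andP[t0 t1] := h; rewrite len1 in t1.
rewrite /hat/= /quad_edge; case: e h => [e|u] h /=.
  rewrite oppr0 mul0r addr0; split.
    have [e1|e1] := eqVneq (sval e).1 x; first by move=> _; left; exists e => //; left.
    have [e2|e2] := eqVneq (sval e).2 x; first by move=> _; left; exists e => //; right.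
    by rewrite /= !mul0r addr0 ltxx.
  have sx : star_edges (inl e) -> star x e by move=> [[e' e'x [<-]]|].
  move=> /sx[ex|ex]; change (sval e) with (val e); rewrite ex eqxx /=.
    by case: (_ == x) => /=; lra.
  by case: (_ == x) => /=; lra.
rewrite (_ : (inr u == _) = (u == x))//; have [->|ux] := eqVneq u x; split => //=.
- by move=> _; right.
- by move=> _; have : t * (1 - t) < 1; [nra|lra].
- by lra.
- by move=> [[]//|[ux']]; rewrite ux' eqxx in ux.
Qed.

(** The centre is covered too, since the value of [step] at a vertex is that of its loop, which
    belongs to [star_edges]. *)
Lemma step_star (c : E -> R) (b : R) z : (forall e, star_edges e -> c e = b) ->
  0 < hat x z -> ext0 (@step R V adj wt rho c) z = b.
Proof.
move=> cb; case: z => [[u|e t h]|]; last by rewrite ltxx.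
  rewrite /hat/=; have [->|_] := eqVneq u x; last by rewrite ltxx.
  by move=> _; apply: cb; right.
by move=> /hat_gt0_inner; exact: cb.
Qed.

(** A continuous function equal to [1] on the open star and to [0] at the cemetery, so that a path
    cannot pass directly from one to the other. *)
Definition closed_star : opc -> R :=
  ext0 (@quad R M (fun u => ((u == x) || adj x u)%:R) (fun=> 0)).

Lemma closed_star_continuous : continuous closed_star.
Proof.
pose N := [set x] `|` [set y | adj x y].
have fN : finite_set N.
  by rewrite finite_setU; split; [exact: finite_set1|exact: adj_locally_finite Hgraph x].
pose F : set E := inl @` (\bigcup_(v in N) star v) `|` inr @` N.
have fF : finite_set F.
  rewrite finite_setU; split; last exact: finite_image.
  by apply/finite_image/bigcup_finite => // v _; exact: (finite_star Hgraph).
apply: (ext0_continuous len_gt0 fF); first exact: quad_continuous.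
have out u : ~ N u -> ((u == x) || adj x u)%:R = 0 :> R.
  by move=> nN; case: eqP => [ux|_]; [exfalso; apply: nN; left|
    case: (boolP (adj x u)) => // xu; exfalso; apply: nN; right].
move=> z; apply: (quad_out len1 src_loop) => -[e|u] nF /=.
  by split=> //; apply: out => Ne; apply: nF; left; exists e => //;
    [exists (val e).1|exists (val e).2] => //; [left|right].
by split=> //; apply: out => Nu; apply: nF; right; exists u.
Qed.

Lemma closed_star_eq1 z : 0 < hat x z -> closed_star z = 1.
Proof.
case: z => [[u|e t h]|]; last by rewrite ltxx.
  by rewrite /hat/=; have [->|_] := eqVneq u x; rewrite ?ltxx//= /closed_star/= eqxx.
move=> /hat_gt0_inner ex; rewrite /closed_star/= /quad_edge mul0r addr0.
have {ex}[-> ->] : (mg_src e == x) || adj x (mg_src e) /\ (mg_tgt e == x) || adj x (mg_tgt e).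
  case: ex => [[e' [<-|<-] <-]|->] /=; rewrite ?eqxx//.
    by rewrite (edge_ends e') orbT.
  by rewrite (adj_sym Hgraph) (edge_ends e') orbT.
by rewrite /= !mul1r subrK.
Qed.

Section Confinement.
Context {d : measure_display} {W : measurableType d}.
Variables (P : mg_point M -> probability W R) (Y : R -> W -> opc).
Hypothesis smd : strong_markov_diffusion P Y.
Local Notation T := (vertex_hitting_time Y x).

(** [hat x] is positive exactly on the open star of [x]: a path leaving the star
    is, when it leaves, in the closed star but not in the star, hence at a neighbour. *)
Lemma confined w (t : R) : Y 0 w = Some (vtx x) -> 0 <= t -> (t%:E < T w)%E ->
  0 < hat x (Y t w).
Proof.
move=> Y0 t0 tT; rewrite lt_neqAle hat_ge0 andbT eq_sym; apply/eqP => ht.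
pose tau := zero_time Y (hat x) w.
have tau_t : (tau <= t%:E)%E by apply: first_time_le.
have tau0 : (0 <= tau)%E by exact: first_time_ge0.
have tauE : tau = (fine tau)%:E by rewrite fineK// ge0_fin_numE// (le_lt_trans tau_t)// ltry.
set r := fine tau in tauE.
have contY := bm_continuous smd.
have [r0 hr] := zero_time_attained contY (@hat_continuous _ _ _ _ _ Hgraph x) hat_ge0 tauE.
have rgt0 : 0 < r.
  rewrite lt_neqAle r0 andbT; apply/eqP => r0'; move: hr; rewrite -r0' Y0.
  by rewrite (hat_eq1 Hgraph _ _).2//; exact/eqP/oner_neq0.
have before s : 0 <= s < r -> 0 < hat x (Y s w).
  move=> /andP[s0 sr]; rewrite lt_neqAle hat_ge0 andbT eq_sym; apply/eqP => hs.
  have : (tau <= s%:E)%E by apply: first_time_le.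
  by rewrite tauE lee_fin leNgt sr.
(* A continuous function that is constant on the star keeps its value at the first zero [r] of
   [hat x] along the path. *)
have limit (g : opc -> R) c : continuous g -> (forall z, 0 < hat x z -> g z = c) -> g (Y r w) = c.
  move=> cg gc; have := continuous_left_const (path_continuous contY (w := w) cg) rgt0.
  move=> /(_ c) h; move: h; rewrite path_clampE// => -> // s s01.
  by have /andP[s0 _] := s01; rewrite path_clampE// gc// before.
have noT v : v <> x -> Y r w <> Some (vtx v).
  move=> vx Yr; have : (T w <= r%:E)%E by apply: first_time_le => //; exists v.
  by rewrite leNgt (le_lt_trans _ tT)// -tauE.
(* The position at time [r] is neither [x], where [hat x] is [1], nor another vertex, as [r < T].
   The interior of an edge outside the star is excluded by its bump, which vanishes on the star, and
   the cemetery by [closed_star]. *)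
case Yr : (Y r w) => [[v|e s h]|].
- have [vx|vx] := eqVneq v x; last by apply: (noT v) Yr; exact/eqP.
  by move: hr; rewrite Yr vx (hat_eq1 Hgraph _ _).2//; exact/eqP/oner_neq0.
- have : @edge_bump R V adj wt rho e (Y r w) = 0.
    apply: (limit _ 0 (@edge_bump_continuous R V adj wt rho e)).
    case=> [[v|e' s' h']|]//; move=> /hat_gt0_inner e'x; rewrite /edge_bump/= /quad_edge.
    rewrite !mul0r !add0r; case: eqP => [ee'|_]; last by rewrite mul0r.
    move: hr; rewrite Yr => hr; move: e'x; rewrite ee' => /(hat_gt0_inner h).2.
    by rewrite hr ltxx.
  by rewrite Yr => /eqP; rewrite gt_eqF// edge_bump_gt0.
- have := limit closed_star 1 (@closed_star_continuous) closed_star_eq1.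
  by rewrite Yr => /esym/eqP; rewrite oner_eq0.
Qed.

End Confinement.

End Star.

Lemma le_Rintegral_almost {R : realType} {d : measure_display} {W : measurableType d}
    (Q : probability W R) (A : set W) (f g : W -> R) : measurable A -> Q A = 1%E ->
  Q.-integrable setT (EFin \o f) -> Q.-integrable setT (EFin \o g) ->
  (forall w, A w -> f w <= g w) -> \int[Q]_w f w <= \int[Q]_w g w.
Proof.
move=> mA QA i_f ig fg; have mN : measurable (~` A) by exact: measurableC.
have QN : Q (~` A) = 0%E by rewrite probability_setC// QA subee.
have TA : setT `\` ~` A = A by rewrite setDE setCK setTI.
rewrite /Rintegral (negligible_integral mN measurableT i_f QN) (negligible_integral mN measurableT ig QN).
rewrite TA; apply: (@le_Rintegral _ _ _ Q A) => //.
  exact: integrableS i_f.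
exact: integrableS ig.
Qed.

Lemma discount_dist_le {R : realType} (alpha K : R) (h1 h2 h3 : R -> R) : 0 < alpha ->
  measurable_fun setT h1 -> measurable_fun setT h2 -> measurable_fun setT h3 ->
  (forall t, `|h1 t| <= K) -> (forall t, `|h2 t| <= K) -> (forall t, `|h3 t| <= K) ->
  (forall t, 0 <= t -> `|h1 t - h2 t| <= h3 t) ->
  `|\int[@lebesgue_measure R]_t (exponential_pdf alpha t * h1 t) -
    \int[@lebesgue_measure R]_t (exponential_pdf alpha t * h2 t)| <=
  \int[@lebesgue_measure R]_t (exponential_pdf alpha t * h3 t).
Proof.
move=> a0 m1 m2 m3 h1K h2K h3K h12.
have i1 := discount_integrable a0 m1 h1K.
have i2 := discount_integrable a0 m2 h2K.
have i3 := discount_integrable a0 m3 h3K.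
have iB := integrableB measurableT i1 i2.
rewrite -RintegralB// (le_trans (le_normr_Rintegral _ iB))//.
apply: le_Rintegral => //; first exact: integrable_norm.
move=> t _; rewrite -mulrBr normrM (ger0_norm (exponential_pdf_ge0 (ltW a0) _)).
have [t0|t0] := leP 0 t; last by rewrite lt0_exponential_pdf// !mul0r.
by rewrite ler_wpM2l ?h12// exponential_pdf_ge0// ltW.
Qed.

(** * The estimate for small discount rates *)

Section StarEstimate.
Context {R : realType} {V : countType} (adj : rel V) (wt rho : V -> V -> R).
Hypothesis Hgraph : weighted_graph adj wt.
Hypothesis Hrho : is_distance rho.
Local Notation M := (adapted_X_loop adj wt rho).
Local Notation E := (mg_edge M).
Local Notation opc := (one_point_compactification (mg_point M)).
Local Notation GE := (graph_edge adj).
Local Notation m := (@lebesgue_measure R).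
Local Notation vtx := (@Vtx R M).
Local Notation hat := (@hat R V adj wt rho).

Variables (a : V -> R) (k0 : GE -> R) (F0 : set GE) (S : set V).
Hypotheses (finF0 : finite_set F0) (finS : finite_set S).
Hypothesis endsF0 : forall e, F0 e -> S (val e).1 /\ S (val e).2.
Hypothesis outF0 : forall e, ~ F0 e -> [/\ a (val e).1 = 0, a (val e).2 = 0 & k0 e = 0].
Hypothesis outS : forall v, ~ S v -> a v = 0.

Context {d : measure_display} {W : measurableType d}.
Variables (P : mg_point M -> probability W R) (Y : R -> W -> opc).
Hypothesis HY : is_brownian_motion P Y.

Variables x j : V.
Hypothesis jx : j <> x.
Hypothesis a_eq0 : forall v, v <> x -> v <> j -> a v = 0.
Variable b : R.
(** In other words, [laplacian] is [- b] on the open star of [x]. *)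
Hypothesis curvature_star : forall e, @star_edges R V adj wt rho x e ->
  @curvature R V adj wt rho a k0 F0 e = b * mg_dens e.

Local Notation T := (vertex_hitting_time Y (x : mg_vertex M)).
Local Notation Px := (P (vtx x)).
Local Notation exit_at := (exit_at Y hat x).

Let countV : countable [set: V]. Proof. exact: countableP. Qed.

Let smd : strong_markov_diffusion P Y. Proof. by have [] := HY. Qed.

Let T0 w : (0 <= T w)%E. Proof. exact: first_time_ge0. Qed.

Let mT : measurable_fun setT T.
Proof.
exact: (hitting_measurable smd countV
    (@hat_continuous _ _ _ _ _ Hgraph) (@hat_le1 _ _ _ _ _ Hgraph) (@hat_eq1 _ _ _ _ _ Hgraph)).
Qed.

Let start : set W := Y 0 @^-1` [set Some (vtx x)].

Let measurable_start : measurable start.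
Proof.
have mh : measurable_fun setT (fun w => hat x (Y 0 w)).
  have mY := bm_measurable smd (lexx 0).
  exact: (measurableT_comp (continuous_borel_measurable (@hat_continuous _ _ _ _ _ Hgraph x)) mY).
rewrite (_ : start = (fun w => hat x (Y 0 w)) @^-1` [set 1]).
  by rewrite -[X in measurable X]setTI; exact: mh.
by apply/seteqP; split => w /=; [move=> ->; exact/hat_eq1|move/(hat_eq1 Hgraph)].
Qed.

(** Before [T] the source is [alpha u + b]. Replacing it by [b] in [dynkin_formula] costs at most
    [alpha] times the supremum of [|u|], collected until [T]. *)
Lemma star_estimate : exists K, forall alpha, 0 < alpha ->
  `|alpha * a x - alpha * a j * (\int[Px]_(w in exit_at j) expR (- alpha * fine (T w)))
    - b * \int[Px]_w killed_mass alpha (T w)| <=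
  alpha * K * \int[Px]_w killed_mass alpha (T w).
Proof.
have [K hK] := @potential_bounded R V adj wt rho a k0 F0 S finF0 finS endsF0 outF0 outS.
exists K => alpha a0.
pose f := ext0 (@source R V adj wt rho a k0 F0 alpha).
have [K' fK] : exists K', forall z, `|f z| <= K'.
  exact: (@source_bounded R V adj wt rho Hgraph a k0 F0 S finF0 finS endsF0 outF0 outS alpha).
have mf := @source_borel R V adj wt rho Hgraph a k0 F0 S finF0 finS endsF0 outF0 outS alpha.
have jf := @source_path R V adj wt rho Hgraph a k0 F0 S finF0 finS endsF0
    outF0 outS d W P Y HY alpha.
have lap v := @laplace_source R V adj wt rho Hgraph Hrho a k0 F0 S finF0 finS endsF0
    outF0 outS d W P Y HY alpha a0 v.
have dyn := @dynkin_formula R M d W P Y smd countV hat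
    (@hat_continuous _ _ _ _ _ Hgraph) (@hat_le1 _ _ _ _ _ Hgraph) (@hat_eq1 _ _ _ _ _ Hgraph)
    x (@vertex_separated _ _ _ _ _ Hgraph x) f K' mf jf fK alpha a0 j jx.
have {}dyn := dyn (fun v vx vj => etrans (lap v) (etrans (congr1 _ (a_eq0 vx vj)) (mulr0 _))).
rewrite !lap in dyn.
have mk := @killed_measurable R M d W P Y smd countV hat
    (@hat_continuous _ _ _ _ _ Hgraph) (@hat_le1 _ _ _ _ _ Hgraph) (@hat_eq1 _ _ _ _ _ Hgraph)
    x f jf.
have kK := killed_bounded Y (x : mg_vertex M) fK.
set J := \int[Px]_w \int[m]_t _ in dyn.
set D := \int[Px]_(w in exit_at j) _ in dyn *.
pose G w := \int[m]_t (exponential_pdf alpha t * killed Y (x : mg_vertex M) f (t, w)).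
have -> : alpha * a x - alpha * a j * D - b * \int[Px]_w killed_mass alpha (T w) =
    J - b * \int[Px]_w killed_mass alpha (T w) by rewrite dyn; ring.
have ikm := killed_mass_integrable Px mT T0 a0 measurableT.
have iG : Px.-integrable setT (EFin \o G).
  apply: (bounded_integrable Px measurableT (K := K')).
    exact: (discount_measurable a0 Px mk kK).
  by move=> w; exact: (discount_bounded a0 mk kK).
have iZ c : Px.-integrable setT (EFin \o (fun w => c * killed_mass alpha (T w))).
  exact: (integrableZl measurableT c ikm).
have iD : Px.-integrable setT (EFin \o (fun w => G w - b * killed_mass alpha (T w))).
  exact: (integrableB measurableT iG (iZ b)).
rewrite -RintegralZl// -RintegralB// (le_trans (le_normr_Rintegral _ iD))//.
(* The path starts at [x] only almost surely, and confinement requires this start. *)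
rewrite -RintegralZl//; apply: (le_Rintegral_almost measurable_start) => //.
- exact: bm_start smd (vtx x).
- exact: integrable_norm.
move=> w Yw.
have star t : 0 <= t -> (t%:E < T w)%E -> f (Y t w) =
    alpha * ext0 (@potential R V adj wt rho a k0 F0) (Y t w) + b.
  move=> t0 tT; rewrite /f ext0_source; congr (_ + _).
  rewrite laplacian_step (step_star (x := x) (b := - b)) ?opprK//.
    by move=> e ex; rewrite curvature_star// mulfK// gt_eqF// mg_dens_gt0.
  exact: (confined Hgraph smd Yw t0 tT).
rewrite /G -(discount_killed b a0 (T0 w)) -(discount_killed (alpha * K) a0 (T0 w)).
have mlt : measurable_fun setT (fun t : R => (t%:E < T w)%E).
  by apply: (@measurable_fun_bool _ _ _ _ true); exact: measurable_lte.
have K0 : 0 <= K by apply: le_trans (hK None).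
have normif (P0 : bool) (c c' : R) : `|c| <= c' -> `|if P0 then c else 0| <= c'.
  by case: P0; rewrite ?normr0// => /(le_trans _) -> .
(* A crude common bound for the three integrands; it ensures integrability and does not enter the
   estimate. *)
pose B := `|b| + alpha * K + K'.
have B0 : 0 <= K' by apply: le_trans (fK None).
apply: (@discount_dist_le _ _ B) => //.
- exact: (measurable_slice2 mk w).
- exact: measurable_fun_ifT.
- exact: measurable_fun_ifT.
- by move=> t; rewrite (le_trans (kK _))// lerDr addr_ge0// mulr_ge0// ltW.
- by move=> t; apply: normif; rewrite /B -addrA lerDl addr_ge0// mulr_ge0// ltW.
- move=> t; apply: normif; rewrite ger0_norm; last by rewrite mulr_ge0// ltW.
  by rewrite /B addrAC lerDr addr_ge0.
- move=> t t0; rewrite /killed/=; case: ifP => [tT|_]; last by rewrite subrr normr0.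
  rewrite path_clampE// star// addrK normrM (gtr0_norm a0).
  by rewrite ler_wpM2l// ltW.
Qed.

End StarEstimate.

(** * Mean exit time and exit probabilities *)

Section ExitLaw.
Context {R : realType} {V : countType} (adj : rel V) (wt rho : V -> V -> R).
Hypothesis Hgraph : weighted_graph adj wt.
Hypothesis Hrho : is_distance rho.
Local Notation M := (adapted_X_loop adj wt rho).
Local Notation E := (mg_edge M).
Local Notation opc := (one_point_compactification (mg_point M)).
Local Notation GE := (graph_edge adj).
Local Notation vtx := (@Vtx R M).
Local Notation hat := (@hat R V adj wt rho).
Local Notation deg := (vertex_weight adj wt).

Lemma star_sym (f : V -> V -> R) x (e : GE) : (forall u v, f u v = f v u) -> star x e ->
  f (val e).1 (val e).2 = f x (other_end x e).
Proof.
move=> fC; rewrite /star/other_end/=; have [->//|e1] := eqVneq (val e).1 x.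
by case=> [e1x|->]; [rewrite e1x eqxx in e1|exact: fC].
Qed.

Lemma kirchhoff_defectE (a : V -> R) (k0 : GE -> R) (F0 : set GE) (x : V) (kk : V -> R) :
  finite_set F0 -> star x `<=` F0 -> (forall e, star x e -> k0 e = kk (other_end x e)) ->
  kirchhoff_defect wt a k0 F0 x = \sum_(y \in [set y | adj x y]) wt x y * (a y - a x + kk y).
Proof.
move=> finF0 sub kE; rewrite (reindex_fsbig _ _ _ _ (star_bij Hgraph x)).
rewrite /kirchhoff_defect -(fsbig_widen (star x) F0)//; last first.
  move=> e [_ nx]; rewrite /preimage/=.
  have [e1|_] := eqVneq (sval e).1 x; first by case: nx; left.
  have [e2|_] := eqVneq (sval e).2 x; first by case: nx; right.
  by rewrite !mulr0 addr0 mulr0.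
apply: eq_fsbigr => e; rewrite inE => xe.
rewrite /conductance (star_sym (wt_sym Hgraph) xe); congr (_ * _).
rewrite -kE// /slope_src /slope_tgt /other_end; have := edge_ends_neq Hgraph e.
have [->|e1] := eqVneq (val e).1 x.
  by rewrite eq_sym => /negbTE ->; rewrite mulr1 mulr0 addr0.
by case: xe => [e1x|->]; [rewrite e1x eqxx in e1|rewrite eqxx mulr0 add0r mulr1].
Qed.

Lemma vertex_weight_gt0 x y : adj x y -> 0 < deg x.
Proof.
move=> xy; rewrite /vertex_weight (fsbigD1 y)//=; last exact: adj_locally_finite Hgraph x.
by rewrite ltr_pwDl ?(wt_gt0 Hgraph)// fsumr_ge0// => z _; exact: wt_ge0 Hgraph x z.
Qed.

Context {d : measure_display} {W : measurableType d}.
Variables (P : mg_point M -> probability W R) (Y : R -> W -> opc).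
Hypothesis HY : is_brownian_motion P Y.
Variables x j : V.
Hypothesis xj : adj x j.

Local Notation T := (vertex_hitting_time Y (x : mg_vertex M)).
Local Notation Px := (P (vtx x)).
Local Notation exit_at := (exit_at Y hat x).

Let jx : j <> x.
Proof. by move=> jx; move: xj; rewrite jx (adj_irr Hgraph). Qed.

Let deg_gt0 : 0 < deg x. Proof. exact: vertex_weight_gt0 xj. Qed.

Let finN : finite_set [set y | adj x y]. Proof. exact: adj_locally_finite Hgraph x. Qed.

Let countV : countable [set: V]. Proof. exact: countableP. Qed.

Let smd : strong_markov_diffusion P Y. Proof. by have [] := HY. Qed.

Let T0 w : (0 <= T w)%E. Proof. exact: first_time_ge0. Qed.

Let mT : measurable_fun setT T.
Proof.
exact: (hitting_measurable smd countV
    (@hat_continuous _ _ _ _ _ Hgraph) (@hat_le1 _ _ _ _ _ Hgraph) (@hat_eq1 _ _ _ _ _ Hgraph)).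
Qed.

(** The curvature of the loop at [x] is minus the Kirchhoff defect, so the last equation makes it
    equal to [b], as required on the star. The loops at other vertices take whatever curvature their
    vertex condition demands. *)
Lemma exit_estimate (a : V -> R) (k0 : GE -> R) (kk : V -> R) (b : R) :
  (forall v, v <> x -> v <> j -> a v = 0) ->
  (forall e, ~ star x e -> k0 e = 0) ->
  (forall e, star x e -> k0 e = kk (other_end x e)) ->
  (forall e, star x e -> k0 e = b * @mg_dens R M (inl e)) ->
  \sum_(y \in [set y | adj x y]) wt x y * (a y - a x + kk y) = - b ->
  exists K, forall alpha, 0 < alpha ->
  `|alpha * a x - alpha * a j * (\int[Px]_(w in exit_at j) expR (- alpha * fine (T w)))
    - b * \int[Px]_w killed_mass alpha (T w)| <=
  alpha * K * \int[Px]_w killed_mass alpha (T w).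
Proof.
move=> a0 k0out kE kb Kb.
(* Only [x] and [j] can carry a nonzero value of [a], so every edge outside these two stars is
   flat. *)
pose F0 : set GE := star x `|` star j.
have finF0 : finite_set F0 by rewrite finite_setU; split; exact: (finite_star Hgraph).
pose S : set V := [set x; j] `|` ((fun e : GE => (val e).1) @` F0 `|` (fun e : GE => (val e).2) @` F0).
have finS : finite_set S.
  rewrite /S !finite_setU; do !split; [exact: finite_set1|exact: finite_set1| |];
    exact: finite_image.
apply: (@star_estimate R V adj wt rho Hgraph Hrho a k0 F0 S finF0 finS _ _ _ d W P Y HY x j jx a0 b) => //.
- by move=> e Fe; split; right; [left|right]; exists e.
- move=> e nF; split; last by apply: k0out => xe; apply: nF; left.
    by apply: a0 => ev; apply: nF; [left|right]; left.
  by apply: a0 => ev; apply: nF; [left|right]; right.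
- by move=> v nS; apply: a0 => vE; apply: nS; left; rewrite vE; [left|right].
- move=> e [[e' xe' <-]|->]; first exact: kb.
  by rewrite /= mulr1 (kirchhoff_defectE a finF0 _ kE) ?Kb ?opprK// => e' xe'; left.
Qed.

Lemma mean_exit_time : (\int[Px]_w T w =
  ((1 + \sum_(y \in [set y | adj x y]) (wt x y * rho x y ^+ 2)) / deg x)%:E)%E.
Proof.
(* [A] solves the vertex equation with [b = 1] and [a] zero off [x]: [s2 - A * deg x = - 1]. *)
set s2 := \sum_(y \in _) _; pose A := (1 + s2) / deg x.
have A0 : 0 <= A.
  rewrite divr_ge0 ?ltW// ltr_wpDr// /s2 fsumr_ge0// => y _.
  by rewrite mulr_ge0 ?sqr_ge0//; exact: wt_ge0 Hgraph x y.
pose a v := if v == x then A else 0.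
pose k0 (e : GE) := if e \in star x then rho (val e).1 (val e).2 ^+ 2 else 0.
have [|||||K hK] := @exit_estimate a k0 (fun y => rho x y ^+ 2) 1.
- by move=> v /eqP/negbTE vx _; rewrite /a vx.
- by move=> e xe; rewrite /k0 memNset.
- move=> e xe; rewrite /k0 mem_set//; congr (_ ^+ 2).
  exact: (star_sym (distance_sym Hrho) xe).
- by move=> e xe; rewrite /k0 mem_set// mul1r.
- rewrite (eq_fsbigr (fun y => wt x y * rho x y ^+ 2 - A * wt x y)); last first.
    move=> y; rewrite inE/= => xy; rewrite /a eqxx ifF; last first.
      by apply/eqP => yx; move: xy; rewrite yx (adj_irr Hgraph).
    ring.
  rewrite fsbig_finite// sumrB -mulr_sumr -!fsbig_finite//.
  rewrite -/s2 -/(vertex_weight adj wt x) /A divfK ?gt_eqF//; ring.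
apply: (expectation_of_killed_mass mT T0 (K := K)) => // alpha alpha0.
have := hK _ alpha0; rewrite /a eqxx ifF; last exact/eqP.
by rewrite mulr0 mul0r subr0 mul1r.
Qed.

Lemma exit_probability : Px (exit_at j) = (wt x j / deg x)%:E.
Proof.
(* [p] solves the vertex equation with [b = 0] and flat edges: [wt x j - p * deg x = 0]. *)
pose p := wt x j / deg x.
pose a v := if v == x then p else if v == j then 1 else 0.
have [|||||K hK] := @exit_estimate a (fun=> 0) (fun=> 0) 0.
- by move=> v /eqP/negbTE vx /eqP/negbTE vj; rewrite /a vx vj.
- by [].
- by [].
- by move=> e xe; rewrite mul0r.
- rewrite (eq_fsbigr (fun y => wt x y * (y == j)%:R - p * wt x y)); last first.
    move=> y; rewrite inE/= => xy; rewrite /a eqxx ifF; last first.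
      by apply/eqP => yx; move: xy; rewrite yx (adj_irr Hgraph).
    by case: (y == j); rewrite /=; ring.
  rewrite fsbig_finite// sumrB -mulr_sumr -!fsbig_finite// -/(vertex_weight adj wt x).
  rewrite (fsbigD1 j)//= eqxx fsbig1; last by move=> y [_ /eqP/negbTE ->]; rewrite mulr0.
  by rewrite /= mulr1 addr0 /p divfK ?gt_eqF// subrr oppr0.
have mexit : measurable (exit_at j).
  exact: (measurable_exit_at smd countV
    (@hat_continuous _ _ _ _ _ Hgraph) (@hat_le1 _ _ _ _ _ Hgraph) (@hat_eq1 _ _ _ _ _ Hgraph)).
apply: (probability_of_killed_mass mT T0 mexit _ mean_exit_time (K := K)) => [w []//|alpha alpha0].
have := hK _ alpha0; rewrite /a eqxx eqxx ifF; last exact/eqP.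
rewrite mulr1 mul0r subr0 -mulrBr normrM (gtr0_norm alpha0) -mulrA ler_pM2l//.
Qed.

End ExitLaw.

(** * The first jump of the chain *)

Section FirstJump.
Context {R : realType} {V : countType} (adj : rel V) (wt : V -> V -> R).
Context {d : measure_display} {W : measurableType d}.
Local Notation deg := (vertex_weight adj wt).
Variables (P : V -> probability W R) (X : R -> W -> option V).
Variables (Z : nat -> W -> V) (S : nat -> W -> R).
Hypothesis HX : jump_chain_realization adj wt P X Z S.

Local Notation T := (first_jump_time X).

Let S0 n w : 0 < S n w. Proof. exact: holding_time_gt0 HX n w. Qed.

(** The chain [Z] has no constraint outside a null set, and may stand still. *)
Let still n w : bool := [forall i : 'I_n.+1, Z i w == Z 0%N w].

Let stillP n w : reflect (forall i, (i <= n)%N -> Z i w = Z 0%N w) (still n w).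
Proof.
apply: (iffP forallP) => [h i ilen|h i]; last by apply/eqP/h; rewrite -ltnS.
by have /eqP := h (Ordinal (ilen : (i < n.+1)%N)).
Qed.

Let jump n w : R := \sum_(i < n) S i w.

Let jumpS n w : jump n.+1 w = jump n w + S n w.
Proof. exact: big_ord_recr. Qed.

Let jump_ge0 n w : 0 <= jump n w.
Proof. by apply: sumr_ge0 => i _; exact: ltW. Qed.

Let jump_mono w : {homo jump ^~ w : m n / (m <= n)%N >-> m <= n}.
Proof.
apply: homo_leq => //; first exact: le_trans.
by move=> n; rewrite jumpS lerDl ltW.
Qed.

Let before_jump n w (t : R) : still n w -> 0 <= t < jump n.+1 w -> X t w = Some (Z 0%N w).
Proof.
move=> /stillP st /andP[t0]; elim: n st => [|n IH] st tn.
  by apply: (jump_path HX); rewrite big_ord0 t0.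
have [tn'|tn'] := ltP t (jump n.+1 w).
  by apply: IH => // i ilen; apply: st; exact: leqW.
by rewrite -(st n.+1)//; apply: (jump_path HX); apply/andP.
Qed.

Let X0 w : X 0 w = Some (Z 0%N w).
Proof.
apply: (before_jump (n := 0%N)); first by apply/stillP => i; rewrite leqn0 => /eqP ->.
by rewrite lexx jumpS /jump big_ord0 add0r S0.
Qed.

Let at_jump n w : X (jump n w) w = Some (Z n w).
Proof.
have h : jump n w <= jump n w < jump n.+1 w by rewrite lexx jumpS ltrDl S0.
exact: (jump_path HX h).
Qed.

Lemma first_jump_at n w : still n w -> Z n.+1 w <> Z 0%N w -> T w = (jump n.+1 w)%:E.
Proof.
move=> st Zn; apply/eqP; rewrite eq_le; apply/andP; split.
  by apply: first_time_le; rewrite /= ?at_jump ?X0// => -[].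
apply: le_ereal_inf_tmp => _ [t [t0 /= Xt] <-]; rewrite lee_fin leNgt; apply/negP => tn.
by apply: Xt; rewrite X0 (before_jump st)// t0.
Qed.

(** If the chain never moves, the first change of [X] is the passage to [None] at the explosion
    time, the supremum of the jump times; without explosion both sides are infinite. *)
Lemma first_jump_never w : (forall n, Z n w = Z 0%N w) ->
  T w = ereal_sup (range (fun n => (jump n w)%:E)).
Proof.
move=> ZE; have st n : still n w by apply/stillP.
apply/eqP; rewrite eq_le; apply/andP; split; last first.
  apply: le_ereal_inf_tmp => _ [t [t0 /= Xt] <-]; apply: ge_ereal_sup => _ [n _ <-].
  rewrite lee_fin leNgt; apply/negP => tn; apply: Xt; rewrite X0 (@before_jump n)// t0/=.
  by rewrite (lt_le_trans tn)// jumpS lerDl ltW.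
set s := ereal_sup _.
have ub n : ((jump n w)%:E <= s)%E by apply: ereal_sup_ubound; exists n.
have s0 : (0 <= s)%E by apply: le_trans (ub 0%N); rewrite lee_fin.
case: s ub s0 => [r| |//] ub r0; last by rewrite leey.
rewrite lee_fin in r0; apply: first_time_le => //=.
by rewrite (jump_path_explosion HX) ?X0// => n; rewrite -lee_fin; exact: ub.
Qed.

Let measurable_Z n y : measurable [set w | Z n w = y].
Proof. exact: jump_chain_measurable HX n y. Qed.

Let countable_union (F : V -> set W) : (forall y, measurable (F y)) -> measurable (\bigcup_y F y).
Proof. by move=> mF; apply: countable_bigcupT_measurable. Qed.

Let measurable_return n : measurable [set w | Z n w = Z 0%N w].
Proof.
rewrite (_ : mkset _ = \bigcup_(y : V) ([set w | Z n w = y] `&` [set w | Z 0%N w = y])).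
  by apply: countable_union => y; exact: measurableI.
by apply/seteqP; split => w /= => [Zn|[y _ [-> ->]]//]; exists (Z 0%N w).
Qed.

Let measurable_still n : measurable (still n : set W).
Proof.
rewrite (_ : (still n : set W) = \bigcap_(i in `I_n.+1) [set w | Z i w = Z 0%N w]).
  by apply: fin_bigcap_measurable => // i _; exact: measurable_return.
by apply/seteqP; split => w; [move=> /stillP h i /=; rewrite ltnS; exact: h|
  move=> h; apply/stillP => i; rewrite -ltnS; exact: h].
Qed.

(** [T] is the limit of the sums of the holding times spent before the chain leaves its starting
    point; this covers the chains that never leave it. *)
Lemma first_jump_measurable : measurable_fun setT T.
Proof.
pose f n w : \bar R := (\sum_(i < n) (if still i w then S i w else 0))%:E.
apply: (@emeasurable_fun_cvg _ _ _ setT f) => [n|w _].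
  apply/measurable_EFinP; apply: measurable_sum => i; apply: measurable_fun_ifT => //.
    apply: (@measurable_fun_bool _ _ _ _ true).
    by rewrite setTI (_ : _ @^-1` _ = still i).
  exact: holding_time_measurable HX i.
have [st|/existsNP[n0 Zn0]] := pselect (forall n, Z n w = Z 0%N w).
  rewrite (first_jump_never st); rewrite (_ : (fun n => _) = fun n => (jump n w)%:E).
    apply: ereal_nondecreasing_cvgn => m n mn; rewrite lee_fin; exact: jump_mono.
  apply/funext => n; congr EFin; apply: eq_bigr => i _; rewrite ifT//.
  by apply/stillP => k _.
have /ex_minnP[[|n] /eqP Zn minn] : exists n, Z n w != Z 0%N w by exists n0; exact/eqP.
  by [].
have stn : still n w.
  by apply/stillP => i ilen; apply: contrapT => /eqP /minn; rewrite ltnNge ilen.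
rewrite (first_jump_at stn Zn); apply: cvg_near_cst; near=> k.
have nk : (n.+1 <= k)%N by near: k; exact: nbhs_infty_ge.
congr EFin; rewrite -(subnKC nk) big_split_ord/= [X in _ + X]big1 ?addr0 => [|i _].
  apply: eq_bigr => i _; rewrite ifT//; apply/stillP => l li.
  by move/stillP : stn; apply; rewrite (leq_trans li)// -ltnS.
by rewrite ifF//; apply/negP => /stillP/(_ n.+1 (leq_addr _ _)).
Unshelve. all: by end_near. Qed.

(** A chain that never moves contributes nothing: at a finite [T] it has exploded, so [X] is [None]
    there. *)
Lemma at_first_jump y : at_time X T (Some y) =
  \bigcup_n ((still n : set W) `&` [set w | Z n.+1 w = y] `\` [set w | Z 0%N w = y]).
Proof.
apply/seteqP; split => w.
  move=> [t Tt Xt]; have [st|/existsNP[n0 Zn0]] := pselect (forall n, Z n w = Z 0%N w).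
    have tn n : jump n w <= t.
      by rewrite -lee_fin -Tt (first_jump_never st); apply: ereal_sup_ubound; exists n.
    by move: Xt; rewrite (jump_path_explosion HX tn).
  have /ex_minnP[[|n] /eqP Zn minn] : exists n, Z n w != Z 0%N w by exists n0; exact/eqP.
    by [].
  have stn : still n w.
    by apply/stillP => i ilen; apply: contrapT => /eqP /minn; rewrite ltnNge ilen.
  have := first_jump_at stn Zn; rewrite Tt => -[tE].
  move: Xt; rewrite tE at_jump => -[Zy]; exists n => //; split => //.
  by move=> /= Z0y; apply: Zn; rewrite Zy Z0y.
move=> [n _ [[stn /= Zn] /= Z0]]; have Zn0 : Z n.+1 w <> Z 0%N w by rewrite Zn => /esym.
by exists (jump n.+1 w); [exact: first_jump_at|rewrite at_jump Zn].
Qed.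

Lemma measurable_at_first_jump y : measurable (at_time X T (Some y)).
Proof.
rewrite at_first_jump; apply: bigcup_measurable => n _; apply: measurableD => //.
exact: measurableI.
Qed.

Lemma first_jump_ge0 w : (0 <= T w)%E.
Proof. exact: first_time_ge0. Qed.

Hypothesis Hgraph : weighted_graph adj wt.
Variable x : V.
Hypothesis deg_gt0 : 0 < deg x.

Lemma jump_step y (t : R) : 0 <= t ->
  P x [set w | [/\ Z 0%N w = x, Z 1%N w = y & t < S 0%N w]] =
  (wt x y / deg x * expR (- deg x * t))%:E.
Proof.
move=> t0; have := jump_law HX x 1 (fun i => if i is 0%N then x else y) (fun=> t0).
rewrite big_ord_recl big_ord0 mulr1 /= eqxx => <-; congr (P x _).
apply/seteqP; split => w /= => [[Z0 Z1 St]|[h1 h2]].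
  by split => [[|[|i]]|[|i]].
by split; [exact: (h1 0%N)|exact: (h1 1%N)|exact: (h2 0%N)].
Qed.

(** An almost sure event under [P x], on which the first step is a genuine jump and [T] is the first
    holding time. *)
Let leaves : set W := [set w | Z 0%N w = x /\ adj x (Z 1%N w)].

Let measurable_gt (t : R) : measurable [set w | t < S 0%N w].
Proof.
have mS := holding_time_measurable HX 0.
rewrite (_ : mkset _ = S 0%N @^-1` `]t, +oo[%classic); last first.
  by apply/seteqP; split => w /=; rewrite in_itv/= andbT.
by rewrite -[X in measurable X]setTI; exact: mS.
Qed.

Lemma leaves_gt (t : R) : 0 <= t ->
  P x (leaves `&` [set w | t < S 0%N w]) = (expR (- deg x * t))%:E.
Proof.
move=> t0; have fN := adj_locally_finite Hgraph x.
pose F y := [set w | [/\ Z 0%N w = x, Z 1%N w = y & t < S 0%N w]].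
rewrite (_ : _ `&` _ = \bigcup_(y in [set y | adj x y]) F y); last first.
  apply/seteqP; split => w; first by move=> [[/= Z0 Z1] St]; exists (Z 1%N w).
  by move=> [y /= xy [Z0 Z1 St]]; split => //; split => //=; rewrite Z1.
rewrite measure_fin_bigcup//; last 2 first.
- apply/trivIsetP => y y' _ _ /eqP yy; apply/seteqP; split => // w.
  by move=> [[_ Zy _] [_ Zy' _]]; apply: yy; rewrite -Zy -Zy'.
- move=> y _; rewrite (_ : F y = [set w | Z 0%N w = x] `&` [set w | Z 1%N w = y] `&` [set w | t < S 0%N w]).
    by apply: measurableI => //; apply: measurableI.
  by apply/seteqP; split => w /= => [[]|[[]]].
rewrite (eq_fsbigr (fun y => (wt x y / deg x * expR (- deg x * t))%:E)); last first.
  by move=> y _; exact: jump_step.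
rewrite fsumEFin//; congr EFin; rewrite fsbig_finite//= -!mulr_suml -fsbig_finite//.
by rewrite -/(vertex_weight adj wt x) divff ?mul1r// gt_eqF.
Qed.

Let P_leaves : P x leaves = 1%E.
Proof.
have := leaves_gt (lexx 0); rewrite mulr0 expR0 => <-; congr (P x _).
by apply/seteqP; split => w //= [].
Qed.

Let measurable_leaves : measurable leaves.
Proof.
have fN := adj_locally_finite Hgraph x.
rewrite (_ : leaves = [set w | Z 0%N w = x] `&` \bigcup_(y in [set y | adj x y]) [set w | Z 1%N w = y]).
  by apply: measurableI => //; apply: fin_bigcup_measurable.
apply/seteqP; split => w; first by move=> [/= Z0 Z1]; split => //; exists (Z 1%N w).
by move=> [/= Z0 [y xy Z1]]; split => //; rewrite Z1.
Qed.

Let PI_leaves A : measurable A -> P x A = P x (leaves `&` A).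
Proof.
move=> mA; have P0 : P x (~` leaves) = 0%E by rewrite probability_setC// P_leaves subee.
rewrite -[in LHS](setIT A) -(setUv leaves) setIUr measureU//; last 3 first.
- exact: measurableI.
- by apply: measurableI => //; exact: measurableC.
- by rewrite setIACA setICr setI0.
rewrite [X in (_ + X)%E](_ : _ = 0%E) ?adde0 1?setIC//.
apply/eqP; rewrite -measure_le0 -P0 le_measure ?inE//.
- by apply: measurableI => //; exact: measurableC.
- exact: measurableC.
Qed.

(** The mean is the integral of the tail [exp (- deg x * r)], which is the exponential density
    divided by its rate. *)
Lemma mean_holding_time : (\int[P x]_w (S 0%N w)%:E = (deg x)^-1%:E)%E.
Proof.
have mS := holding_time_measurable HX 0.
have S0fun : S 0%N \in mfun by exact: mem_set.
pose S' : {RV (P x) >-> R} := mfun_Sub S0fun.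
have := @ge0_expectation_ccdf _ _ _ (P x) S' (fun w => ltW (S0 0 w)).
rewrite expectation_def => ->.
have ccdfE r : 0 <= r -> ccdf S' r = (expR (- deg x * r))%:E.
  move=> r0; rewrite -leaves_gt// -PI_leaves//; congr (P x _).
  by apply/seteqP; split => w /=; rewrite /preimage/= in_itv/= andbT.
have kE r : (fun r => ((deg x)^-1%:E * (exponential_pdf (deg x) r)%:E)%E) r =
    ((fun r => ccdf S' r) \_ `[0%R, +oo[) r.
  rewrite patchE; have [r0|r0] := leP 0 r.
    rewrite ifT; last by rewrite inE/= in_itv/= r0.
    by rewrite ccdfE// exponential_pdfE// -EFinM mulKf// gt_eqF.
  rewrite lt0_exponential_pdf// mule0 ifF//.
  by apply/negbTE; rewrite notin_setE/= in_itv/= andbT; apply/negP; rewrite -ltNge.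
transitivity (\int[@lebesgue_measure R]_r ((deg x)^-1%:E * (exponential_pdf (deg x) r)%:E))%E.
  by rewrite integral_mkcond; apply: eq_integral => r _; rewrite -kE.
rewrite ge0_integralZl//.
- by rewrite integral_exponential_pdf// mule1.
- by apply/measurable_EFinP; exact: measurable_exponential_pdf.
- by move=> r _; rewrite lee_fin exponential_pdf_ge0// ltW.
- by rewrite lee_fin invr_ge0 ltW.
Qed.

Lemma mean_first_jump : (\int[P x]_w T w = (deg x)^-1%:E)%E.
Proof.
have P0 : P x (~` leaves) = 0%E by rewrite probability_setC// P_leaves subee.
have mN : measurable (~` leaves) by exact: measurableC.
rewrite -mean_holding_time.
rewrite (ge0_negligible_integral mN measurableT first_jump_measurable (fun w _ => first_jump_ge0 w) P0).
have mS : measurable_fun setT (EFin \o S 0%N) by apply/measurable_EFinP; exact: holding_time_measurable HX 0.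
rewrite [RHS](ge0_negligible_integral mN measurableT mS _ P0); last by move=> w _; rewrite lee_fin ltW.
apply: eq_integral => w; rewrite inE => -[_ /contrapT[/= Z0 Z1]].
rewrite (@first_jump_at 0) ?jumpS /jump ?big_ord0 ?add0r//.
  by apply/stillP => i; rewrite leqn0 => /eqP ->.
by rewrite Z0 => Z1x; move: Z1; rewrite Z1x (adj_irr Hgraph).
Qed.

Lemma first_jump_law y : adj x y -> P x (at_time X T (Some y)) = (wt x y / deg x)%:E.
Proof.
move=> xy; rewrite PI_leaves; last exact: measurable_at_first_jump.
have := jump_step y (lexx 0); rewrite mulr0 expR0 mulr1 => <-; congr (P x _).
apply/seteqP; split => w /=.
  move=> [[Z0 Z1] [t Tt Xt]]; split => //.
  have st0 : still 0 w by apply/stillP => i; rewrite leqn0 => /eqP ->.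
  have Z10 : Z 1%N w <> Z 0%N w by rewrite Z0 => Z1x; move: Z1; rewrite Z1x (adj_irr Hgraph).
  have := first_jump_at st0 Z10; rewrite Tt => -[tE].
  by move: Xt; rewrite tE at_jump => -[].
move=> [Z0 Z1 _]; split; first by split => //; rewrite Z1.
rewrite at_first_jump; exists 0%N => //; split; last first.
  by rewrite /= Z0 => xy'; move: xy; rewrite -xy' (adj_irr Hgraph).
by split => //; apply/stillP => i; rewrite leqn0 => /eqP ->.
Qed.

End FirstJump.

(** * Comparison of the two processes *)

Lemma distance_le_path {R : realType} {V : countType} (rho : V -> V -> R) (x : V) (p : seq V) :
  is_distance rho -> rho x (last x p) <= \sum_(e <- zip (x :: p) p) rho e.1 e.2.
Proof.
move=> Hrho; elim: p x => [|y p IH] x /=.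
  by rewrite big_nil (distance_eq0 Hrho _ _).2.
by rewrite big_cons/= (le_trans (distance_triangle Hrho _ y _))// lerD2l.
Qed.

(** Connectedness provides a path, so the infimum is over a nonempty set and not the default value
    [0]. *)
Lemma distance_le_path_metric {R : realType} {V : countType} (adj : rel V) (wt rho : V -> V -> R) x y :
  weighted_graph adj wt -> is_distance rho -> rho x y <= path_metric adj rho x y.
Proof.
move=> Hgraph Hrho; apply: lb_le_inf.
  by have [p px py] := adj_connected Hgraph x y; eexists; exists p.
by move=> _ [p [px <-] <-]; exact: distance_le_path.
Qed.

Theorem corollary4p5 (R : realType) (V : countType) (adj : rel V)
    (wt : V -> V -> R) (Hgraph : weighted_graph adj wt)
    (Htwo : exists x y : V, x <> y)
    (rho : V -> V -> R) (Hrho : is_distance rho) (Hadapted : adapted adj wt rho)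
    (dX : measure_display) (WX : measurableType dX)
    (PX : V -> probability WX R) (X : R -> WX -> option V)
    (HX : is_vsrw adj wt PX X)
    (dY : measure_display) (WY : measurableType dY)
    (PY : mg_point (adapted_X_loop adj wt rho) -> probability WY R)
    (Y : R -> WY ->
      one_point_compactification (mg_point (adapted_X_loop adj wt rho)))
    (HY : is_brownian_motion PY Y) :
  (exists2 C : R, 0 < C &
    forall x xj : V, adj x xj ->
      let vtx := @Vtx R (adapted_X_loop adj wt rho) in
      let Px := PX x in
      let Py := PY (vtx x) in
      let TX := first_jump_time X in
      let TY := vertex_hitting_time Y x in
      [/\ Py (at_time Y TY (Some (vtx xj))) = Px (at_time X TX (Some xj)),
          (\int[Px]_w TX w <= \int[Py]_w TY w)%E
        & (\int[Py]_w TY w <= (C + 1)%:E * \int[Px]_w TX w)%E]) /\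
  (forall x y : V, rho x y <= path_metric adj rho x y).
Proof.
split; last by move=> x y; exact: distance_le_path_metric Hgraph Hrho.
have [C0 C00 hC] := Hadapted; have [Z [S ZS]] := HX.
(* Adaptedness gives only [0 <= C0]; the added [1] makes the constant positive. *)
exists (C0 + 1) => [|x xj xxj /=]; first by rewrite ltr_wpDl.
have deg0 := vertex_weight_gt0 Hgraph xxj.
have xjx : xj <> x by move=> e; move: xxj; rewrite e (adj_irr Hgraph).
rewrite (mean_exit_time Hgraph Hrho HY xxj) (mean_first_jump ZS Hgraph deg0).
rewrite (first_jump_law ZS Hgraph deg0 xxj).
set s2 := \sum_(y \in _) _.
have s20 : 0 <= s2.
  by rewrite /s2 fsumr_ge0// => y _; rewrite mulr_ge0 ?sqr_ge0//; exact: wt_ge0 Hgraph x y.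
have s2C : s2 <= C0 := hC x.
split.
- have [smd _] := HY.
  rewrite (at_hitting_time smd
    (@hat_continuous _ _ _ _ _ Hgraph) (@hat_le1 _ _ _ _ _ Hgraph) (@hat_eq1 _ _ _ _ _ Hgraph) xjx).
  exact: (exit_probability Hgraph Hrho HY xxj).
- by rewrite lee_fin ler_pdivlMr// mulVf ?gt_eqF// lerDl.
- rewrite -EFinM lee_fin ler_wpM2r ?invr_ge0 ?ltW//.
  lra.
Qed.
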